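(* Let $\mathcal P$ and $\mathcal Q$ be differential graded operads and let $M$ be an operadic $\mathcal P$-$\mathcal Q$ quasi-torsor. Then there is a zig-zag of quasi-isomorphisms of operads and bimodules connecting the triple $(\mathcal P, M,\mathcal Q)$, consisting of the operads $\mathcal P$, $\mathcal Q$ and the $\mathcal P$-$\mathcal Q$-bimodule $M$, to the canonical operadic torsor $(\mathcal Q,\mathcal Q,\mathcal Q)$, where $\mathcal Q$ is regarded as a $\mathcal Q$-$\mathcal Q$-bimodule via its operadic composition.
   Context: Conventions: we work over a field $\mathbb K$ of characteristic zero; all vector spaces, $\mathbb S$-modules, operads, modules and bimodules are differential graded (dg), with homological conventions (differentials have degree $-1$). $V^d$ denotes the degree $d$ part of $V$. An $\mathbb S$-module is a collection $\mathcal P(N)$, $N=0,1,2,\dots$, of dg vector spaces with right actions of the symmetric groups $\mathbb S_N$; $\circ$ is the monoidal (composition) product of $\mathbb S$-modules, and operads are monoids for $\circ$ (in particular they are unital). A $\mathcal P$-$\mathcal Q$ operadic bimodule is an $\mathbb S$-module $M$ with a left action $\mathcal P\circ M\to M$ and a right action $M\circ\mathcal Q\to M$, both compatible with operadic composition and units, which commute with each other. A $\mathcal P$-$\mathcal Q$ quasi-torsor is an operadic dg $\mathcal P$-$\mathcal Q$-bimodule $M$ for which there is an element $\mathbf 1\in M^0(1)$ (arity one, degree zero) such that the canonical maps $$\mathcal P\to M,\quad p\mapsto p\circ(\mathbf 1,\dots,\mathbf 1),\qquad\qquad \mathcal Q\to M,\quad q\mapsto \mathbf 1\circ q$$ are quasi-isomorphisms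 (of dg $\mathbb S$-modules). It is a torsor if these maps are isomorphisms. A quasi-isomorphism of operads and bimodules from $(\mathcal P,M,\mathcal Q)$ to $(\mathcal P',M',\mathcal Q')$ (where $M$ is a $\mathcal P$-$\mathcal Q$-bimodule and $M'$ a $\mathcal P'$-$\mathcal Q'$-bimodule) consists of quasi-isomorphisms of dg operads $\mathcal P\to\mathcal P'$ and $\mathcal Q\to\mathcal Q'$ together with a quasi-isomorphism of dg $\mathbb S$-modules $M\to M'$ that intertwines the left and right actions along these operad morphisms. A zig-zag is a finite chain of such morphisms, pointing in either direction. *)

(* Defs.v *)
(* Mathematical Components; from Stdlib only the reflexive-symmetric-transitive
   closure of a relation is used. *)
From Stdlib Require Export Relation_Operators.
From mathcomp Require Export all_boot all_order all_fingroup all_algebra.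

Set Implicit Arguments.
Unset Strict Implicit.
Unset Printing Implicit Defensive.

Import GRing.Theory.
Local Open Scope ring_scope.

Arguments clos_refl_sym_trans {A} R x y.

(* A dg vector space is given by its total space, the internal direct sum of
   its homogeneous parts V^i = {v | homog i v}, i : int. *)
Record dgvect (K : fieldType) := DgVect {
  dg_space :> lmodType K;
  homog : int -> dg_space -> Prop;
  dgd : dg_space -> dg_space;
  homog0 : forall i, homog i 0;
  homog_linear : forall i (a : K) u v, homog i u -> homog i v -> homog i (a *: u + v);
  homog_span : forall v, exists (s : seq int) (x : int -> dg_space),
    (forall i, homog i (x i)) /\ v = \sum_(i <- s) x i;
  homog_free : forall (s : seq int) (x : int -> dg_space),
    uniq s -> (forall i, homog i (x i)) -> \sum_(i <- s) x i = 0 ->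
    forall i, i \in s -> x i = 0;
  dgd_linear : linear dgd;
  dgd_homog : forall i v, homog i v -> homog (i - 1) (dgd v);
  dgdK : forall v, dgd (dgd v) = 0
}.

Section DgVect.
Variable K : fieldType.

Definition is_cycle (V : dgvect K) (x : V) : Prop := dgd x = 0.

Definition homologous (V : dgvect K) (x y : V) : Prop := exists z : V, x - y = dgd z.

Record is_dg_morph (V W : dgvect K) (f : V -> W) : Prop := IsDgMorph {
  dg_morph_linear : linear f;
  dg_morph_homog : forall i v, homog i v -> homog i (f v);
  dg_morph_dgd : forall v, f (dgd v) = dgd (f v)
}.

(* The last two fields are injectivity and surjectivity of the induced map
   ker d / im d -> ker d / im d; since f preserves degrees, this is the same as
   bijectivity in each degree. *)
Record is_dg_qiso (V W : dgvect K) (f : V -> W) : Prop := IsDgQiso {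
  dg_qiso_morph : is_dg_morph f;
  dg_qiso_inj : forall x y : V,
    is_cycle x -> is_cycle y -> homologous (f x) (f y) -> homologous x y;
  dg_qiso_surj : forall w : W, is_cycle w -> exists2 v : V, is_cycle v & homologous (f v) w
}.

End DgVect.

(* The product s * t of 'S_n is "s, then t", so sactM is the axiom of a right
   action of the group 'S_n.  For multilinear operations this is
   (f . s)(x_0, .., x_(n-1)) = +/- f(x_(s 0), .., x_(s (n-1))). *)
Record smod (K : fieldType) := SMod {
  smod_fun :> nat -> dgvect K;
  sact : forall n, smod_fun n -> 'S_n -> smod_fun n;
  sact_morph : forall n (s : 'S_n), is_dg_morph (fun x => sact x s);
  sact1 : forall n (x : smod_fun n), sact x 1%g = x;
  sactM : forall n (x : smod_fun n) (s t : 'S_n),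
    sact x (s * t)%g = sact (sact x s) t
}.

Section SMod.
Variable K : fieldType.

Definition acast (A : smod K) m n (e : m = n) (x : A m) : A n := ecast N (A N) e x.

Record is_smod_morph (A B : smod K) (f : forall n, A n -> B n) : Prop := IsSModMorph {
  smod_morph_dg : forall n, is_dg_morph (@f n);
  smod_morph_act : forall n (x : A n) (s : 'S_n), f n (sact x s) = sact (f n x) s
}.

Record is_smod_qiso (A B : smod K) (f : forall n, A n -> B n) : Prop := IsSModQiso {
  smod_qiso_morph : is_smod_morph f;
  smod_qiso_dg : forall n, is_dg_qiso (@f n)
}.

End SMod.

(* In \sum_(i < n) k i the j-th input of the i-th block is
   tagnat.Rank i j = k 0 + .. + k (i-1) + j  (tagnat.rankEsum). *)
Section Blocks.
Variable n : nat.

Lemma sum_blocks (k : 'I_n -> nat) (l : 'I_(\sum_(i < n) k i) -> nat) :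
  (\sum_(s < \sum_(i < n) k i) l s =
   \sum_(i < n) \sum_(j < k i) l (tagnat.Rank i j))%N.
Proof.
rewrite (reindex (@tagnat.rank _ k)) /=; last exact: onW_bij (@tagnat.rank_bij _ k).
rewrite (sig_big_dep (op := addn)) /=.
by apply: eq_bigr => p _; rewrite tagnat.rankE.
Qed.

Lemma sum_perm (k : 'I_n -> nat) (s : 'S_n) :
  (\sum_(i < n) k (s i) = \sum_(i < n) k i)%N.
Proof. by symmetry; apply: reindex_inj; apply: perm_inj. Qed.

Lemma sum_ones : (\sum_(i < n) 1 = n)%N.
Proof. by rewrite sum1_card card_ord. Qed.

Lemma sum_single (k : nat) : (\sum_(i < 1) k = k)%N.
Proof. exact: big_ord1. Qed.

(* Sends input j of block i of \sum_i k (s i) to input j of block s i of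
   \sum_i k i. *)
Definition block_fun (k : 'I_n -> nat) (s : 'S_n) (x : 'I_(\sum_(i < n) k i)) :
    'I_(\sum_(i < n) k i) :=
  let y := cast_ord (esym (sum_perm k s)) x in
  @tagnat.Rank n k (s (tagnat.sig1 y)) (tagnat.sig2 y).

Lemma block_fun_inj k s : injective (block_fun (k := k) s).
Proof.
move=> x y /tagnat.rank_inj E; apply: (@cast_ord_inj _ _ (esym (sum_perm k s))).
apply: tagnat.sig_inj; move: E; rewrite !tagnat.sigE12.
move: (tagnat.sig1 _) (tagnat.sig2 _) (tagnat.sig1 _) (tagnat.sig2 _).
move=> i j i' j' E; have/perm_inj Ei : s i = s i' by case: E.
by case: _ / Ei in j' E *; move/eqP: E; rewrite eq_Tagged => /eqP /= ->.
Qed.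

Definition block_perm (k : 'I_n -> nat) (s : 'S_n) : 'S_(\sum_(i < n) k i) :=
  perm (@block_fun_inj k s).

Definition sum_fun (k : 'I_n -> nat) (t : forall i, 'S_(k i))
    (x : 'I_(\sum_(i < n) k i)) : 'I_(\sum_(i < n) k i) :=
  @tagnat.Rank n k (tagnat.sig1 x) (t _ (tagnat.sig2 x)).

Lemma sum_fun_inj k t : injective (sum_fun (k := k) t).
Proof.
move=> x y /tagnat.rank_inj E; apply: tagnat.sig_inj; move: E.
rewrite !tagnat.sigE12.
move: (tagnat.sig1 _) (tagnat.sig2 _) (tagnat.sig1 _) (tagnat.sig2 _).
move=> i j i' j' E; have Ei : i = i' by case: E.
case: _ / Ei in j' E *; congr Tagged; apply: (@perm_inj _ (t i)).
by apply/eqP; move/eqP: E; rewrite eq_Tagged.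
Qed.

Definition sum_perms (k : 'I_n -> nat) (t : forall i, 'S_(k i)) :
  'S_(\sum_(i < n) k i) := perm (@sum_fun_inj k t).

Lemma block_permE (k : 'I_n -> nat) (s : 'S_n) i (j : 'I_(k (s i))) :
  block_perm k s (cast_ord (sum_perm k s) (@tagnat.Rank n (k \o s) i j)) =
  @tagnat.Rank n k (s i) j.
Proof.
rewrite permE /block_fun cast_ordK.
apply: (congr1 (fun p : {i & 'I_(k (s i))} => @tagnat.Rank n k (s (tag p)) (tagged p))
  (_ : tagnat.sig _ = Tagged _ j)).
exact: tagnat.rankK.
Qed.

Lemma sum_permsE (k : 'I_n -> nat) (t : forall i, 'S_(k i)) i (j : 'I_(k i)) :
  sum_perms t (tagnat.Rank i j) = tagnat.Rank i (t i j).
Proof.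
rewrite permE /sum_fun.
apply: (congr1 (fun p : {i & 'I_(k i)} => @tagnat.Rank n k (tag p) (t _ (tagged p)))
  (_ : tagnat.sig _ = Tagged _ j)).
exact: tagnat.rankK.
Qed.

End Blocks.

(* A morphism of dg S-modules A o B -> C, given by the equivariant multilinear
   maps A(n) x B(k_0) x .. x B(k_(n-1)) -> C(k_0 + .. + k_(n-1)) that it amounts
   to.  Signs are the Koszul signs for the order p, q_0, .., q_(n-1). *)
Record comp_map (K : fieldType) (A B C : smod K) := CompMap {
  ocomp : forall n (k : 'I_n -> nat),
    A n -> (forall i, B (k i)) -> C (\sum_(i < n) k i)%N;
  comp_linear_l : forall n k (q : forall i : 'I_n, B (k i)),
    linear (fun p : A n => ocomp p q);
  comp_linear_r : forall n k (p : A n) (q : forall i, B (k i)) i,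
    linear (fun x : B (k i) => ocomp p (dfwith q x));
  comp_homog : forall n k (p : A n) (q : forall i, B (k i)) a (b : 'I_n -> int),
    homog a p -> (forall i, homog (b i) (q i)) ->
    homog (a + \sum_(i < n) b i) (ocomp p q);
  comp_dgd : forall n k (p : A n) (q : forall i, B (k i)) a (b : 'I_n -> int),
    homog a p -> (forall i, homog (b i) (q i)) ->
    dgd (ocomp p q) = ocomp (dgd p) q +
      \sum_(i < n) (-1) ^+ (`|a| + \sum_(j < n | (j < i)%N) `|b j|)%N
        *: ocomp p (dfwith q (dgd (q i)));
  comp_act_l : forall n k (p : A n) (q : forall i, B (k i)) (b : 'I_n -> int)
      (s : 'S_n),
    (forall i, homog (b i) (q i)) ->
    ocomp (sact p s) q =
      (-1) ^+ (\sum_(i < n) \sum_(j < n | (i < j)%N && (s j < s i)%N)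
                 `|b (s i)| * `|b (s j)|)%N
      *: sact (acast (sum_perm k s) (ocomp p (fun i => q (s i)))) (block_perm k s);
  comp_act_r : forall n k (p : A n) (q : forall i, B (k i)) (t : forall i, 'S_(k i)),
    ocomp p (fun i => sact (q i) (t i)) = sact (ocomp p q) (sum_perms t)
}.

Arguments ocomp {K A B C} c {n k} p q.

Section Operads.
Variable K : fieldType.

(* Associativity (p; q); r = p; (q; r).  With r_i the inputs of block i, the
   Koszul sign is that of the permutation
   q_0 .. q_(n-1) r_0 .. r_(n-1)  ->  q_0 r_0 .. q_(n-1) r_(n-1). *)
Definition comp_assoc (A B C D E F : smod K)
    (AB : comp_map A B D) (DC : comp_map D C E)
    (BC : comp_map B C F) (AF : comp_map A F E) : Prop :=
  forall n (k : 'I_n -> nat) (l : 'I_(\sum_(i < n) k i) -> nat)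
    (p : A n) (q : forall i, B (k i)) (r : forall s, C (l s))
    (b : 'I_n -> int) (c : 'I_(\sum_(i < n) k i) -> int),
  (forall i, homog (b i) (q i)) -> (forall s, homog (c s) (r s)) ->
  acast (sum_blocks l) (ocomp DC (ocomp AB p q) r) =
    (-1) ^+ (\sum_(i < n) \sum_(i' < n | (i < i')%N) \sum_(j < k i)
               `|c (tagnat.Rank i j)| * `|b i'|)%N
    *: ocomp AF p (fun i => ocomp BC (q i) (fun j => r (tagnat.Rank i j))).

(* x; (m, .., m) and m; x for m of arity one. *)
Definition plug_all (A B C : smod K) (c : comp_map A B C) (m : B 1%N) n (x : A n) :
  C n := acast (sum_ones n) (ocomp c x (fun _ => m)).

Definition plug_into (A B C : smod K) (c : comp_map A B C) (m : A 1%N) n (x : B n) :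
  C n := acast (sum_single n) (ocomp c m (fun _ => x)).

Record operad := Operad {
  op_smod :> smod K;
  op_mul : comp_map op_smod op_smod op_smod;
  op_id : op_smod 1%N;
  op_id_homog : homog 0 op_id;
  op_id_cycle : is_cycle op_id;
  op_mulA : comp_assoc op_mul op_mul op_mul op_mul;
  op_mul1 : forall n (p : op_smod n), plug_all op_mul op_id p = p;
  op_1mul : forall n (p : op_smod n), plug_into op_mul op_id p = p
}.

Record bimodule (P Q : operad) := Bimodule {
  bi_smod :> smod K;
  lact : comp_map P bi_smod bi_smod;
  ract : comp_map bi_smod Q bi_smod;
  lactA : comp_assoc (op_mul P) lact lact lact;
  lact1 : forall n (m : bi_smod n), plug_into lact (op_id P) m = m;
  ractA : comp_assoc ract ract (op_mul Q) ract;
  ract1 : forall n (m : bi_smod n), plug_all ract (op_id Q) m = m;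
  lract : comp_assoc lact ract ract lact
}.

Definition operad_bimodule (Q : operad) : bimodule Q Q :=
  Bimodule (@op_mulA Q) (@op_1mul Q) (@op_mulA Q) (@op_mul1 Q) (@op_mulA Q).

Definition quasi_torsor (P Q : operad) (M : bimodule P Q) : Prop :=
  exists one : M 1%N,
    [/\ homog 0 one,
        is_smod_qiso (fun n (p : P n) => plug_all (lact M) one p)
      & is_smod_qiso (fun n (q : Q n) => plug_into (ract M) one q)].

Definition comp_compatible (A B C A' B' C' : smod K)
    (c : comp_map A B C) (c' : comp_map A' B' C')
    (f : forall n, A n -> A' n) (g : forall n, B n -> B' n)
    (h : forall n, C n -> C' n) : Prop :=
  forall n (k : 'I_n -> nat) (p : A n) (q : forall i, B (k i)),
    h _ (ocomp c p q) = ocomp c' (f n p) (fun i => g (k i) (q i)).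

Record is_operad_qiso (P P' : operad) (f : forall n, P n -> P' n) : Prop :=
  IsOperadQiso {
    operad_qiso_smod : is_smod_qiso f;
    operad_qiso_mul : comp_compatible (op_mul P) (op_mul P') f f f;
    operad_qiso_id : f 1%N (op_id P) = op_id P'
  }.

Record triple := Triple {
  left_operad : operad;
  right_operad : operad;
  middle : bimodule left_operad right_operad
}.

Record is_triple_qiso (T T' : triple)
    (f : forall n, left_operad T n -> left_operad T' n)
    (g : forall n, middle T n -> middle T' n)
    (h : forall n, right_operad T n -> right_operad T' n) : Prop := IsTripleQiso {
  triple_qiso_left : is_operad_qiso f;
  triple_qiso_right : is_operad_qiso h;
  triple_qiso_middle : is_smod_qiso g;
  triple_qiso_lact : comp_compatible (lact (middle T)) (lact (middle T')) f g g;
  triple_qiso_ract : comp_compatible (ract (middle T)) (ract (middle T')) g h g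
}.

Definition triple_qiso (T T' : triple) : Prop :=
  exists f g h, @is_triple_qiso T T' f g h.

Definition zigzag : triple -> triple -> Prop := clos_refl_sym_trans triple_qiso.

End Operads.

(* Main.v *)
Require Import Defs.
From mathcomp Require Import all_boot all_order all_algebra.
From HB Require Import structures.
From mathcomp Require Import boolp ring.

(* If p |-> p o (1, .., 1) is moreover surjective, then the pairs (p, q) with
   p o (1, .., 1) = 1 o q form an operad E contained in P x Q, and (E, E, E)
   maps to (P, M, Q) and to (Q, Q, Q) by quasi-isomorphisms.

   The general case is reduced to this one.  Let Z = Q (+) Cone(id_M), a right
   Q-module.  It is homotopy equivalent to Q, and its map pi to M, given by
   q |-> 1 o q on Q and the projection on the cone, is a quasi-isomorphism that
   splits as a map of graded right Q-modules.  Let End(n) = Hom_Q(Z^(x) n, Z) be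
   the endomorphism operad of Z, for the Day convolution of right Q-modules.
   Evaluation at (1, .., 1) is a split surjection and a homotopy equivalence
   End -> Z.  The pairs (p, f) in P x End with pi f = p (pi, .., pi) form an
   operad P', whose projections to P (because pi splits) and to End are
   quasi-isomorphisms, so (P, M, Q) <- (P', Z, Q) -> (End, Z, Q), and the first
   paragraph applies to (End, Z, Q). *)

Set Implicit Arguments.
Unset Strict Implicit.
Unset Printing Implicit Defensive.

Import GRing.Theory.
Local Open Scope ring_scope.

(** * Homogeneous parts and multilinear maps *)

(** A strict pullback of operads is well behaved along a surjection, and P need not act on an
    enlargement of M for which evaluation at 1 becomes surjective. The operad is therefore changed
    together with the module: an endomorphism operad acts by construction. Its homotopy type is
    under control because Z contracts onto Q by right linear maps and Q is the free right module on
    one generator of arity one, so that Hom_Q(Q^(x) n, Z) is Z(n); a mere quasi-isomorphism from Q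
    to Z would not be enough for this. Hence the cone on an identity: its contraction is right
    linear, and its projection to M has a right linear section s, so that s p (pi, .., pi) lifts p
    to an operation on Z. Signs are the formal obstacle. Koszul signs make sense for homogeneous
    elements, while structure maps must be defined on whole spaces. They are written with parity
    operators, computed on homogeneous elements and compared there by multilinearity. *)

Section LinearMaps.
Variables (K : fieldType) (V W : lmodType K) (f : V -> W).
Hypothesis f_lin : linear f.

Let f' := GRing.isLinear.Build K V W *:%R f f_lin.
Let g : {linear V -> W} := HB.pack f f'.

Lemma lin0 : f 0 = 0. Proof. exact: (linear0 g). Qed.
Lemma linD u v : f (u + v) = f u + f v. Proof. exact: (linearD g). Qed.
Lemma linN u : f (- u) = - f u. Proof. exact: (linearN g). Qed.
Lemma linB u v : f (u - v) = f u - f v. Proof. exact: (linearB g). Qed.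
Lemma linZ a u : f (a *: u) = a *: f u.
Proof. by rewrite -[a *: u]addr0 f_lin lin0 addr0. Qed.
Lemma lin_sum I (r : seq I) (P : pred I) F :
  f (\sum_(i <- r | P i) F i) = \sum_(i <- r | P i) f (F i).
Proof. exact: (linear_sum g). Qed.
End LinearMaps.

Section DgdLinear.
Variables (K : fieldType) (V : dgvect K).
Lemma dgd0 : dgd (0 : V) = 0. Proof. exact: lin0 (@dgd_linear K V). Qed.
Lemma dgdD (u v : V) : dgd (u + v) = dgd u + dgd v. Proof. exact: linD (@dgd_linear K V) _ _. Qed.
Lemma dgdN (u : V) : dgd (- u) = - dgd u. Proof. exact: linN (@dgd_linear K V) _. Qed.
Lemma dgdB (u v : V) : dgd (u - v) = dgd u - dgd v. Proof. exact: linB (@dgd_linear K V) _ _. Qed.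
Lemma dgdZ a (u : V) : dgd (a *: u) = a *: dgd u. Proof. exact: linZ (@dgd_linear K V) _ _. Qed.
Lemma dgd_sum I (r : seq I) (P : pred I) (F : I -> V) :
  dgd (\sum_(i <- r | P i) F i) = \sum_(i <- r | P i) dgd (F i).
Proof. exact: (lin_sum (@dgd_linear K V)). Qed.
End DgdLinear.

(** An inductive form of [homog_span]: closure properties are then proved by induction, without
    index lists. *)
Inductive inspan (K : fieldType) (V : lmodType K) (H : int -> V -> Prop) : V -> Prop :=
| inspan0 : inspan H 0
| inspanD i u v : H i u -> inspan H v -> inspan H (u + v).

Lemma sum_support (W : zmodType) (r r' : seq int) (y : int -> W) : uniq r -> uniq r' ->
  (forall i, i \notin r -> y i = 0) -> (forall i, i \notin r' -> y i = 0) ->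
  \sum_(i <- r) y i = \sum_(i <- r') y i.
Proof.
move=> ur ur' y0 y0'; rewrite (bigID (mem r')) /= [X in _ + X]big1 ?addr0; last by move=> i /y0'.
rewrite [RHS](bigID (mem r)) /= [X in _ = _ + X]big1 ?addr0; last by move=> i /y0.
rewrite -big_filter -[RHS]big_filter; apply: perm_big; apply: uniq_perm.
- exact: filter_uniq.
- exact: filter_uniq.
- by move=> i; rewrite !mem_filter andbC.
Qed.

Section Inspan.
Variables (K : fieldType) (V : lmodType K) (H : int -> V -> Prop).
Hypothesis H0 : forall i, H i 0.
Hypothesis Hlin : forall i (a : K) u v, H i u -> H i v -> H i (a *: u + v).

Lemma inspan_homog i v : H i v -> inspan H v.
Proof. by move=> Hv; rewrite -[v]addr0; apply: (inspanD Hv); apply: inspan0. Qed.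

Lemma inspan_linear a u v : inspan H u -> inspan H v -> inspan H (a *: u + v).
Proof.
elim=> [|i {}u u' Hu _ IH] Hv; first by rewrite scaler0 add0r.
rewrite scalerDr -addrA; apply: (@inspanD _ _ _ i); last exact: IH.
by rewrite -[a *: u]addr0; apply: Hlin.
Qed.

Lemma inspan_sum I (r : seq I) (P : pred I) F :
  (forall i, P i -> inspan H (F i)) -> inspan H (\sum_(i <- r | P i) F i).
Proof.
move=> HF; elim/big_rec: _ => [|i x Pi Hx]; first exact: inspan0.
by rewrite -[F i]scale1r; apply: inspan_linear => //; apply: HF.
Qed.

Lemma inspan_dec v : inspan H v -> exists (s : seq int) (x : int -> V),
  [/\ uniq s, forall i, H i (x i), forall i, i \notin s -> x i = 0
    & v = \sum_(i <- s) x i].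
Proof.
elim=> [|i0 u {}v Hu _ [s [x [us Hx x0 ->]]]].
  by exists [::], (fun=> 0); split=> //; rewrite big_nil.
(* The degree [i0] may already occur in [s]; [u] is then added to the component present there. *)
exists (undup (i0 :: s)), (fun i => (i == i0)%:R *: u + x i); split.
- exact: undup_uniq.
- by move=> i; case: (eqVneq i i0) => [->|_]; [apply: Hlin | rewrite scale0r add0r].
- move=> i; rewrite mem_undup inE negb_or => /andP[/negPf-> /x0->].
  by rewrite scale0r addr0.
rewrite big_split /=; congr (_ + _).
  have it : i0 \in undup (i0 :: s) by rewrite mem_undup mem_head.
  rewrite (bigD1_seq i0 it) ?undup_uniq //.
  by rewrite /= eqxx scale1r big1 ?addr0 // => i /negPf->; rewrite scale0r.
apply: (sum_support us (undup_uniq (i0 :: s))) => // i.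
by rewrite mem_undup inE negb_or => /andP[_ /x0].
Qed.
End Inspan.

Section DgVectTheory.
Variables (K : fieldType) (V : dgvect K).
Implicit Types (u v : V) (w : int -> K).

Lemma homogZ i (a : K) v : homog i v -> homog i (a *: v).
Proof. by move=> hv; rewrite -[a *: v]addr0; apply: homog_linear (homog0 _ _). Qed.
Lemma homogD i u v : homog i u -> homog i v -> homog i (u + v).
Proof. by move=> hu hv; rewrite -[u]scale1r; apply: homog_linear. Qed.
Lemma homogN i v : homog i v -> homog i (- v).
Proof. by rewrite -scaleN1r; apply: homogZ. Qed.
Lemma homogB i u v : homog i u -> homog i v -> homog i (u - v).
Proof. by move=> hu hv; apply/homogD/homogN. Qed.
Lemma homog_sum i I (r : seq I) (P : pred I) (F : I -> V) :
  (forall j, P j -> homog i (F j)) -> homog i (\sum_(j <- r | P j) F j).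
Proof. by move=> h; elim/big_rec: _ => [|j x Pj]; [apply: homog0 | apply/homogD/h]. Qed.

Lemma dg_inspan v : inspan (@homog K V) v.
Proof.
have [s [x [hx ->]]] := homog_span v.
by apply: inspan_sum => [||i _]; [exact: homog0 | exact: homog_linear | exact: inspan_homog (hx i)].
Qed.

Definition is_dec v (d : seq int * (int -> V)) :=
  [/\ uniq d.1, forall i, homog i (d.2 i), forall i, i \notin d.1 -> d.2 i = 0
    & v = \sum_(i <- d.1) d.2 i].

Lemma dec_ex v : exists d, is_dec v d.
Proof.
have [s [x h]] := inspan_dec (@homog0 K V) (@homog_linear K V) (dg_inspan v).
by exists (s, x).
Qed.

(** Over a common list of degrees, [homog_free] applies to the difference of the two
    decompositions. *)
Lemma dec_uniq v d d' : is_dec v d -> is_dec v d' -> d.2 =1 d'.2.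
Proof.
case: d d' => [s x] [s' x'] [/= us hx x0 dv] [/= us' hx' x0' dv'].
have ut := undup_uniq (s ++ s'); set t := undup _ in ut *.
have xt i : i \notin t -> x i = 0 /\ x' i = 0.
  by rewrite mem_undup mem_cat negb_or => /andP[/x0-> /x0'->].
have: \sum_(i <- t) (x i - x' i) = 0.
  apply/eqP; rewrite sumrB subr_eq0; apply/eqP.
  transitivity v; [rewrite dv | rewrite dv']; apply: sum_support => // i /xt[] //.
move=> /homog_free hf i; case: (boolP (i \in t)) => [is_|/xt[-> ->]] //.
apply/eqP; rewrite -subr_eq0; apply/eqP; apply: (hf _ _ i is_) => // j.
exact: homogB.
Qed.

Definition dec v := sval (cid (dec_ex v)).
Lemma decP v : is_dec v (dec v).
Proof. exact: svalP (cid (dec_ex v)). Qed.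

(** The operator that multiplies the part of degree [i] by [w i]. Degree projections, parity
    projections and Koszul signs on inhomogeneous elements are all of this form. *)
Definition wt w v := \sum_(i <- (dec v).1) w i *: (dec v).2 i.

Lemma wtE w v d : is_dec v d -> wt w v = \sum_(i <- d.1) w i *: d.2 i.
Proof.
move=> hd; have e := dec_uniq hd (decP v); have [us hx x0 dv] := decP v.
case: hd => us' hx' x0' dv'; rewrite /wt (@sum_support _ _ d.1) //.
- by apply: eq_bigr => i _; rewrite e.
- by move=> i /x0->; rewrite scaler0.
- by move=> i /x0'; rewrite -e => ->; rewrite scaler0.
Qed.

Lemma dec_homog i v : homog i v -> is_dec v ([:: i], fun j => (j == i)%:R *: v).
Proof.
move=> hv; split=> //= [j|j|]; last by rewrite big_seq1 eqxx scale1r.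
  by case: eqVneq => [->|_]; [apply: homogZ | rewrite scale0r; apply: homog0].
by rewrite inE => /negPf->; rewrite scale0r.
Qed.

Lemma wt_homog w i v : homog i v -> wt w v = w i *: v.
Proof. by move/dec_homog/wtE->; rewrite big_seq1 /= eqxx scale1r. Qed.

Lemma wt_linear w : linear (wt w).
Proof.
move=> a u v; have [us hx x0 du] := decP u; have [us' hx' x0' dv] := decP v.
have ut := undup_uniq ((dec u).1 ++ (dec v).1); set t := undup _ in ut *.
have xt i : i \notin t -> (dec u).2 i = 0 /\ (dec v).2 i = 0.
  by rewrite mem_undup mem_cat negb_or => /andP[/x0-> /x0'->].
have d : is_dec (a *: u + v) (t, fun i => a *: (dec u).2 i + (dec v).2 i).
  split=> /= [|i|i /xt[-> ->]|]; [by [] | exact: homog_linear | by rewrite scaler0 addr0|].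
  rewrite {1}du {1}dv big_split /= -scaler_sumr.
  by congr (_ *: _ + _); apply: sum_support => // i /xt[].
rewrite (wtE _ d) /wt /= (@sum_support _ (dec u).1 t) //; first last.
- by move=> i /xt[-> _]; rewrite scaler0.
- by move=> i /x0->; rewrite scaler0.
rewrite (@sum_support _ (dec v).1 t) //; first last.
- by move=> i /xt[_ ->]; rewrite scaler0.
- by move=> i /x0'->; rewrite scaler0.
rewrite scaler_sumr -big_split /=; apply: eq_bigr => i _.
by rewrite scalerDr !scalerA mulrC.
Qed.

Definition hpart i v := wt (fun j => (j == i)%:R) v.
Lemma hpart_linear i : linear (hpart i). Proof. exact: wt_linear. Qed.
Lemma hpart_homog i j v : homog j v -> hpart i v = (j == i)%:R *: v.
Proof. exact: wt_homog. Qed.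
Lemma hpartE i v : homog i v -> hpart i v = v.
Proof. by move/hpart_homog->; rewrite eqxx scale1r. Qed.
Lemma homog_hpart i v : homog i (hpart i v).
Proof.
rewrite /hpart /wt; apply: homog_sum => j _; case: eqVneq => [->|_].
  by apply: homogZ; have [] := decP v.
by rewrite scale0r; apply: homog0.
Qed.
End DgVectTheory.

Section LinearOnDg.
Variables (K : fieldType) (V : dgvect K).

Lemma homog_ind (S : V -> Prop) : S 0 -> (forall u v, S u -> S v -> S (u + v)) ->
  (forall i v, homog i v -> S v) -> forall v, S v.
Proof.
by move=> S0 SD Sh v; elim: (dg_inspan v) => // i {}v u /Sh hv _; apply: SD.
Qed.

Lemma linear_homog_eq (W : lmodType K) (f g : V -> W) : linear f -> linear g ->
  (forall i v, homog i v -> f v = g v) -> f =1 g.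
Proof.
move=> lf lg e; apply: homog_ind => // [|u v hu hv]; first by rewrite !lin0.
by rewrite !linD // hu hv.
Qed.
End LinearOnDg.

Lemma hpart_dgd (K : fieldType) (V : dgvect K) i (v : V) : hpart i (dgd v) = dgd (hpart (i + 1) v).
Proof.
apply: (@linear_homog_eq _ _ _ (fun v => hpart i (dgd v)) (fun v => dgd (hpart (i + 1) v))).
- by move=> a u w; rewrite dgd_linear hpart_linear.
- by move=> a u w; rewrite hpart_linear dgd_linear.
move=> j w hw; rewrite (hpart_homog _ (dgd_homog hw)) (hpart_homog _ hw) dgdZ.
by rewrite subr_eq.
Qed.

Lemma hpart_morph (K : fieldType) (V W : dgvect K) (f : V -> W) i v :
  is_dg_morph f -> hpart i (f v) = f (hpart i v).
Proof.
case=> lf hf _; move: v; apply: linear_homog_eq.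
- by move=> a u w; rewrite lf hpart_linear.
- by move=> a u w; rewrite hpart_linear lf.
by move=> j w hw; rewrite (hpart_homog _ (hf _ _ hw)) (hpart_homog _ hw) (linZ lf).
Qed.

Definition multilinear (K : fieldType) n (V : 'I_n -> lmodType K) (W : lmodType K)
  (F : (forall i, V i) -> W) :=
  forall q i, linear (fun x : V i => F (dfwith q x)).

Lemma dfwith_id (I : eqType) (T : I -> Type) (q : forall i, T i) i : dfwith q (q i) = q.
Proof. by apply: functional_extensionality_dep => j; case: dfwithP. Qed.

Section Multilinear.
Variables (K : fieldType) (n : nat) (V : 'I_n -> dgvect K) (W : lmodType K).
Implicit Types F G : (forall i, V i) -> W.

Lemma multi_ind F (S : W -> Prop) : @multilinear K n V W F -> S 0 ->
  (forall u v, S u -> S v -> S (u + v)) ->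
  (forall q b, (forall i, homog (b i) (q i)) -> S (F q)) -> forall q, S (F q).
Proof.
move=> Fl S0 SD Sh.
(* Arguments are split into homogeneous parts one at a time, from the last one down: those of index
   at least [m] are already homogeneous. *)
suff main m q : (forall i : 'I_n, (m <= i)%N -> exists b, homog b (q i)) -> S (F q).
  by move=> q; apply: (main n) => i; rewrite leqNgt ltn_ord.
elim: m q => [|m IH] q hq.
  have /choice[b hb] : forall i, exists b, homog b (q i) by move=> i; apply: hq.
  exact: Sh hb.
case: (ltnP m n) => [lt_mn|le_nm]; last first.
  by apply: IH => i /(leq_trans le_nm); rewrite leqNgt ltn_ord.
pose i0 := Ordinal lt_mn; rewrite -(dfwith_id q i0).
move: (q i0); apply: homog_ind => [|u v Su Sv|b v hv].
- by rewrite (lin0 (Fl q i0)).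
- by rewrite (linD (Fl q i0)); apply: SD.
apply: IH => i le_mi; case: (eqVneq i0 i) => [<-|ne]; first by exists b; rewrite dfwith_in.
by rewrite dfwith_out //; apply: hq; rewrite ltn_neqAle le_mi andbT.
Qed.

Lemma multi_eq F G : @multilinear K n V W F -> @multilinear K n V W G ->
  (forall q b, (forall i, homog (b i) (q i)) -> F q = G q) -> F =1 G.
Proof.
move=> Fl Gl e q; apply/eqP; rewrite -subr_eq0; apply/eqP; move: q.
apply: (@multi_ind (fun q => F q - G q) (fun w => w = 0)) => //.
- move=> q i a u v; rewrite Fl Gl opprD addrACA scalerDr scalerN //.
- by move=> u v -> ->; rewrite addr0.
- by move=> q b h; rewrite (e _ _ h) subrr.
Qed.
End Multilinear.

(** * Quasi-isomorphisms on homogeneous elements *)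

(* The data of a dg vector space except that the ambient space may contain
   elements that are not sums of homogeneous ones. *)
Record predg (K : fieldType) := PreDg {
  pre_space :> lmodType K;
  pre_homog : int -> pre_space -> Prop;
  pre_d : pre_space -> pre_space;
  pre_homog0 : forall i, pre_homog i 0;
  pre_homog_linear : forall i (a : K) u v,
    pre_homog i u -> pre_homog i v -> pre_homog i (a *: u + v);
  pre_homog_free : forall (s : seq int) (x : int -> pre_space),
    uniq s -> (forall i, pre_homog i (x i)) -> \sum_(i <- s) x i = 0 ->
    forall i, i \in s -> x i = 0;
  pre_d_linear : linear pre_d;
  pre_d_homog : forall i v, pre_homog i v -> pre_homog (i - 1) (pre_d v);
  pre_dK : forall i v, pre_homog i v -> pre_d (pre_d v) = 0
}.

Section SpanDg.
Variables (K : fieldType) (V : predg K).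

Definition span_pred : {pred V} := fun v => `[< inspan (@pre_homog K V) v >].

Fact span_submod : GRing.submod_closed span_pred.
Proof.
split=> [|a u v /asboolP hu /asboolP hv]; apply/asboolP; first exact: inspan0.
exact: (inspan_linear (@pre_homog0 K V) (@pre_homog_linear K V)).
Qed.
HB.instance Definition _ := GRing.isSubmodClosed.Build K V span_pred span_submod.

Record span_type := SpanType { span_val : V; span_valP : span_val \in span_pred }.
HB.instance Definition _ := [isSub of span_type for span_val].
HB.instance Definition _ := [Choice of span_type by <:].
HB.instance Definition _ := [SubChoice_isSubLmodule of span_type by <:].

Lemma span_val_linear : linear span_val.
Proof. exact: (linearP (val : {linear span_type -> V})). Qed.

Lemma span_val_inj : injective span_val. Proof. exact: val_inj. Qed.

Definition Span v (h : inspan (@pre_homog K V) v) : span_type := SpanType (asboolT h).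

Lemma span_d_closed (v : span_type) : inspan (@pre_homog K V) (pre_d (span_val v)).
Proof.
case: v => v /= /asboolP; elim=> [|i u {}v hu _ IH].
  by rewrite (lin0 (@pre_d_linear _ V)); apply: inspan0.
by rewrite (linD (@pre_d_linear _ V)); apply: inspanD (pre_d_homog hu) IH.
Qed.

Definition span_homog i (v : span_type) := pre_homog i (span_val v).
Definition span_d (v : span_type) := Span (span_d_closed v).

Fact span_homog0 i : span_homog i 0.
Proof. by rewrite /span_homog (lin0 span_val_linear); apply: pre_homog0. Qed.

Fact span_homog_linear i (a : K) u v :
  span_homog i u -> span_homog i v -> span_homog i (a *: u + v).
Proof. by move=> hu hv; rewrite /span_homog span_val_linear; apply: pre_homog_linear. Qed.

Fact span_homog_span v : exists (s : seq int) (x : int -> span_type),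
  (forall i, span_homog i (x i)) /\ v = \sum_(i <- s) x i.
Proof.
have /asboolP/(inspan_dec (@pre_homog0 K V) (@pre_homog_linear K V)) := span_valP v.
case=> s [x [us hx x0 e]].
have hx' i : inspan (@pre_homog K V) (x i).
  exact: (inspan_homog (hx i)).
exists s, (fun i => Span (hx' i)); split=> //.
by apply: span_val_inj; rewrite (lin_sum span_val_linear).
Qed.

Fact span_homog_free (s : seq int) (x : int -> span_type) :
  uniq s -> (forall i, span_homog i (x i)) -> \sum_(i <- s) x i = 0 ->
  forall i, i \in s -> x i = 0.
Proof.
move=> us hx /(congr1 span_val); rewrite (lin_sum span_val_linear) (lin0 span_val_linear) => e i si.
by apply: span_val_inj; rewrite (pre_homog_free us hx e si) (lin0 span_val_linear).
Qed.

Fact span_d_linear : linear span_d.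
Proof.
move=> a u v; apply: span_val_inj; rewrite span_val_linear.
have <- := @pre_d_linear _ V a (span_val u) (span_val v).
by rewrite -span_val_linear.
Qed.

Fact span_d_homog i v : span_homog i v -> span_homog (i - 1) (span_d v).
Proof. exact: pre_d_homog. Qed.

Fact span_dK v : span_d (span_d v) = 0.
Proof.
apply: span_val_inj; rewrite (lin0 span_val_linear) /=.
have dl := @pre_d_linear _ V; case: v => v /= /asboolP; elim=> [|i u {}v hu _ IH].
  by rewrite !(lin0 dl).
by rewrite !(linD dl) IH (pre_dK hu) addr0.
Qed.

Definition span_dg : dgvect K := DgVect span_homog0 span_homog_linear span_homog_span
  span_homog_free span_d_linear span_d_homog span_dK.

End SpanDg.

Section Qiso.
Variable K : fieldType.

Lemma is_dg_morph_comp (U V W : dgvect K) (f : U -> V) (g : V -> W) :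
  is_dg_morph f -> is_dg_morph g -> is_dg_morph (fun x => g (f x)).
Proof.
move=> [lf hf df] [lg hg dg]; split=> [a u v|i v hv|v]; first by rewrite lf lg.
  exact/hg/hf.
by rewrite df dg.
Qed.

Lemma homog_cycle (V : dgvect K) i (v : V) : is_cycle v -> is_cycle (hpart i v).
Proof.
rewrite /is_cycle => v0; have := hpart_dgd (i - 1) v.
by rewrite subrK v0 (lin0 (@hpart_linear _ V _)) => <-.
Qed.

Lemma hpart_sum (V : dgvect K) (v : V) : v = \sum_(i <- (dec v).1) hpart i v.
Proof.
have [us hx x0 {1}->] := decP v; apply: eq_big_seq => i si.
rewrite /hpart /wt (bigD1_seq i) //= eqxx scale1r big1 ?addr0 // => j /negPf->.
by rewrite scale0r.
Qed.

(** Witnesses carry their degree because elements of the operads of pairs are built by [Pull_ex]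
    from homogeneous components. *)
Record is_hqiso (V W : dgvect K) (f : V -> W) : Prop := IsHQiso {
  hqiso_morph : is_dg_morph f;
  hqiso_inj : forall i (v : V) (w : W), homog i v -> is_cycle v -> homog (i + 1) w ->
    f v = dgd w -> exists2 u : V, homog (i + 1) u & v = dgd u;
  hqiso_surj : forall i (w : W), homog i w -> is_cycle w ->
    exists (v : V) (u : W), [/\ homog i v, is_cycle v, homog (i + 1) u & f v - w = dgd u]
}.

(* Homology is the direct sum of its homogeneous parts, so a quasi-isomorphism
   may be recognised on homogeneous elements. *)
Lemma hqisoP (V W : dgvect K) (f : V -> W) : is_dg_qiso f <-> is_hqiso f.
Proof.
split=> -[fm fi fs]; split=> //; have [lf hf df] := fm.
- move=> i v w hv v0 hw e; have [|||u] := fi v 0 => //; first by rewrite /is_cycle dgd0.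
    by exists w; rewrite (lin0 lf) subr0.
  rewrite subr0 => eu; exists (hpart (i + 1) u); first exact: homog_hpart.
  by rewrite -hpart_dgd -eu hpartE.
- move=> i w hw w0; have [v v0 [u e]] := fs w w0.
  exists (hpart i v), (hpart (i + 1) u); split; rewrite ?homog_hpart //.
  + exact: homog_hpart.
  + exact: homog_cycle.
  + exact: homog_hpart.
  by rewrite -hpart_dgd -e (linB (@hpart_linear _ W _)) (hpart_morph _ _ fm) (hpartE hw).
- move=> x y x0 y0 [w e]; have c0 : is_cycle (x - y) by rewrite /is_cycle dgdB x0 y0 subrr.
  rewrite /homologous (hpart_sum (x - y)).
  elim: (dec _).1 => [|i s [z ez]]; first by exists 0; rewrite big_nil dgd0.
  have [||||u _ eu] := fi i (hpart i (x - y)) (hpart (i + 1) w).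
  + exact: homog_hpart.
  + exact: homog_cycle.
  + exact: homog_hpart.
  + by rewrite -(hpart_morph _ _ fm) (linB lf) e hpart_dgd.
  by exists (u + z); rewrite big_cons dgdD -eu -ez.
- move=> w w0; rewrite (hpart_sum w); elim: (dec w).1 => [|i s [v v0 [z ez]]].
    exists 0; first by rewrite /is_cycle dgd0.
    by exists 0; rewrite big_nil (lin0 lf) dgd0 subr0.
  have [u [z' [_ u0 _ e]]] := fs i _ (homog_hpart i w) (homog_cycle i w0).
  exists (u + v); first by rewrite /is_cycle dgdD u0 v0 addr0.
  by exists (z' + z); rewrite big_cons dgdD -e -ez (linD lf) opprD addrACA.
Qed.

Section TwoOfThree.
Variables (U V W : dgvect K) (f : U -> V) (g : V -> W).
Hypotheses (fm : is_dg_morph f) (gm : is_dg_morph g).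

Lemma hqiso_cancel_l : is_hqiso g -> is_hqiso (fun x => g (f x)) -> is_hqiso f.
Proof.
move=> [_ gi _] [_ ci cs]; have [lf hf df] := fm; have [lg hg dg] := gm; split=> //.
  by move=> i v w hv v0 hw e; apply: (ci i v (g w)) => //; [exact: hg | rewrite e dg].
move=> i w hw w0; have [|v [u [hv v0 hu e]]] := cs i (g w) (hg _ _ hw).
  by rewrite /is_cycle -dg w0 (lin0 lg).
have [|||z hz ez] := gi i (f v - w) u _ _ hu.
- by apply: homogB => //; apply: hf.
- by rewrite /is_cycle dgdB -df v0 w0 (lin0 lf) subrr.
- by rewrite (linB lg).
by exists v, z.
Qed.

Lemma hqiso_cancel_r : is_hqiso f -> is_hqiso (fun x => g (f x)) -> is_hqiso g.
Proof.
move=> [_ fi fs] [_ ci cs]; have [lf hf df] := fm; have [lg hg dg] := gm; split=> //.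
  move=> i v w hv v0 hw e; have [u [z [hu u0 hz ez]]] := fs i v hv v0.
  have [||x hx ex] := ci i u (g z + w) hu u0.
  - by apply: homogD => //; apply: hg.
  - by rewrite dgdD -e -dg -ez (linB lg) subrK.
  exists (f x - z); first by apply: homogB => //; apply: hf.
  by rewrite dgdB -df -ex -ez subKr.
move=> i w hw w0; have [v [u [hv v0 hu e]]] := cs i w hw w0.
exists (f v), u; split=> //; first exact: hf.
by rewrite /is_cycle -df v0 (lin0 lf).
Qed.

Lemma hqiso_comp : is_hqiso f -> is_hqiso g -> is_hqiso (fun x => g (f x)).
Proof.
move=> [_ fi fs] [_ gi gs]; have [lf hf df] := fm; have [lg hg dg] := gm.
split; first exact: is_dg_morph_comp.
  move=> i v w hv v0 hw e; have [||z hz ez] := gi i (f v) w _ _ hw e.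
  - exact: hf.
  - by rewrite /is_cycle -df v0 (lin0 lf).
  by apply: (fi i v z).
move=> i w hw w0; have [v [u [hv v0 hu e]]] := gs i w hw w0.
have [x [y [hx x0 hy ey]]] := fs i v hv v0.
exists x, (g y + u); split=> //; first by apply: homogD => //; apply: hg.
by rewrite dgdD -dg -ey -e (linB lg) addrA subrK.
Qed.
End TwoOfThree.

(** The long exact sequence of the kernel, by hand: lifting a bounding chain, or a cycle, through
    [f] leaves an error in the kernel, which is acyclic. *)
Lemma surj_hqiso (V W : dgvect K) (f : V -> W) : is_dg_morph f ->
  (forall i w, homog i w -> exists2 v, homog i v & f v = w) ->
  (forall i v, homog i v -> is_cycle v -> f v = 0 ->
    exists u, [/\ homog (i + 1) u, f u = 0 & v = dgd u]) ->
  is_hqiso f.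
Proof.
move=> fm fs fk; have [lf hf df] := fm; split=> // [i v w hv v0 hw e|i w hw w0].
  have [u hu eu] := fs _ _ hw; have [|||z [hz _ ez]] := fk i (v - dgd u).
  - by apply: homogB => //; rewrite -(addrK 1 i); apply: dgd_homog.
  - by rewrite /is_cycle dgdB v0 dgdK subrr.
  - by rewrite (linB lf) df eu e subrr.
  by exists (z + u); [apply: homogD | rewrite dgdD -ez subrK].
have [v hv ev] := fs _ _ hw; have [|||z [hz z0 ez]] := fk (i - 1) (dgd v).
- exact: dgd_homog.
- exact: dgdK.
- by rewrite df ev.
rewrite subrK in hz; exists (v - z), 0; split; first exact: homogB.
- by rewrite /is_cycle dgdB ez subrr.
- exact: homog0.
- by rewrite (linB lf) z0 ev subr0 subrr dgd0.
Qed.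
End Qiso.

Lemma hqiso_kernel (K : fieldType) (V W : dgvect K) (f : V -> W) : is_hqiso f ->
  (forall i w, homog i w -> exists2 v, homog i v & f v = w) ->
  forall i v, homog i v -> is_cycle v -> f v = 0 ->
  exists u, [/\ homog (i + 1) u, f u = 0 & v = dgd u].
Proof.
move=> [fm fi fs] fsurj i v hv v0 fv0; have [lf hf df] := fm.
have [|u hu eu] := fi i v 0 hv v0 (homog0 _ _); first by rewrite fv0 dgd0.
have [|x [w [hx x0 hw ew]]] := fs (i + 1) (f u) (hf _ _ hu).
  by rewrite /is_cycle -df -eu.
have [y hy ey] := fsurj _ _ hw.
have hdy : homog (i + 1) (dgd y) by rewrite -[i + 1](addrK 1); apply: dgd_homog.
(* [f u] is a cycle but need not vanish. It is homologous to the image of a cycle [x], and [y] lifts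
   the chain [w] between them. *)
exists (u - x + dgd y); split.
- by apply: homogD => //; apply: homogB.
- by rewrite (linD lf) (linB lf) df ey -ew addrC addrA subrK subrr.
- by rewrite dgdD dgdB x0 dgdK subr0 addr0.
Qed.

(** * Koszul signs and labelled operations *)

(** Koszul exponents are taken in ['F_2], where sign identities become polynomial identities within
    reach of [ring]. *)
Definition pz (i : int) : 'F_2 := i%:~R.
Definition sg (K : fieldType) (x : 'F_2) : K := (-1) ^+ (x : nat).

Section Signs.
Variable K : fieldType.
Local Notation sg := (sg K).

Lemma F2DD (x : 'F_2) : x + x = 0.
Proof. by apply: val_inj; case: x => [[|[|]]]. Qed.
Lemma F2N (x : 'F_2) : - x = x.
Proof. by apply/eqP; rewrite eq_sym -subr_eq0 opprK F2DD. Qed.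

Lemma sg_nat n : (-1) ^+ n = sg n%:R.
Proof. by rewrite /sg val_Fp_nat // modn2 signr_odd. Qed.
Lemma sgD x y : sg (x + y) = sg x * sg y.
Proof. by rewrite -(natr_Zp x) -(natr_Zp y) -natrD -!sg_nat exprD. Qed.
Lemma sg0 : sg 0 = 1. Proof. exact: expr0. Qed.
Lemma sg1 : sg 1 = -1. Proof. exact: expr1. Qed.
Lemma sg_sq x : sg x * sg x = 1.
Proof. by rewrite -sgD F2DD sg0. Qed.

Lemma abszE (i : int) : (`|i|%N)%:R = pz i.
Proof. by rewrite /pz; case: i => n //; rewrite NegzE abszN intrN F2N. Qed.
Lemma pzD i j : pz (i + j) = pz i + pz j. Proof. exact: intrD. Qed.
Lemma pzB1 i : pz (i - 1) = pz i + 1. Proof. by rewrite /pz intrB F2N. Qed.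
Lemma pzD1 i : pz (i + 1) = pz i + 1. Proof. exact: intrD. Qed.
Lemma pz_sum I (r : seq I) (P : pred I) (F : I -> int) :
  pz (\sum_(i <- r | P i) F i) = \sum_(i <- r | P i) pz (F i).
Proof. exact: rmorph_sum. Qed.
End Signs.

Section Casts.
Variables (K : fieldType).
Implicit Types A B C : smod K.

Lemma acast_id A m (e : m = m) (x : A m) : acast e x = x.
Proof. by rewrite /acast eq_axiomK. Qed.
Lemma acast_comp A m n p (e : m = n) (f : n = p) (x : A m) :
  acast f (acast e x) = acast (etrans e f) x.
Proof. by case: p / f; case: n / e. Qed.
Lemma acast_irr A m n (e f : m = n) (x : A m) : acast e x = acast f x.
Proof. by rewrite (eq_irrelevance e f). Qed.
Lemma acast_linear A m n (e : m = n) : linear (@acast K A m n e).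
Proof. by case: n / e. Qed.
Lemma acastZ A m n (e : m = n) a (x : A m) : acast e (a *: x) = a *: acast e x.
Proof. by case: n / e. Qed.
Lemma acast_dgd A m n (e : m = n) (x : A m) : acast e (dgd x) = dgd (acast e x).
Proof. by case: n / e. Qed.
Lemma acast_homog A m n (e : m = n) i (x : A m) : homog i x -> homog i (acast e x).
Proof. by case: n / e. Qed.
Lemma acast_fun A B (f : forall n, A n -> B n) m n (e : m = n) (x : A m) :
  f n (acast e x) = acast e (f m x).
Proof. by case: n / e. Qed.
Lemma acastK A m n (e : m = n) (f : n = m) (x : A m) : acast f (acast e x) = x.
Proof. by rewrite acast_comp acast_id. Qed.

Section Sact.
Variables (A : smod K) (n : nat).
Implicit Types (x y : A n) (s : 'S_n).
Lemma sactD x y s : sact (x + y) s = sact x s + sact y s.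
Proof. exact: linD (dg_morph_linear (sact_morph A s)) _ _. Qed.
Lemma sactZ a x s : sact (a *: x) s = a *: sact x s.
Proof. exact: linZ (dg_morph_linear (sact_morph A s)) _ _. Qed.
Lemma sact_homog i x s : homog i x -> homog i (sact x s).
Proof. exact: dg_morph_homog (sact_morph A s) _ _. Qed.
Lemma sact_dgd x s : sact (dgd x) s = dgd (sact x s).
Proof. exact: dg_morph_dgd (sact_morph A s) _. Qed.
Lemma sact_linear s : linear (fun x : A n => sact x s).
Proof. exact: dg_morph_linear (sact_morph A s). Qed.
End Sact.
End Casts.

(* [lab_eq x e y f]: x with inputs labelled by e and y with inputs labelled by
   f are the same operation.  Arity casts and permutations of the inputs are
   thus absorbed, and identities are checked on labels. *)
Definition lab_eq (K : fieldType) (A : smod K) (T : Type) m (x : A m) (e : 'I_m -> T)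
    n (y : A n) (f : 'I_n -> T) : Prop :=
  exists (E : m = n) (s : 'S_n),
    y = sact (acast E x) s /\ forall i, f (s (cast_ord E i)) = e i.

Section Labels.
Variables (K : fieldType) (A : smod K) (T : Type).

Lemma lab_refl m (x : A m) (e : 'I_m -> T) : lab_eq x e x e.
Proof. by exists erefl, 1%g; split=> [|i]; rewrite ?sact1 // perm1 cast_ord_id. Qed.

Lemma lab_sym m (x : A m) (e : 'I_m -> T) n (y : A n) (f : 'I_n -> T) :
  lab_eq x e y f -> lab_eq y f x e.
Proof.
move=> [E]; case: n / E y f => y f [s [-> h]]; exists erefl, s^-1%g; split=> [|i] /=.
  by rewrite -sactM mulgV sact1.
by rewrite -h !cast_ord_id permKV.
Qed.

Lemma lab_trans m (x : A m) (e : 'I_m -> T) n (y : A n) (f : 'I_n -> T)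
    p (z : A p) (g : 'I_p -> T) :
  lab_eq x e y f -> lab_eq y f z g -> lab_eq x e z g.
Proof.
move=> [E]; case: n / E y f => y f [s [-> h]]; move=> [E]; case: p / E z g => z g [t [-> h']].
exists erefl, (s * t)%g; split=> [|i] /=; first by rewrite sactM.
by rewrite permM -h -h' !cast_ord_id.
Qed.

Lemma lab_sact m (x : A m) (e f : 'I_m -> T) (s : 'S_m) :
  (forall i, f (s i) = e i) -> lab_eq x e (sact x s) f.
Proof. by move=> h; exists erefl, s; split=> // i; rewrite cast_ord_id. Qed.

Lemma lab_cast m n (E : m = n) (x : A m) (e : 'I_m -> T) (f : 'I_n -> T) :
  (forall i, f (cast_ord E i) = e i) -> lab_eq x e (acast E x) f.
Proof. by move=> h; exists E, 1%g; split=> [|i]; rewrite ?sact1 // perm1. Qed.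

Lemma lab_scale a m (x : A m) (e : 'I_m -> T) n (y : A n) (f : 'I_n -> T) :
  lab_eq x e y f -> lab_eq (a *: x) e (a *: y) f.
Proof. by move=> [E [s [-> h]]]; exists E, s; rewrite acastZ sactZ. Qed.

(** With distinct labels, the only permutation that respects them is the identity. *)
Lemma lab_inj m (x : A m) (e : 'I_m -> T) (y : A m) :
  lab_eq x e y e -> injective e -> x = y.
Proof.
move=> [E [s [-> h]]] ie; rewrite acast_id (_ : s = 1%g) ?sact1 //.
apply/perm.permP => i; rewrite perm1; apply: ie.
by rewrite -[in RHS](h i); congr (e (s _)); apply: val_inj.
Qed.

Lemma lab_inj_cast m n (E : m = n) (x : A m) (e : 'I_m -> T) (y : A n) f :
  lab_eq x e y f -> (forall i, f (cast_ord E i) = e i) -> injective f -> acast E x = y.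
Proof.
move=> h h' fi; apply: (@lab_inj _ _ f) => //; apply: lab_trans h.
by apply/lab_sym/lab_cast.
Qed.

Lemma lab_eq0 m (x : A m) (e : 'I_m -> T) n (f : 'I_n -> T) : lab_eq x e (0 : A n) f -> x = 0.
Proof.
move=> [E]; case: n / E f => f [s [e0 _]].
by rewrite -[x](sact1) -(mulgV s) sactM -[sact x s]e0 (lin0 (@sact_linear K A m _)).
Qed.

Lemma lab_eq_fun (B : smod K) (g : forall n, A n -> B n) m (x : A m) (e : 'I_m -> T)
    n (y : A n) (f : 'I_n -> T) : is_smod_morph g ->
  lab_eq x e y f -> lab_eq (g m x) e (g n y) f.
Proof.
by move=> gm [E [s [-> h]]]; exists E, s; rewrite (smod_morph_act gm) acast_fun.
Qed.
End Labels.

Section Join.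
Variables (T : Type) (n : nat) (k : 'I_n -> nat) (e : forall i, 'I_(k i) -> T).

Definition join (x : 'I_(\sum_(i < n) k i)) : T := e (tagnat.sig2 x).

Lemma joinE i (j : 'I_(k i)) : join (tagnat.Rank i j) = e j.
Proof.
rewrite /join.
apply: (congr1 (fun p : {i & 'I_(k i)} => e (tagged p)) (_ : tagnat.sig _ = Tagged _ j)).
exact: tagnat.rankK.
Qed.
End Join.

(** Labelling each input by its block and its place there is the generic labelling: statements about
    all labellings yield equalities through it. *)
Lemma join_Tagged_inj n (k : 'I_n -> nat) :
  injective (join (fun i => @Tagged _ i (fun i => 'I_(k i)))).
Proof. by move=> x y; rewrite /join -!tagnat.sigE12 => /tagnat.sig_inj. Qed.

Lemma RankP n (k : 'I_n -> nat) (P : 'I_(\sum_(i < n) k i) -> Prop) :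
  (forall i (j : 'I_(k i)), P (tagnat.Rank i j)) -> forall x, P x.
Proof. by move=> h x; rewrite -[x]tagnat.sig2K. Qed.

Lemma lt_RankE n (k : 'I_n -> nat) i (j : 'I_(k i)) i' (j' : 'I_(k i')) :
  (tagnat.Rank i j < tagnat.Rank i' j')%N = (i < i')%N || (i == i') && (j < j')%N.
Proof.
rewrite -[LHS]/(@tagnat.rank n k (Tagged _ j) < @tagnat.rank n k (Tagged _ j'))%O.
rewrite tagnat.lt_rank Order.SigmaOrder.ltEsig /= !leEord.
case: (ltngtP i i') => //= [|/val_inj ii'].
  by move=> lt; rewrite (negPf (_ : i != i')) // neq_ltn lt orbT.
by case: _ / ii' in j' *; rewrite tagged_asE eqxx.
Qed.

Lemma big_Rank (R : Type) (idx : R) (op : Monoid.com_law idx) n (k : 'I_n -> nat)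
    (P : pred 'I_(\sum_(i < n) k i)) (F : 'I_(\sum_(i < n) k i) -> R) :
  \big[op/idx]_(s < \sum_(i < n) k i | P s) F s =
  \big[op/idx]_(i < n) \big[op/idx]_(j < k i | P (tagnat.Rank i j)) F (tagnat.Rank i j).
Proof.
rewrite (reindex (@tagnat.rank _ k)) /=; last exact: onW_bij (@tagnat.rank_bij _ k).
by rewrite sig_big_dep /=; apply: eq_big => p; rewrite tagnat.rankE.
Qed.

(** Positions count earlier inputs, and the order on the pairs (i, j) is lexicographic: the earlier
    blocks are those with a smaller [i], then those with the same [i] and a smaller [j]. *)
Lemma cast_Rank_Rank n (k : 'I_n -> nat) (l : 'I_(\sum_(i < n) k i) -> nat) i (j : 'I_(k i))
    (u : 'I_(l (tagnat.Rank i j))) :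
  cast_ord (sum_blocks l) (tagnat.Rank (tagnat.Rank i j) u) =
  tagnat.Rank (p_ := fun i => \sum_(j < k i) l (tagnat.Rank i j))%N i
    (tagnat.Rank (p_ := fun j => l (tagnat.Rank i j)) j u).
Proof.
apply: val_inj; rewrite -[LHS]/(val (tagnat.Rank (tagnat.Rank i j) u)).
rewrite /val [LHS]tagnat.RankEsum [RHS]tagnat.RankEsum.
rewrite [X in _ = (_ + X)%N]tagnat.RankEsum addnA; congr (_ + _)%N.
rewrite big_Rank.
rewrite [LHS](bigID (fun i' : 'I_n => i' < i)%N) /=; congr (_ + _)%N.
  by apply: eq_bigr => i' lt; apply: eq_bigl => j'; rewrite lt_RankE lt.
rewrite (bigD1 i) ?ltnn //= [X in (_ + X)%N]big1 ?addn0.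
  by apply: eq_bigl => j'; rewrite lt_RankE ltnn eqxx.
move=> i' /andP[ge ne]; apply: big_pred0 => j'.
by rewrite lt_RankE (negPf ge) (negPf ne).
Qed.

(** * Operations on multilinear maps *)

Section MultilinearTheory.
Variables (K : fieldType) (n : nat).

Lemma multilinear_coord (V V' : 'I_n -> lmodType K) (W : lmodType K)
    (F : (forall i, V' i) -> W) (g : forall i, V i -> V' i) :
  multilinear F -> (forall i, linear (g i)) -> multilinear (fun q => F (fun i => g i (q i))).
Proof.
move=> Fl gl q i a u v.
have h x : (fun j => g j (dfwith q x j)) = dfwith (fun j => g j (q j)) (g i x).
  by apply: functional_extensionality_dep => j; case: dfwithP => [|j' ne]; rewrite ?dfwith_in ?dfwith_out.
by rewrite !h gl Fl.
Qed.

Lemma multilinear_perm (V : 'I_n -> lmodType K) (W : lmodType K) (s : 'S_n)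
    (F : (forall i, V (s i)) -> W) :
  multilinear F -> multilinear (fun q : forall i, V i => F (fun i => q (s i))).
Proof.
move=> Fl q i; suff H i' : linear (fun x : V (s i') => F (fun j => dfwith q x (s j))).
  by have := H (s^-1%g i); rewrite permKV.
have h (x : V (s i')) : (fun j => dfwith q x (s j)) = dfwith (fun j => q (s j)) x.
  apply: functional_extensionality_dep => j; case: (eqVneq i' j) => [<-|ne]; first by rewrite !dfwith_in.
  by rewrite !dfwith_out // (inj_eq perm_inj).
by move=> a u v; rewrite !h Fl.
Qed.

Lemma multilinear_rank (k : 'I_n -> nat) (V : 'I_(\sum_(i < n) k i) -> lmodType K)
    (V' : 'I_n -> lmodType K) (W : lmodType K) (F : (forall i, V' i) -> W)
    (G : forall i, (forall j : 'I_(k i), V (tagnat.Rank i j)) -> V' i) :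
  multilinear F -> (forall i, multilinear (G i)) ->
  multilinear (fun q => F (fun i => G i (fun j => q (tagnat.Rank i j)))).
Proof.
move=> Fl Gl q; apply: RankP => i j a u v.
have h (x : V (tagnat.Rank i j)) : (fun i' => G i' (fun j' => dfwith q x (tagnat.Rank i' j'))) =
    dfwith (fun i' => G i' (fun j' => q (tagnat.Rank i' j')))
      (G i (dfwith (fun j' => q (tagnat.Rank i j')) x)).
  apply: functional_extensionality_dep => i'; case: dfwithP => [|i'' ne].
    congr (G i _); apply: functional_extensionality_dep => j'.
    case: (eqVneq j j') => [<-|ne]; first by rewrite !dfwith_in.
    by rewrite !dfwith_out // -(inj_eq val_inj) tagnat.eq_Rank eqxx.
  congr (G i'' _); apply: functional_extensionality_dep => j'.
  by rewrite dfwith_out // -(inj_eq val_inj) tagnat.eq_Rank negb_and ne.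
by rewrite !h Gl Fl.
Qed.

Lemma multilinear_sum (V : 'I_n -> lmodType K) (W : lmodType K) I (r : seq I) (P : pred I)
    (F : I -> (forall i, V i) -> W) :
  (forall j, multilinear (F j)) -> multilinear (fun q => \sum_(j <- r | P j) F j q).
Proof.
move=> Fl q i a u v; rewrite scaler_sumr -big_split; apply: eq_bigr => j _.
by rewrite Fl.
Qed.

Lemma multilinear_post (V : 'I_n -> lmodType K) (W W' : lmodType K)
    (F : (forall i, V i) -> W) (g : W -> W') :
  multilinear F -> linear g -> multilinear (fun q => g (F q)).
Proof. by move=> Fl gl q i a u v; rewrite Fl gl. Qed.

Lemma linear_scale (W : lmodType K) (c : K) : linear (fun x : W => c *: x).
Proof. by move=> a u v; rewrite scalerDr !scalerA mulrC. Qed.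

Lemma multi_scale (V : 'I_n -> lmodType K) (W : lmodType K) (F : (forall i, V i) -> W)
    (a : 'I_n -> K) q : multilinear F ->
  F (fun i => a i *: q i) = (\prod_i a i) *: F q.
Proof.
(* [mix m] rescales the first [m] arguments only, so that they can be rescaled one by one. *)
move=> Fl; pose mix (m : nat) := fun i : 'I_n => (if (i < m)%N then a i else 1) *: q i.
suff main m : (m <= n)%N -> F (mix m) = (\prod_(i < n | (i < m)%N) a i) *: F q.
  have -> : (fun i => a i *: q i) = mix n by apply: functional_extensionality_dep => i; rewrite /mix ltn_ord.
  rewrite main //; congr (_ *: _); apply: eq_bigl => i; exact: ltn_ord.
elim: m => [_|m IH lt_mn].
  rewrite big_pred0 // scale1r; congr F; apply: functional_extensionality_dep => i.
  by rewrite /mix scale1r.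
pose i0 := Ordinal lt_mn.
have e : mix m.+1 = dfwith (mix m) (a i0 *: q i0).
  apply: functional_extensionality_dep => i; case: dfwithP => [|i' ne]; first by rewrite /mix ltnS leqnn.
  by rewrite /mix ltnS leq_eqVlt (negPf (_ : i' != m :> nat)) // eq_sym.
have e' : mix m = dfwith (mix m) (q i0).
  by rewrite -[LHS](dfwith_id _ i0) {2}/mix ltnn scale1r.
rewrite e (linZ (Fl _ _)) -e' IH ?(ltnW lt_mn) // scalerA; congr (_ *: _).
rewrite [RHS](bigD1 i0) /=; last exact: ltnSn.
congr (_ * _); apply: eq_bigl => i.
by rewrite ltnS -(inj_eq val_inj) /= ltn_neqAle andbC.
Qed.

Lemma multi0 (V : 'I_n -> lmodType K) (W : lmodType K) (F : (forall i, V i) -> W) q i :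
  multilinear F -> q i = 0 -> F q = 0.
Proof. by move=> Fl e; rewrite -(dfwith_id q i) e (lin0 (Fl q i)). Qed.

Lemma homog_dfwith (V : 'I_n -> dgvect K) (q : forall i, V i) (b : 'I_n -> int) i b' (x : V i) :
  (forall j, homog (b j) (q j)) -> homog b' x ->
  forall j, homog (if j == i then b' else b j) (dfwith q x j).
Proof.
move=> hq hx j; case: dfwithP => [|j' ne]; first by rewrite eqxx.
by rewrite eq_sym (negPf ne).
Qed.
End MultilinearTheory.

Section Weights.
Variables (K : fieldType) (V : dgvect K).

(** [par x] projects onto the part of parity [x]; [eps x] is the Koszul sign for crossing an element
    of parity [x]. Being linear operators, they put signs into formulas that must hold for
    inhomogeneous elements. *)
Definition par (x : 'F_2) (v : V) := wt (fun i => (pz i == x)%:R) v.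
Definition eps (x : 'F_2) (v : V) := wt (fun i => sg K (x * pz i)) v.

Lemma par_linear x : linear (par x). Proof. exact: wt_linear. Qed.
Lemma eps_linear x : linear (eps x). Proof. exact: wt_linear. Qed.
Lemma par_homog x i v : homog i v -> par x v = (pz i == x)%:R *: v.
Proof. exact: wt_homog. Qed.
Lemma eps_homog x i v : homog i v -> eps x v = sg K (x * pz i) *: v.
Proof. exact: wt_homog. Qed.
End Weights.

(** The exponent in [comp_assoc], modulo 2: each [c] in block [i] crosses the [b i'] of the later
    blocks. *)
Definition blk n (k : 'I_n -> nat) (b : 'I_n -> 'F_2) (c : 'I_(\sum_(i < n) k i) -> 'F_2) : 'F_2 :=
  \sum_(i < n) \sum_(i' < n | (i < i')%N) \sum_(j < k i) c (tagnat.Rank i j) * b i'.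

(** The exponent in [comp_act_l], modulo 2: one term for each inversion of [s]. *)
Definition pinv n (s : 'S_n) (b : 'I_n -> 'F_2) : 'F_2 :=
  \sum_(i < n) \sum_(j < n | (i < j)%N && (s j < s i)%N) b (s i) * b (s j).

Section CompMap.
Variables (K : fieldType) (A B C : smod K) (c : comp_map A B C).

Lemma ocompD n k (p p' : A n) (q : forall i, B (k i)) : ocomp c (p + p') q = ocomp c p q + ocomp c p' q.
Proof. exact: linD (comp_linear_l c q) _ _. Qed.
Lemma ocompZ n k a (p : A n) (q : forall i, B (k i)) : ocomp c (a *: p) q = a *: ocomp c p q.
Proof. exact: linZ (comp_linear_l c q) _ _. Qed.
Lemma ocomp_sum n k I (r : seq I) (P : pred I) (F : I -> A n) (q : forall i, B (k i)) :
  ocomp c (\sum_(j <- r | P j) F j) q = \sum_(j <- r | P j) ocomp c (F j) q.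
Proof. exact: (lin_sum (comp_linear_l c q)). Qed.
Lemma ocomp0 n k (q : forall i, B (k i)) : ocomp c (0 : A n) q = 0.
Proof. exact: lin0 (comp_linear_l c q). Qed.
Lemma ocompB n k (p p' : A n) (q : forall i, B (k i)) : ocomp c (p - p') q = ocomp c p q - ocomp c p' q.
Proof. exact: linB (comp_linear_l c q) _ _. Qed.

Lemma ocomp_multilinear n k (p : A n) :
  multilinear (fun q : forall i, B (k i) => ocomp c p q).
Proof. by move=> q i; apply: comp_linear_r. Qed.

Lemma ocomp_dgd n k (p : A n) (q : forall i, B (k i)) a (b : 'I_n -> int) :
    homog a p -> (forall i, homog (b i) (q i)) ->
  dgd (ocomp c p q) = ocomp c (dgd p) q +
    \sum_(i < n) sg K (pz a + \sum_(j < n | (j < i)%N) pz (b j)) *: ocomp c p (dfwith q (dgd (q i))).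
Proof.
move=> hp hq; rewrite (comp_dgd c hp hq); congr (_ + _); apply: eq_bigr => i _.
rewrite sg_nat natrD natr_sum abszE; congr (sg K (_ + _) *: _).
by apply: eq_bigr => j _; rewrite abszE.
Qed.

Lemma ocomp_act_l n k (p : A n) (q : forall i, B (k i)) (b : 'I_n -> int) (s : 'S_n) :
    (forall i, homog (b i) (q i)) ->
  ocomp c (sact p s) q = sg K (pinv s (fun i => pz (b i))) *:
    sact (acast (sum_perm k s) (ocomp c p (fun i => q (s i)))) (block_perm k s).
Proof.
move=> hq; rewrite (comp_act_l c _ _ hq) sg_nat natr_sum; congr (sg K _ *: _).
apply: eq_bigr => i _; rewrite natr_sum; apply: eq_bigr => j _.
by rewrite natrM !abszE.
Qed.
End CompMap.

Section Assoc.
Variables (K : fieldType) (A B C D E F : smod K).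
Variables (AB : comp_map A B D) (DC : comp_map D C E) (BC : comp_map B C F) (AF : comp_map A F E).

Definition comp_assoc_sg := forall n (k : 'I_n -> nat) (l : 'I_(\sum_(i < n) k i) -> nat)
    (p : A n) (q : forall i, B (k i)) (r : forall s, C (l s))
    (b : 'I_n -> int) (c : 'I_(\sum_(i < n) k i) -> int),
  (forall i, homog (b i) (q i)) -> (forall s, homog (c s) (r s)) ->
  acast (sum_blocks l) (ocomp DC (ocomp AB p q) r) =
    sg K (blk (fun i => pz (b i)) (fun s => pz (c s)))
    *: ocomp AF p (fun i => ocomp BC (q i) (fun j => r (tagnat.Rank i j))).

Lemma comp_assocP : comp_assoc AB DC BC AF <-> comp_assoc_sg.
Proof.
suff e n (k : 'I_n -> nat) (b : 'I_n -> int) (c : 'I_(\sum_(i < n) k i) -> int) :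
    (-1) ^+ (\sum_(i < n) \sum_(i' < n | (i < i')%N) \sum_(j < k i)
               `|c (tagnat.Rank i j)| * `|b i'|)%N = sg K (blk (fun i => pz (b i)) (fun s => pz (c s))).
  by split=> h n k l p q r b c hq hr; rewrite (h n k l p q r b c) // e.
rewrite sg_nat natr_sum; congr (sg K _).
apply: eq_bigr => i _; rewrite natr_sum; apply: eq_bigr => i' _; rewrite natr_sum.
by apply: eq_bigr => j _; rewrite natrM !abszE.
Qed.
End Assoc.

(** * The endomorphism operad of a right module *)

(** Raw families of operations, the ambient space of Hom_Q(Z^(x) n, Z). A map out of a Day
    convolution is given by its values on blocks, hence one component for each tuple of arities. *)
Definition fam (K : fieldType) (A B : smod K) n :=
  forall k : 'I_n -> nat, (forall i, A (k i)) -> B (\sum_(i < n) k i)%N.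

Section FamLmod.
Variables (K : fieldType) (A B : smod K) (n : nat).
Implicit Types F G H : fam A B n.

HB.instance Definition _ := gen_eqMixin (fam A B n).
HB.instance Definition _ := gen_choiceMixin (fam A B n).

Lemma famP F G : (forall k q, F k q = G k q) -> F = G.
Proof. by move=> h; do 2!apply: functional_extensionality_dep => ?; apply: h. Qed.

Definition fam_add F G : fam A B n := fun k q => F k q + G k q.
Definition fam_opp F : fam A B n := fun k q => - F k q.
Definition fam_scale (a : K) F : fam A B n := fun k q => a *: F k q.

Fact fam_addA : associative fam_add.
Proof. by move=> F G H; apply: famP => k q; apply: addrA. Qed.
Fact fam_addC : commutative fam_add.
Proof. by move=> F G; apply: famP => k q; apply: addrC. Qed.
Fact fam_add0 : left_id (fun k q => 0) fam_add.
Proof. by move=> F; apply: famP => k q; apply: add0r. Qed.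
Fact fam_addN : left_inverse (fun k q => 0) fam_opp fam_add.
Proof. by move=> F; apply: famP => k q; apply: addNr. Qed.
HB.instance Definition _ := GRing.isZmodule.Build (fam A B n) fam_addA fam_addC fam_add0 fam_addN.

Fact fam_scaleA a b F : fam_scale a (fam_scale b F) = fam_scale (a * b) F.
Proof. by apply: famP => k q; apply: scalerA. Qed.
Fact fam_scale1 : left_id 1 fam_scale.
Proof. by move=> F; apply: famP => k q; apply: scale1r. Qed.
Fact fam_scaleDr : right_distributive fam_scale +%R.
Proof. by move=> a F G; apply: famP => k q; apply: scalerDr. Qed.
Fact fam_scaleDl F : {morph fam_scale^~ F : a b / a + b}.
Proof. by move=> a b; apply: famP => k q; apply: scalerDl. Qed.
HB.instance Definition _ := GRing.Zmodule_isLmodule.Build K (fam A B n)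
  fam_scaleA fam_scale1 fam_scaleDr fam_scaleDl.

Lemma fam0E k q : (0 : fam A B n) k q = 0. Proof. by []. Qed.
Lemma fam_linE a F G k q : (a *: F + G) k q = a *: F k q + G k q. Proof. by []. Qed.

Lemma fam_apply_linear k (q : forall i, A (k i)) : linear (fun F : fam A B n => F k q).
Proof. by []. Qed.

(** The Day convolution is induced from products of the groups ['S_(k i)], so by adjunction a map
    out of it is a family equivariant under block sums of permutations. *)
Definition fam_equivariant F := forall k (q : forall i, A (k i)) (t : forall i, 'S_(k i)),
  F k (fun i => sact (q i) (t i)) = sact (F k q) (sum_perms t).

Definition fam_multilinear F := forall k, multilinear (F k).

(** Equivariance is what makes a family well defined on arguments with labelled inputs. *)
Lemma lab_fam F T k (q : forall i, A (k i)) (e : forall i, 'I_(k i) -> T)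
    k' (q' : forall i, A (k' i)) (e' : forall i, 'I_(k' i) -> T) :
  fam_equivariant F -> (forall i, lab_eq (q i) (e i) (q' i) (e' i)) ->
  lab_eq (F k q) (join e) (F k' q') (join e').
Proof.
move=> Fe h; have E : k = k' by apply: functional_extensionality_dep => i; have [] := h i.
case: k' / E q' e' h => q' e' h.
have h' i : exists s : 'S_(k i), q' i = sact (q i) s /\ forall j, e' i (s j) = e i j.
  have [E [s [-> h']]] := h i; exists s; split=> [|j]; first by rewrite acast_id.
  by rewrite -h'; congr (e' i (s _)); apply: val_inj.
have [t ht] := fin_all_exists h'.
rewrite (_ : q' = fun i => sact (q i) (t i)); last first.
  by apply: functional_extensionality_dep => i; case: (ht i).
rewrite Fe; apply: lab_sact; apply: RankP => i j.
by rewrite sum_permsE !joinE; case: (ht i).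
Qed.

(** The converse of [lab_fam], tested on homogeneous arguments, where the signed formulas for the
    families below hold; multilinearity gives the rest. *)
Lemma lab_cong_equivariant F : fam_multilinear F ->
  (forall k (q : forall i, A (k i)) b k' (q' : forall i, A (k' i)) T e e',
    (forall i, homog (b i) (q i)) -> (forall i, homog (b i) (q' i)) ->
    (forall i, @lab_eq _ _ T _ (q i) (e i) _ (q' i) (e' i)) ->
    lab_eq (F k q) (join e) (F k' q') (join e')) ->
  fam_equivariant F.
Proof.
move=> Fl h k q t; move: q; apply: (@multi_eq K n (fun i => A (k i))).
- exact: (multilinear_coord (V := fun i => A (k i)) (g := fun i x => sact x (t i)) (Fl k)
    (fun i => @sact_linear K A _ (t i))).
- exact: (multilinear_post (g := fun x => sact x (sum_perms t)) (Fl k) (@sact_linear K B _ _)).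
move=> q b hq; pose e i (j : 'I_(k i)) := Tagged (fun i => 'I_(k i)) j.
apply: (@lab_inj _ _ _ _ _ (join e)); last exact: join_Tagged_inj.
apply: (@lab_trans _ _ _ _ _ _ _ (F k q) (join (fun i j => e i (t i j)))).
  apply: (h _ _ b) => // i; first exact: sact_homog.
  by apply/lab_sym/lab_sact.
by apply: lab_sact; apply: RankP => i j; rewrite sum_permsE !joinE.
Qed.

End FamLmod.

(** [ring] proves identities valid in every commutative ring; what holds because 2 = 0 is brought in
    by the doubled term [m]. *)
Lemma F2_cancel (m x y : 'F_2) : x + (m + m) = y -> x = y.
Proof. by rewrite F2DD addr0. Qed.

Section MoreSigns.
Variable K : fieldType.

Lemma sg_sum I (r : seq I) (P : pred I) (F : I -> 'F_2) :
  sg K (\sum_(i <- r | P i) F i) = \prod_(i <- r | P i) sg K (F i).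
Proof. by elim/big_ind2: _ => [|x a y b <- <-|]; rewrite ?sg0 ?sgD. Qed.

Lemma sgS x : sg K (x + 1) = - sg K x.
Proof. by rewrite sgD sg1 mulrN1. Qed.

Definition bsum n (k : 'I_n -> nat) (c : 'I_(\sum_(i < n) k i) -> 'F_2) i : 'F_2 :=
  \sum_(j < k i) c (tagnat.Rank i j).

Lemma blkE n (k : 'I_n -> nat) (b : 'I_n -> 'F_2) (c : 'I_(\sum_(i < n) k i) -> 'F_2) :
  blk b c = \sum_(i < n) \sum_(i' < n | (i < i')%N) bsum c i * b i'.
Proof. by apply: eq_bigr => i _; apply: eq_bigr => i' _; rewrite mulr_suml. Qed.

Lemma blkDl n (k : 'I_n -> nat) (b b' : 'I_n -> 'F_2) (c : 'I_(\sum_(i < n) k i) -> 'F_2) :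
  blk (fun i => b i + b' i) c = blk b c + blk b' c.
Proof.
rewrite !blkE -big_split; apply: eq_bigr => i _; rewrite -big_split; apply: eq_bigr => i' _.
exact: mulrDr.
Qed.

Lemma blkDr n (k : 'I_n -> nat) (b : 'I_n -> 'F_2) (c c' : 'I_(\sum_(i < n) k i) -> 'F_2) :
  blk b (fun s => c s + c' s) = blk b c + blk b c'.
Proof.
rewrite !blkE -big_split; apply: eq_bigr => i _; rewrite -big_split; apply: eq_bigr => i' _.
by rewrite /bsum big_split; apply: mulrDl.
Qed.

(** A differential changes one parity by 1 and [blk] is additive in each argument, so its value on
    an indicator is the resulting change of the sign. *)
Lemma blk_delta_l n (k : 'I_n -> nat) i (c : 'I_(\sum_(i < n) k i) -> 'F_2) :
  blk (fun i' => (i' == i)%:R) c = \sum_(i' < n | (i' < i)%N) bsum c i'.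
Proof.
rewrite blkE [RHS]big_mkcond; apply: eq_bigr => i' _; case: ifP => lt.
  rewrite (bigD1 i) //= eqxx mulr1 big1 ?addr0 // => j /andP[_ /negPf->].
  exact: mulr0.
rewrite big1 // => j lt'; case: eqVneq lt' => [->|_ _]; [by rewrite lt | exact: mulr0].
Qed.

Lemma blk_delta_r n (k : 'I_n -> nat) i (j : 'I_(k i)) (b : 'I_n -> 'F_2) :
  blk b (fun s => (s == tagnat.Rank i j)%:R) = \sum_(i' < n | (i < i')%N) b i'.
Proof.
have h i' : bsum (fun s => (s == tagnat.Rank i j)%:R) i' = (i' == i)%:R.
  rewrite /bsum; case: eqVneq => [->|ne].
    rewrite (bigD1 j) //= eqxx big1 ?addr0 // => j' ne.
    by rewrite -(inj_eq val_inj) tagnat.eq_Rank eqxx (inj_eq val_inj) (negPf ne).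
  by rewrite big1 // => j' _; rewrite -(inj_eq val_inj) tagnat.eq_Rank (negPf ne).
rewrite blkE (bigD1 i) //= [X in _ + X]big1 ?addr0.
  by apply: eq_bigr => i' _; rewrite h eqxx mul1r.
by move=> i' ne; rewrite big1 // => ? _; rewrite h (negPf ne) mul0r.
Qed.

Lemma sum_lt_Rank n (k : 'I_n -> nat) i (j : 'I_(k i)) (c : 'I_(\sum_(i < n) k i) -> 'F_2) :
  \sum_(s < \sum_(i < n) k i | (s < tagnat.Rank i j)%N) c s =
  \sum_(i' < n | (i' < i)%N) bsum c i' + \sum_(j' < k i | (j' < j)%N) c (tagnat.Rank i j').
Proof.
rewrite big_Rank /= [LHS](bigID (fun i' : 'I_n => i' < i)%N) /=; congr (_ + _).
  by apply: eq_bigr => i' lt; apply: eq_bigl => j'; rewrite lt_RankE lt.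
rewrite (bigD1 i) ?ltnn //= [X in (_ + X)]big1 ?addr0.
  by apply: eq_bigl => j'; rewrite lt_RankE ltnn eqxx.
move=> i' /andP[ge ne]; apply: big_pred0 => j'.
by rewrite lt_RankE (negPf ge) (negPf ne).
Qed.

Lemma sum_split3 n (i : 'I_n) (f : 'I_n -> 'F_2) :
  \sum_(i' < n) f i' = \sum_(i' < n | (i' < i)%N) f i' + f i + \sum_(i' < n | (i < i')%N) f i'.
Proof.
rewrite (bigID (fun i' : 'I_n => i' < i)%N) /= -addrA; congr (_ + _).
rewrite (bigD1 i) ?ltnn //=; congr (_ + _); apply: eq_bigl => i'.
by rewrite -leqNgt [RHS]ltn_neqAle andbC eq_sym.
Qed.

Lemma pz_dfwith n (b : 'I_n -> int) (i : 'I_n) :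
  (fun j => pz (if j == i then b i - 1 else b j)) = (fun j => pz (b j) + (j == i)%:R).
Proof.
by apply: functional_extensionality_dep => j; case: eqVneq => [->|]; rewrite ?pzB1 ?addr0.
Qed.
End MoreSigns.

Lemma wt_morph (K : fieldType) (V W : dgvect K) (f : V -> W) w v :
  is_dg_morph f -> wt w (f v) = f (wt w v).
Proof.
case=> lf hf _; move: v; apply: linear_homog_eq.
- by move=> a u v; rewrite lf wt_linear.
- by move=> a u v; rewrite wt_linear lf.
by move=> i v hv; rewrite (wt_homog _ hv) (wt_homog _ (hf _ _ hv)) (linZ lf).
Qed.

Section LeibnizNested.
Variables (K : fieldType) (n : nat) (k : 'I_n -> nat).
Variables (V W : 'I_n -> dgvect K) (U : 'I_(\sum_(i < n) k i) -> dgvect K) (X : lmodType K).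
Variables (F : (forall i, W i) -> X).
Variable G : forall i, V i -> (forall j : 'I_(k i), U (tagnat.Rank i j)) -> W i.
Hypothesis F_multi : @multilinear K n W X F.
Hypothesis G_dgd : forall i v u b c, homog b v -> (forall j, homog (c j) (u j)) ->
  dgd (@G i v u) = G (dgd v) u +
    \sum_(j < k i) sg K (pz b + \sum_(j' < k i | (j' < j)%N) pz (c j')) *:
      G v (dfwith u (dgd (u j))).

Let N v (u : forall s, U s) := F (fun i => G (v i) (fun j => u (tagnat.Rank i j))).

(* The associativity isomorphism, with its Koszul sign, is a chain map. *)
Lemma leibniz_nested (v : forall i, V i) (u : forall s, U s) (x : 'F_2) b c :
  (forall i, homog (b i) (v i)) -> (forall s, homog (c s) (u s)) ->
  sg K (blk (fun i => pz (b i)) (fun s => pz (c s))) *: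
    (\sum_(i < n) sg K (x + \sum_(i' < n | (i' < i)%N)
        (pz (b i') + \sum_(j < k i') pz (c (tagnat.Rank i' j)))) *:
      F (dfwith (fun i => G (v i) (fun j => u (tagnat.Rank i j)))
          (dgd (G (v i) (fun j => u (tagnat.Rank i j)))))) =
  \sum_(i < n) (sg K (x + \sum_(i' < n | (i' < i)%N) pz (b i')) *
      sg K (blk (fun j => pz (if j == i then b i - 1 else b j)) (fun s => pz (c s)))) *:
    N (dfwith v (dgd (v i))) u +
  \sum_(s < \sum_(i < n) k i) (sg K (x + \sum_(i < n) pz (b i) +
        \sum_(s' < \sum_(i < n) k i | (s' < s)%N) pz (c s')) *
      sg K (blk (fun i => pz (b i)) (fun t => pz (if t == s then c s - 1 else c t)))) *:
    N v (dfwith u (dgd (u s))).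
Proof.
move=> hv hu; rewrite big_Rank -big_split scaler_sumr; apply: eq_bigr => i _.
set g := fun i => G (v i) _.
rewrite (G_dgd (hv i) (fun j => hu (tagnat.Rank i j))) (linD (@F_multi g i)) !scalerDr; congr (_ + _).
  rewrite scalerA -!sgD pz_dfwith blkDl blk_delta_l big_split /=; congr (sg K _ *: F _).
    rewrite /bsum; set B := blk _ _; set S := \sum_(i' < n | _) _; set T := \sum_(i' < n | _) _.
    ring.
  apply: functional_extensionality_dep => i'; case: (eqVneq i i') => [<-|ne].
    by rewrite !dfwith_in.
  by rewrite !dfwith_out.
rewrite (lin_sum (@F_multi g i)) !scaler_sumr; apply: eq_bigr => j _.
rewrite (linZ (@F_multi g i)) !scalerA -!sgD; congr (sg K _ *: F _); last first.
  apply: functional_extensionality_dep => i'; case: (eqVneq i i') => [<-|ne].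
    rewrite !dfwith_in; congr (G _ _); apply: functional_extensionality_dep => j'.
    case: (eqVneq j j') => [<-|ne]; first by rewrite !dfwith_in.
    by rewrite !dfwith_out // -(inj_eq val_inj) tagnat.eq_Rank eqxx.
  rewrite !dfwith_out //; congr (G _ _); apply: functional_extensionality_dep => j'.
  by rewrite dfwith_out // -(inj_eq val_inj) tagnat.eq_Rank negb_and ne.
rewrite pz_dfwith blkDr blk_delta_r sum_lt_Rank.
set B := blk _ _; set T := \sum_(j' < k i | _) _.
rewrite (sum_split3 i) big_split /bsum; set L := \sum_(i' < n | (i' < i)%N) pz (b i').
set M := \sum_(i' < n | (i < i')%N) _.
set S := \sum_(i' < n | (i' < i)%N) \sum_(j' < _) _.
(* [M] is the parity of the [v i'] after block [i]: [dgd] crosses them on its way to the [u s], and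
   [blk] changes by the same amount. *)
by move: B T L M S => B T L M S /=; apply: (@F2_cancel M); ring.
Qed.
End LeibnizNested.

Lemma deg_dfwith n (a : int) (b : 'I_n -> int) i :
  a + \sum_(j < n) (if j == i then b i - 1 else b j) = a + \sum_(j < n) b j - 1.
Proof.
rewrite (bigD1 i) //= eqxx [in RHS](bigD1 i) //= (eq_bigr b) => [|j /negPf->//].
by rewrite -!addrA; do 2!congr (_ + _); rewrite addrC.
Qed.

(** * The complex of right Q-linear maps from the n-th Day power of Z to Z *)

Section HomPredg.
Variables (K : fieldType) (Z Q : smod K) (R : comp_map Z Q Z) (n : nat).
Implicit Types F G : fam Z Z n.

(** The formula of [comp_assoc] with evaluation as left action: that the actions of End and Q on Z
    commute ([End_lract]) is thus built into End. *)
Definition fam_right_linear F := forall k (l : 'I_(\sum_(i < n) k i) -> nat)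
    (z : forall i, Z (k i)) (q : forall s, Q (l s))
    (b : 'I_n -> int) (c : 'I_(\sum_(i < n) k i) -> int),
  (forall i, homog (b i) (z i)) -> (forall s, homog (c s) (q s)) ->
  acast (sum_blocks l) (ocomp R (F k z) q) =
    sg K (blk (fun i => pz (b i)) (fun s => pz (c s)))
    *: F _ (fun i => ocomp R (z i) (fun j => q (tagnat.Rank i j))).

Record is_qfam F : Prop := IsQFam {
  qfam_multi : fam_multilinear F;
  qfam_equiv : fam_equivariant F;
  qfam_right : fam_right_linear F
}.

Definition fam_homog a F := forall k (z : forall i, Z (k i)) (b : 'I_n -> int),
  (forall i, homog (b i) (z i)) -> homog (a + \sum_(i < n) b i) (F k z).

Definition is_hom a F := is_qfam F /\ fam_homog a F.

Lemma is_qfam0 : is_qfam 0.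
Proof.
split=> [k q i a u v|k q t|k l z q b c _ _]; rewrite !fam0E.
- by rewrite scaler0 addr0.
- by rewrite (lin0 (@sact_linear K Z _ _)).
- by rewrite ocomp0 (lin0 (@acast_linear K Z _ _ _)) scaler0.
Qed.

Lemma is_qfam_linear a F G : is_qfam F -> is_qfam G -> is_qfam (a *: F + G).
Proof.
move=> [Fl Fe Fr] [Gl Ge Gr]; split.
- move=> k q i c u v; rewrite !fam_linE.
  rewrite Fl Gl !scalerDr !scalerA addrACA; congr (_ + _ + _).
  by rewrite mulrC.
- move=> k q t; rewrite !fam_linE.
  by rewrite Fe Ge sactD sactZ.
move=> k l z q b c hz hq; rewrite !fam_linE.
rewrite ocompD ocompZ (@acast_linear K Z) (Fr _ _ _ _ _ _ hz hq) (Gr _ _ _ _ _ _ hz hq).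
by rewrite scalerDr !scalerA mulrC.
Qed.

Lemma is_hom0 a : is_hom a 0.
Proof. by split; [exact: is_qfam0 | move=> k z b _; apply: homog0]. Qed.

Lemma is_hom_linear d (a : K) F G : is_hom d F -> is_hom d G -> is_hom d (a *: F + G).
Proof.
move=> [Fq Fh] [Gq Gh]; split; first exact: is_qfam_linear.
by move=> k z b hz; apply: homog_linear; [apply: Fh | apply: Gh].
Qed.

Lemma fam_sum I (r : seq I) (P : pred I) (F : I -> fam Z Z n) k (z : forall i, Z (k i)) :
  (\sum_(j <- r | P j) F j) k z = \sum_(j <- r | P j) F j k z.
Proof. exact: (lin_sum (fam_apply_linear (B := Z) z)). Qed.

Lemma fam_eq F G : fam_multilinear F -> fam_multilinear G ->
  (forall k (z : forall i, Z (k i)) b, (forall i, homog (b i) (z i)) -> F k z = G k z) -> F = G.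
Proof.
move=> Fl Gl h; apply: famP => k.
by apply: (multi_eq (V := fun i => Z (k i)) (Fl k) (Gl k)) => z b; apply: h.
Qed.

Lemma is_hom_free (s : seq int) (x : int -> fam Z Z n) :
  uniq s -> (forall i, is_hom i (x i)) -> \sum_(i <- s) x i = 0 ->
  forall i, i \in s -> x i = 0.
Proof.
move=> us hx e i si; have [[xl _ _] _] := hx i; apply: fam_eq => //.
  by case: is_qfam0.
move=> k z b hz; have := congr1 (fun F : fam Z Z n => F k z) e; rewrite fam_sum => e'.
(* On arguments of total degree [S] the component of degree [i] takes values in degree [i + S], so
   independence is used for the shifted degrees. *)
pose S := \sum_(i < n) b i.
have := @homog_free K (Z _) [seq j + S | j <- s] (fun j => x (j - S) k z).
rewrite (map_inj_uniq (addIr S)) => /(_ us) h.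
have := h _ _ (i + S); rewrite addrK => -> //.
- by move=> j; have [_ /(_ k z b hz)] := hx (j - S); rewrite subrK.
- by rewrite big_map -[RHS]e'; apply: eq_bigr => j _; rewrite addrK.
- by rewrite (mem_map (addIr S)).
Qed.

(** The differential of Hom, d F - (-1)^|F| F d, is written without reference to the degree of [F].
    The outer [eps 1] in [dfam] gives the parity of the whole value, and the inner ones, on the
    slots from [i] on, remove the parities of these slots. What remains is the degree of [F] and of
    the arguments before [i]. *)
Definition dslot (k : 'I_n -> nat) (i j : 'I_n) (x : Z (k j)) : Z (k j) :=
  if (j < i)%N then x else eps 1 (if j == i then dgd x else x).

Definition dfam F : fam Z Z n := fun k z =>
  dgd (F k z) - \sum_(i < n) eps 1 (F k (fun j => dslot i (z j))).
Arguments dfam : clear implicits.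

Lemma dslot_linear k i j : linear (@dslot k i j).
Proof.
move=> a u v; rewrite /dslot; case: ifP => // _.
by case: ifP => _; rewrite ?dgd_linear eps_linear.
Qed.

Lemma dslot_homog k (z : forall i, Z (k i)) (b : 'I_n -> int) i :
    (forall i, homog (b i) (z i)) ->
  (fun j => dslot i (z j)) = (fun j =>
    (if (j < i)%N then 1 else sg K (pz (if j == i then b i - 1 else b j)))
    *: dfwith z (dgd (z i)) j).
Proof.
move=> hz; apply: functional_extensionality_dep => j; rewrite /dslot.
case: ifP => lt; first by rewrite scale1r dfwith_out //; apply: contraTneq lt => ->; rewrite ltnn.
have h := homog_dfwith hz (dgd_homog (hz i)) j.
rewrite -[X in sg K X]mul1r -(eps_homog _ h); congr eps.
by case: dfwithP => [|j' ne]; rewrite ?eqxx // eq_sym (negPf ne).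
Qed.

Lemma dfam_homog a F k (z : forall i, Z (k i)) (b : 'I_n -> int) :
    fam_multilinear F -> fam_homog a F -> (forall i, homog (b i) (z i)) ->
  dfam F k z = dgd (F k z) -
    \sum_(i < n) sg K (pz a + \sum_(j < n | (j < i)%N) pz (b j)) *: F k (dfwith z (dgd (z i))).
Proof.
move=> Fl Fh hz; congr (_ - _); apply: eq_bigr => i _.
rewrite (dslot_homog _ hz) (multi_scale (V := fun j => Z (k j))) // (linZ (@eps_linear K _ _)).
pose b' j := if j == i then b i - 1 else b j.
have h : forall j, homog (b' j) (dfwith z (dgd (z i)) j).
  exact: homog_dfwith hz (dgd_homog (hz i)).
rewrite (eps_homog _ (Fh _ _ _ h)) scalerA; congr (_ *: _).
rewrite (_ : \prod_j _ = sg K (\sum_(j < n | ~~ (j < i)%N) pz (b' j))); last first.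
  by rewrite sg_sum [RHS]big_mkcond; apply: eq_bigr => j _; case: ifP.
rewrite -sgD mul1r pzD pz_sum; congr sg; set M := \sum_(j < n | ~~ _) _.
have -> : \sum_(j < n) pz (b' j) = \sum_(j < n | (j < i)%N) pz (b j) + M.
  rewrite (bigID (fun j : 'I_n => j < i)%N) /=; congr (_ + _); apply: eq_bigr => j lt.
  by rewrite /b'; case: eqP lt => [->|//]; rewrite ltnn.
by set L := \sum_(j < n | _) _; symmetry; apply: (@F2_cancel M); ring.
Qed.

Lemma dfam_linear : linear dfam.
Proof.
move=> a F G; apply: famP => k z; rewrite fam_linE /dfam fam_linE dgd_linear.
have -> : \sum_(i < n) eps 1 ((a *: F + G) k (fun j => dslot i (z j))) =
    a *: (\sum_(i < n) eps 1 (F k (fun j => dslot i (z j)))) +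
    \sum_(i < n) eps 1 (G k (fun j => dslot i (z j))).
  by rewrite scaler_sumr -big_split; apply: eq_bigr => i _; rewrite fam_linE eps_linear.
by rewrite scalerBr opprD addrACA.
Qed.

Lemma dfam_multilinear F : fam_multilinear F -> fam_multilinear (dfam F).
Proof.
move=> Fl k.
have h1 : multilinear (fun z => dgd (F k z)) by apply: multilinear_post (Fl k) (@dgd_linear K _).
have h2 : multilinear (fun z => \sum_(i < n) eps 1 (F k (fun j => dslot i (z j)))).
  apply: multilinear_sum => i; apply: multilinear_post (@eps_linear K _ _).
  by apply: (multilinear_coord (V := fun i => Z (k i)) (V' := fun i => Z (k i)) (Fl k)) => j;
    apply: dslot_linear.
by move=> q i a u v; rewrite /dfam h1 h2 scalerBr opprD addrACA.
Qed.

Lemma dfam_equivariant F : fam_equivariant F -> fam_equivariant (dfam F).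
Proof.
move=> Fe k z t; rewrite /dfam Fe -sact_dgd [RHS](linB (@sact_linear K Z _ _)); congr (_ - _).
rewrite (lin_sum (@sact_linear K Z _ _)); apply: eq_bigr => i _.
rewrite -(wt_morph _ _ (sact_morph Z (sum_perms t))) -Fe; congr (wt _ (F k _)).
apply: functional_extensionality_dep => j; rewrite /dslot; case: ifP => // _.
by rewrite -(wt_morph _ _ (sact_morph Z (t j))); case: ifP => // _; rewrite sact_dgd.
Qed.

Lemma dfam_fam_homog a F : fam_multilinear F -> fam_homog a F -> fam_homog (a - 1) (dfam F).
Proof.
move=> Fl Fh k z b hz; rewrite (dfam_homog Fl Fh hz) addrAC; apply: homogB.
  exact/dgd_homog/Fh.
apply: homog_sum => i _; apply: homogZ.
by have /Fh := homog_dfwith hz (dgd_homog (hz i)); rewrite deg_dfwith.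
Qed.

Lemma dfam_right a F : is_hom a F -> fam_right_linear (dfam F).
Proof.
move=> [[Fl Fe Fr] Fh] k l z q b c hz hq.
have Fhz := Fh _ _ _ hz.
have cl m p (e : m = p) := @acast_linear K Z m p e.
rewrite (dfam_homog Fl Fh hz).
have -> : dgd (F k z) = dgd (F k z) + 0 by rewrite addr0.
have E := ocomp_dgd R Fhz hq.
(* The Leibniz rule [E] is solved for the term with [dgd (F k z)]; what is left is the chain map
   property of the associativity isomorphism. *)
rewrite addr0 ocompB ocomp_sum -[ocomp R (dgd (F k z)) q](addrK (\sum_(s < \sum_(i < n) k i)
  sg K (pz (a + \sum_(i < n) b i) + \sum_(j < \sum_(i < n) k i | (j < s)%N) pz (c j)) *:
  ocomp R (F k z) (dfwith q (dgd (q s))))) -E.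
rewrite !(linB (cl _ _ _)) !(lin_sum (cl _ _ _)) acast_dgd (Fr _ _ _ _ _ _ hz hq) dgdZ.
have hzq i : homog (b i + \sum_(j < k i) c (tagnat.Rank i j))
    (ocomp R (z i) (fun j => q (tagnat.Rank i j))) by apply: comp_homog.
rewrite [in RHS](dfam_homog Fl Fh hzq) scalerBr -addrA -opprD; congr (_ - _).
have L := @leibniz_nested K n k (fun i => Z (k i)) (fun i => Z (\sum_(j < k i) l (tagnat.Rank i j))%N)
  (fun s => Q (l s)) (Z _) (F _) (fun i v u => ocomp R v u) (Fl _) _ z q (pz a) b c hz hq.
refine (etrans _ (etrans (esym (L _)) _)); first 1 last.
- by move=> i v u b' c' hv hu; apply: ocomp_dgd.
- congr (_ *: _); apply: eq_bigr => i _; congr (sg K (_ + _) *: _).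
  by apply: eq_bigr => j _; rewrite pzD pz_sum.
rewrite addrC; congr (_ + _); apply: eq_bigr => i _.
  rewrite ocompZ acastZ (Fr _ _ _ _ _ _ (homog_dfwith hz (dgd_homog (hz i))) hq) scalerA.
  by [].
rewrite acastZ (Fr _ _ _ _ _ _ hz (homog_dfwith hq (dgd_homog (hq i)))) scalerA.
by rewrite pzD pz_sum.
Qed.

Lemma dfam_hom a F : is_hom a F -> is_hom (a - 1) (dfam F).
Proof.
move=> Fhom; have [[Fl Fe Fr] Fh] := Fhom; split; last exact: dfam_fam_homog.
split; [exact: dfam_multilinear | exact: dfam_equivariant | exact: dfam_right Fhom].
Qed.

Lemma antisym_sum (W : zmodType) (T : 'I_n -> 'I_n -> W) : (forall i, T i i = 0) ->
  (forall i j : 'I_n, (i < j)%N -> T j i = - T i j) -> \sum_(i < n) \sum_(j < n) T i j = 0.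
Proof.
move=> T0 TN; rewrite pair_big /= (bigID (fun p : 'I_n * 'I_n => p.1 < p.2)%N) /=.
rewrite [X in _ + X](bigID (fun p : 'I_n * 'I_n => p.1 == p.2)) /= [X in _ + (X + _)]big1 ?add0r; last first.
  by move=> [i j] /= /andP[_ /eqP->].
rewrite [X in _ + X](reindex_inj (h := fun p : 'I_n * 'I_n => (p.2, p.1))) /=; last first.
  by move=> [i j] [i' j'] [-> ->].
rewrite -[X in _ + X]opprK -sumrN; apply/eqP; rewrite subr_eq0; apply/eqP.
apply: eq_big => [[i j]|[i j] lt] /=; last by rewrite (TN _ _ lt) opprK.
by rewrite -leqNgt ltn_neqAle andbC eq_sym.
Qed.

(** Terms with one differential outside cancel in pairs, and so do those with [dgd] in two different
    slots; [dgd] twice in one slot gives zero. *)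
Lemma dfamK a F : is_hom a F -> dfam (dfam F) = 0.
Proof.
move=> Fhom; have [[Fl Fe Fr] Fh] := Fhom; have [[dl _ _] dh] := dfam_hom Fhom.
have [[ddl _ _] ddh] := dfam_hom (dfam_hom Fhom).
apply: fam_eq => // [|k z b hz]; first by case: is_qfam0.
rewrite (dfam_homog dl dh hz) [in dgd _](dfam_homog Fl Fh hz) dgdB dgdK dgd_sum sub0r fam0E.
apply/eqP; rewrite -opprD oppr_eq0 -big_split; apply/eqP.
pose T (i j : 'I_n) := sg K (\sum_(j' < n | (j' < i)%N) pz (b j') + \sum_(j' < n | (j' < j)%N)
  pz (if j' == i then b i - 1 else b j')) *:
  F k (dfwith (dfwith z (dgd (z i))) (dgd (dfwith z (dgd (z i)) j))).
transitivity (\sum_(i < n) \sum_(j < n) T i j).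
  apply: eq_bigr => i _; pose s1 := \sum_(j < n | (j < i)%N) pz (b j).
  rewrite (dfam_homog Fl Fh (homog_dfwith hz (dgd_homog (hz i)))) scalerBr dgdZ pzB1 addrAC sgS.
  rewrite /= scaleNr addrA subrr add0r scaleNr opprK scaler_sumr; apply: eq_bigr => j _.
  rewrite scalerA -sgD /T -/s1; congr (sg K _ *: _).
  set s2 := \sum_(j' < n | _) pz (if _ then _ else _).
  by symmetry; apply: (@F2_cancel (pz a)); ring.
apply: antisym_sum => [i|i j lt]; rewrite /T.
  by rewrite dfwith_in dgdK (lin0 (Fl _ _ _)) scaler0.
have ij : i != j by rewrite neq_ltn lt.
have ji : j != i by rewrite eq_sym.
rewrite -scaleNr -sgS (dfwith_out _ _ ji) (dfwith_out _ _ ij); congr (sg K _ *: F k _).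
  have -> : \sum_(j' < n | (j' < i)%N) pz (if j' == j then b j - 1 else b j') =
      \sum_(j' < n | (j' < i)%N) pz (b j').
    apply: eq_bigr => j' lt'; rewrite (negPf (_ : j' != j)) //.
    by apply: contraTneq lt' => ->; rewrite -leqNgt ltnW.
  (* Since i < j, a [dgd] already in slot [i] shifts the parity crossed on the way to slot [j]; this
     1 is the sign of the antisymmetry. *)
  have -> : \sum_(j' < n | (j' < j)%N) pz (if j' == i then b i - 1 else b j') =
      \sum_(j' < n | (j' < j)%N) pz (b j') + 1.
    transitivity (\sum_(j' < n | (j' < j)%N) (pz (b j') + (j' == i)%:R)).
      by apply: eq_bigr => j' _; apply: (congr1 (fun f => f j') (pz_dfwith b i)).
    rewrite big_split; congr (_ + _).
    by rewrite (bigD1 i) //= eqxx big1 ?addr0 // => j' /andP[_ /negPf->].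
  set s1 := \sum_(j' < n | (j' < i)%N) _; set s2 := \sum_(j' < n | _) _.
  by apply: (@F2_cancel 1); ring.
apply: functional_extensionality_dep => i'; case: (eqVneq i i') => [<-|ni].
  by rewrite dfwith_in dfwith_out ?dfwith_in // eq_sym.
case: (eqVneq j i') => [<-|nj]; first by rewrite dfwith_in dfwith_out // dfwith_in.
by rewrite !dfwith_out.
Qed.

Definition hom_predg : predg K := PreDg (@is_hom0) (@is_hom_linear) is_hom_free dfam_linear
  dfam_hom dfamK.
End HomPredg.

(** * Koszul signs of permutations *)

Section PermSigns.
Variable n : nat.
Implicit Types (s t : 'S_n) (b : 'I_n -> 'F_2).

Lemma pair_fold (f : 'I_n -> 'I_n -> 'F_2) : (forall i, f i i = 0) ->
  \sum_i \sum_j f i j = \sum_(i < n) \sum_(j < n | (i < j)%N) (f i j + f j i).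
Proof.
move=> f0; rewrite [RHS](eq_bigr (fun i : 'I_n => \sum_(j < n | (i < j)%N) f i j +
  \sum_(j < n | (i < j)%N) f j i)); last by move=> i _; rewrite big_split.
rewrite big_split; have -> : \sum_(i < n) \sum_(j < n | (i < j)%N) f j i =
    \sum_(i < n) \sum_(j < n | (j < i)%N) f i j.
  by rewrite (exchange_big_dep xpredT).
rewrite -big_split; apply: eq_bigr => i _.
rewrite (sum_split3 i) f0 addr0 addrC; by [].
Qed.

Lemma pinvE s b : pinv s b =
  \sum_(i < n) \sum_(j < n | (i < j)%N) (s j < s i)%:R * (b (s i) * b (s j)).
Proof.
apply: eq_bigr => i _; rewrite [RHS]big_mkcond [LHS]big_mkcond; apply: eq_bigr => j _.
by case: (i < j)%N => //=; case: (s j < s i)%N; rewrite ?mul1r ?mul0r.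
Qed.

Lemma ltb_perm s (i j : 'I_n) : (i < j)%N -> (s i < s j)%:R = 1 + (s j < s i)%:R :> 'F_2.
Proof.
move=> lt; have : s i != s j by rewrite (inj_eq perm_inj) neq_ltn lt.
by case: ltngtP => [||/val_inj->]; rewrite ?eqxx // => _ _; apply: val_inj.
Qed.

Lemma pinv1 b : pinv 1%g b = 0.
Proof.
rewrite pinvE big1 // => i _; rewrite big1 // => j lt.
by rewrite !perm1 ltnNge ltnW // mul0r.
Qed.

(** A pair is inverted by the product when exactly one of [s], on the pair, and [t], on its image,
    inverts it; so inversions add up modulo 2. *)
Lemma pinvM s t b : pinv (s * t)%g b = pinv t b + pinv s (fun i => b (t i)).
Proof.
pose f (i j : 'I_n) := (i < j)%:R * ((t j < t i)%:R * (b (t i) * b (t j))).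
have -> : pinv t b = \sum_i \sum_j f (s i) (s j).
  rewrite pinvE (reindex_inj (@perm_inj _ s)); apply: eq_bigr => i _.
  rewrite big_mkcond (reindex_inj (@perm_inj _ s)); apply: eq_bigr => j _.
  by rewrite /f; case: ifP; rewrite ?mul1r ?mul0r.
rewrite pair_fold => [|i]; last by rewrite /f ltnn mul0r.
rewrite !pinvE -big_split; apply: eq_bigr => i _; rewrite -big_split; apply: eq_bigr => j lt.
rewrite !permM /f /= (ltb_perm s lt).
have nts : t (s i) != t (s j) by rewrite !(inj_eq perm_inj) neq_ltn lt.
have -> : (t (s i) < t (s j))%:R = 1 + (t (s j) < t (s i))%:R :> 'F_2.
  by case: ltngtP nts => [||/val_inj->]; rewrite ?eqxx // => _ _; apply: val_inj.
set x := (s j < s i)%:R; set y := (t (s j) < t (s i))%:R.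
set u := b (t (s i)); set v := b (t (s j)).
apply: (@F2_cancel (x * y * (u * v) + x * (u * v))); ring.
Qed.

Lemma pinvD s b c : pinv s (fun i => b i + c i) = pinv s b + pinv s c +
  \sum_(i < n) \sum_(j < n | (i < j)%N) (s j < s i)%:R * (b (s i) * c (s j) + c (s i) * b (s j)).
Proof.
rewrite !pinvE -!big_split; apply: eq_bigr => i _; rewrite -!big_split; apply: eq_bigr => j _ /=.
ring.
Qed.

(** The sign behind the compatibility of action and differential: [dgd] reaches an input before or
    after the permutation, and the inputs crossed differ by the inversions involving that input,
    which are those whose sign changes. *)
Lemma pinv_delta s b i0 : pinv s (fun i => b i + (i == s i0)%:R) + \sum_(j < n | (j < s i0)%N) b j =
  pinv s b + \sum_(j < n | (j < i0)%N) b (s j).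
Proof.
have sE (P : pred 'I_n) (f : 'I_n -> 'F_2) : \sum_(j < n | P j) f j = \sum_(j < n) (P j)%:R * f j.
  by rewrite big_mkcond; apply: eq_bigr => j _; case: (P j); rewrite ?mul1r ?mul0r.
have -> : pinv s (fun i => b i + (i == s i0)%:R) = pinv s b +
    \sum_(i < n) \sum_(j < n | (i < j)%N) (s j < s i)%:R * (b (s i) * (j == i0)%:R + (i == i0)%:R * b (s j)).
  rewrite pinvD -addrA; congr (_ + _); rewrite pinvE -big_split; apply: eq_bigr => i _.
  rewrite -big_split; apply: eq_bigr => j lt; rewrite /= !(inj_eq perm_inj).
  case: (eqVneq i i0) => [ei|ni]; last by rewrite !mul0r !mulr0 add0r.
  case: (eqVneq j i0) lt => [->|nj lt]; first by rewrite ei ltnn.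
  by rewrite !mulr0 add0r.
rewrite -addrA; congr (_ + _).
have -> : \sum_(i < n) \sum_(j < n | (i < j)%N)
      (s j < s i)%:R * (b (s i) * (j == i0)%:R + (i == i0)%:R * b (s j)) =
    \sum_(j < n) ((j < i0)%N && (s i0 < s j)%N || (i0 < j)%N && (s j < s i0)%N)%:R * b (s j).
  rewrite (eq_bigr (fun i : 'I_n => \sum_(j < n | (i < j)%N) (s j < s i)%:R * (b (s i) * (j == i0)%:R) +
    \sum_(j < n | (i < j)%N) (s j < s i)%:R * ((i == i0)%:R * b (s j)))); last first.
    by move=> i _; rewrite -big_split; apply: eq_bigr => j _; rewrite mulrDr.
  rewrite big_split /= [X in _ + X](bigD1 i0) //= [X in _ + (_ + X)]big1 ?addr0; last first.
    by move=> i /negPf ni; rewrite big1 // => j _; rewrite ni mul0r mulr0.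
  rewrite [X in _ + X]sE -big_split; apply: eq_bigr => i _; rewrite eqxx mul1r sE (bigD1 i0) //= eqxx mulr1.
  rewrite big1 ?addr0; last by move=> j /negPf->; rewrite !mulr0.
  by case: (ltngtP i i0) => _; case: (s i0 < s i)%N; case: (s i < s i0)%N;
    rewrite /= ?mul1r ?mul0r ?add0r ?addr0.
have -> : \sum_(j < n | (j < s i0)%N) b j = \sum_(j < n) (s j < s i0)%:R * b (s j).
  rewrite (reindex_inj (@perm_inj _ s)); exact: sE.
have -> : \sum_(j < n | (j < i0)%N) b (s j) = \sum_(j < n) (j < i0)%:R * b (s j) by apply: sE.
rewrite -big_split; apply: eq_bigr => j _ /=.
case: (eqVneq j i0) => [->|nj]; first by rewrite !ltnn !mul0r addr0.
have := nj; rewrite -(inj_eq (@perm_inj _ s)).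
case: (ltngtP j i0) => [||/val_inj e]; last by rewrite e eqxx in nj.
  by case: (ltngtP (s j) (s i0)) => [||/val_inj->]; rewrite /= ?eqxx ?mul0r ?mul1r ?add0r ?addr0.
by case: (ltngtP (s j) (s i0)) => [||/val_inj->]; rewrite /= ?eqxx ?F2DD ?mul0r ?mul1r ?add0r ?addr0.
Qed.

End PermSigns.

Section BlockSigns.
Variables (n : nat) (k : 'I_n -> nat) (c : 'I_(\sum_(i < n) k i) -> 'F_2).

Lemma big_block (s : 'S_n) (P : pred 'I_(\sum_(i < n) k i)) (F : 'I_(\sum_(i < n) k i) -> 'F_2) :
  \sum_(x < \sum_(i < n) k i | P x) F x =
  \sum_(i < n) \sum_(j < k (s i) | P (cast_ord (sum_perm k s) (tagnat.Rank (p_ := k \o s) i j)))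
    F (cast_ord (sum_perm k s) (tagnat.Rank (p_ := k \o s) i j)).
Proof.
rewrite (reindex (cast_ord (sum_perm k s))); last first.
  by exists (cast_ord (esym (sum_perm k s))) => x _; rewrite ?cast_ordK ?cast_ordKV.
exact: big_Rank.
Qed.

(** A block permutation keeps the order inside each block, so pairs are inverted only between two
    blocks, and then all of them at once. *)
Lemma pinv_block (s : 'S_n) : pinv (block_perm k s) c = pinv s (bsum c).
Proof.
transitivity (\sum_(i < n) \sum_(j < k (s i)) \sum_(i' < n) \sum_(j' < k (s i') |
    (i < i')%N && (s i' < s i)%N) c (tagnat.Rank (s i) j) * c (tagnat.Rank (s i') j')).
  rewrite /pinv (big_block s); apply: eq_bigr => i _; apply: eq_bigr => j _.
  rewrite (big_block s); apply: eq_bigr => i' _.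
  apply: eq_big => [j'|j' _]; last by rewrite !block_permE.
  rewrite !block_permE !lt_RankE.
  rewrite (inj_eq perm_inj); case: (ltngtP i i') => [lt|gt|/val_inj e].
  - have ne : i != i' by rewrite neq_ltn lt.
    by rewrite (eq_sym i') (negPf ne) /= orbF.
  - have ne : i != i' by rewrite neq_ltn gt orbT.
    by rewrite (negPf ne).
  - by case: _ / e j' => j'; rewrite eqxx ltnn /=; case: ltngtP.
apply: eq_bigr => i _; rewrite exchange_big [RHS]big_mkcond; apply: eq_bigr => i' _.
case: ifP => h; last by rewrite big1 // => j _; rewrite big_pred0.
by rewrite /bsum mulr_suml; apply: eq_bigr => j _; rewrite mulr_sumr.
Qed.

Lemma pinv_sum_perms (t : forall i, 'S_(k i)) :
  pinv (sum_perms t) c = \sum_(i < n) pinv (t i) (fun j => c (tagnat.Rank i j)).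
Proof.
rewrite /pinv big_Rank; apply: eq_bigr => i _; apply: eq_bigr => j _.
rewrite big_Rank (bigD1 i) //= [X in _ + X]big1 ?addr0 => [|i' ne].
  by apply: eq_big => [j'|j' _]; rewrite !sum_permsE // !lt_RankE ltnn eqxx.
apply: big_pred0 => j'; rewrite !sum_permsE !lt_RankE (negPf ne) eq_sym (negPf ne) /= !orbF.
by case: ltngtP.
Qed.

Lemma bsum_block (s : 'S_n) i :
  bsum (k := k \o s) (fun x => c (block_perm k s (cast_ord (sum_perm k s) x))) i = bsum c (s i).
Proof. by apply: eq_bigr => j _; rewrite block_permE. Qed.

(** Two ways to reach the permuted interleaved order: interleave and then permute the pairs, or
    permute both lists and then interleave. *)
Lemma blk_block (s : 'S_n) (b : 'I_n -> 'F_2) :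
  blk b c + pinv s (fun i => b i + bsum c i) = pinv s b + pinv (block_perm k s) c +
  blk (k := k \o s) (fun i => b (s i)) (fun x => c (block_perm k s (cast_ord (sum_perm k s) x))).
Proof.
rewrite pinv_block pinvD !blkE.
pose f (i j : 'I_n) := (i < j)%:R * (bsum c i * b j).
have -> : \sum_(i < n) \sum_(i' < n | (i < i')%N) bsum c i * b i' = \sum_i \sum_j f (s i) (s j).
  rewrite (reindex_inj (@perm_inj _ s)); apply: eq_bigr => i _.
  rewrite big_mkcond (reindex_inj (@perm_inj _ s)); apply: eq_bigr => j _.
  by rewrite /f; case: ifP; rewrite ?mul1r ?mul0r.
rewrite pair_fold => [|i]; last by rewrite /f ltnn mul0r.
rewrite addrC -!addrA; do 2!congr (_ + _); rewrite -big_split; apply: eq_bigr => i _.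
rewrite -big_split; apply: eq_bigr => j lt; rewrite /f /= !bsum_block (ltb_perm s lt).
set x := (s j < s i)%:R; set u := bsum c _; set v := bsum c _.
by symmetry; apply: (@F2_cancel (x * (b (s i) * u) + x * (v * b (s j)))); ring.
Qed.
End BlockSigns.

(** Stated for an indexed family because [x = y] alone does not put [z x] and [z y] in the same
    type. *)
Lemma lab_eq_refl_idx (K : fieldType) (Z : smod K) T (I : Type) (l : I -> nat) (z : forall s, Z (l s))
    (e : forall s, 'I_(l s) -> T) x y : x = y -> lab_eq (z x) (@e x) (z y) (@e y).
Proof. by move=> ->; apply: lab_refl. Qed.

Definition jj (T : Type) n (k : 'I_n -> nat) (l : 'I_(\sum_(i < n) k i) -> nat)
    (e : forall s, 'I_(l s) -> T) :=
  join (fun i => join (fun j => e (@tagnat.Rank n k i j))).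

Lemma jjE (T : Type) n (k : 'I_n -> nat) (l : 'I_(\sum_(i < n) k i) -> nat)
    (e : forall s, 'I_(l s) -> T) x :
  jj e (cast_ord (sum_blocks l) x) = join e x.
Proof.
by move: x; apply: RankP => s u; move: s u; apply: RankP => i j u; rewrite cast_Rank_Rank /jj !joinE.
Qed.

Section LabBlocks.
Variables (K : fieldType) (Z : smod K) (n : nat) (k : 'I_n -> nat).
Variable l : 'I_(\sum_(i < n) k i) -> nat.
Variables (x : Z (\sum_(s < \sum_(i < n) k i) l s)%N).
Variable y : Z (\sum_(i < n) \sum_(j < k i) l (tagnat.Rank i j))%N.

Lemma lab_blocks T (e : forall s, 'I_(l s) -> T) :
  acast (sum_blocks l) x = y -> lab_eq x (join e) y (jj e).
Proof. by move<-; apply: lab_cast => u; apply: jjE. Qed.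

Lemma lab_blocks_eq :
  (forall T (e : forall s, 'I_(l s) -> T), lab_eq x (join e) y (jj e)) ->
  acast (sum_blocks l) x = y.
Proof.
move=> h; have := h _ (fun s => @Tagged _ s (fun s => 'I_(l s))); move/lab_inj_cast; apply.
  exact: jjE.
move=> u v; rewrite -[u](cast_ordKV (sum_blocks l)) -[v](cast_ordKV (sum_blocks l)) !jjE.
by move/join_Tagged_inj ->.
Qed.
End LabBlocks.

Section LabCompMap.
Variables (K : fieldType) (A B C : smod K) (c : comp_map A B C) (T : Type).

Lemma lab_ocomp n (p : A n) k (q : forall i, B (k i)) (e : forall i, 'I_(k i) -> T)
    k' (q' : forall i, B (k' i)) (e' : forall i, 'I_(k' i) -> T) :
  (forall i, lab_eq (q i) (e i) (q' i) (e' i)) ->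
  lab_eq (ocomp c p q) (join e) (ocomp c p q') (join e').
Proof. exact: (@lab_fam K B C n (fun k q => ocomp c p q) T _ _ _ _ _ _ (fun k q t => comp_act_r c p q t)). Qed.

Lemma lab_block_perm n (k : 'I_n -> nat) (s : 'S_n) (x : C (\sum_(i < n) k (s i))%N)
    (e : forall i, 'I_(k i) -> T) :
  lab_eq (sact (acast (sum_perm k s) x) (block_perm k s)) (join e) x (join (fun i => e (s i))).
Proof.
apply: lab_sym; apply: (@lab_trans _ _ _ _ _ _ _ (acast (sum_perm k s) x)
  (fun u => join e (block_perm k s u))).
  apply: lab_cast; apply: (@RankP n (k \o s)) => i j.
  by rewrite block_permE joinE (joinE (k := k \o s)).
exact: lab_sact.
Qed.

Lemma lab_ocomp_act n (p : A n) (s : 'S_n) k (q : forall i, B (k i)) (b : 'I_n -> int)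
    (e : forall i, 'I_(k i) -> T) : (forall i, homog (b i) (q i)) ->
  lab_eq (ocomp c (sact p s) q) (join e)
    (sg K (pinv s (fun i => pz (b i))) *: ocomp c p (fun i => q (s i))) (join (fun i => e (s i))).
Proof.
move=> hq; rewrite (ocomp_act_l c p s hq); apply: lab_scale; exact: lab_block_perm.
Qed.

Lemma lab_ocomp_cast m n (E : m = n) (p : A m) k (q : forall i, B (k i))
    (e : forall i, 'I_(k i) -> T) :
  lab_eq (ocomp c (acast E p) q) (join e)
    (ocomp c p (fun i => q (cast_ord E i))) (join (fun i => e (cast_ord E i))).
Proof.
case: n / E k q e => k q e; apply: lab_ocomp => i; apply: lab_eq_refl_idx.
exact: val_inj.
Qed.
End LabCompMap.

Lemma inspan_map (K : fieldType) (V W : lmodType K) (H : int -> V -> Prop) (H' : int -> W -> Prop)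
    (f : V -> W) : linear f -> (forall i, H' i 0) ->
  (forall i (a : K) u v, H' i u -> H' i v -> H' i (a *: u + v)) ->
  (forall i v, H i v -> inspan H' (f v)) -> forall v, inspan H v -> inspan H' (f v).
Proof.
move=> fl H0 Hl h v; elim=> [|i u {}v hu _ IH]; first by rewrite lin0 //; apply: inspan0.
by rewrite linD // -[f u]scale1r; apply: (inspan_linear H0 Hl) => //; apply: h hu.
Qed.

(** Homogeneous arguments have a single parity pattern [e0]: a sum over all patterns, which is
    defined on every argument, collapses there to the expected term. *)
Lemma sum_pattern (K : fieldType) n (W : lmodType K) (T : finType) (e0 : 'I_n -> T)
    (G : {ffun 'I_n -> T} -> W) :
  \sum_(e : {ffun 'I_n -> T}) (\prod_(i < n) (e0 i == e i)%:R) *: G e = G (finfun e0) :> W.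
Proof.
rewrite (bigD1 (finfun e0)) //= big1 ?scale1r => [|i _]; last by rewrite ffunE eqxx.
rewrite big1 ?addr0 // => e ne.
have [i /negPf ni] : exists i, e0 i != e i.
  apply/existsP; apply: contraNT ne; rewrite negb_exists => /forallP h.
  by apply/eqP/ffunP => i; rewrite ffunE; apply/esym/eqP; move: (h i); rewrite negbK.
by rewrite (bigD1 i) //= ni mul0r scale0r.
Qed.

(** * The endomorphism complexes and the action of the symmetric groups *)

Section EndSMod.
Variables (K : fieldType) (Z Q : smod K) (R : comp_map Z Q Z).

(** A family has a component for each tuple of arities, so its degrees may be unbounded; only finite
    sums of homogeneous families are kept. *)
Definition End_dg n : dgvect K := span_dg (hom_predg R n).
Definition ev n (f : End_dg n) : fam Z Z n := span_val f.

Arguments ev {n} f k z.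

Lemma ev_linear n : linear (@ev n). Proof. exact: span_val_linear. Qed.
Lemma ev_inj n : injective (@ev n). Proof. exact: span_val_inj. Qed.
Lemma evD n (f g : End_dg n) k z : ev (f + g) k z = ev f k z + ev g k z.
Proof. by rewrite (linD (@ev_linear n)). Qed.
Lemma ev_qfam n (f : End_dg n) : is_qfam R (ev f).
Proof.
rewrite /ev; case: f => f /= /asboolP; elim=> [|i u v [hu _] _ IH]; first exact: is_qfam0.
by rewrite -[u]scale1r; apply: is_qfam_linear.
Qed.
Lemma ev_multi n (f : End_dg n) : fam_multilinear (ev f). Proof. by case: (ev_qfam f). Qed.
Lemma ev_equiv n (f : End_dg n) : fam_equivariant (ev f). Proof. by case: (ev_qfam f). Qed.

Lemma End_eq n (f g : End_dg n) :
  (forall k (z : forall i, Z (k i)) b, (forall i, homog (b i) (z i)) -> ev f k z = ev g k z) -> f = g.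
Proof. by move=> h; apply: ev_inj; apply: fam_eq h; apply: ev_multi. Qed.

Lemma lab_ev n (f : End_dg n) T k (q : forall i, Z (k i)) (e : forall i, 'I_(k i) -> T)
    k' (q' : forall i, Z (k' i)) (e' : forall i, 'I_(k' i) -> T) :
  (forall i, lab_eq (q i) (e i) (q' i) (e' i)) ->
  lab_eq (ev f k q) (join e) (ev f k' q') (join e').
Proof. exact: lab_fam (ev_equiv f). Qed.

Lemma lab_right n (F : fam Z Z n) T k (l : 'I_(\sum_(i < n) k i) -> nat)
    (z : forall i, Z (k i)) (q : forall s, Q (l s))
    (b : 'I_n -> int) (c : 'I_(\sum_(i < n) k i) -> int) (e : forall s, 'I_(l s) -> T) :
    fam_right_linear R F -> (forall i, homog (b i) (z i)) -> (forall s, homog (c s) (q s)) ->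
  lab_eq (ocomp R (F k z) q) (join e)
    (sg K (blk (fun i => pz (b i)) (fun s => pz (c s)))
      *: F _ (fun i => ocomp R (z i) (fun j => q (tagnat.Rank i j)))) (jj e).
Proof. by move=> Fr hz hq; apply: lab_blocks; apply: Fr. Qed.

(** Forced by [comp_act_l] for the evaluation on Z. The sign is not linear in the arguments, which
    are therefore split by parity. *)
Definition sfam n (s : 'S_n) (F : fam Z Z n) : fam Z Z n := fun k z =>
  \sum_(e : {ffun 'I_n -> 'F_2}) sg K (pinv s e) *:
    sact (acast (sum_perm k s) (F _ (fun i => par (e (s i)) (z (s i))))) (block_perm k s).
Arguments sfam : clear implicits.

Section SFam.
Variables (n : nat) (s : 'S_n).
Implicit Types F : fam Z Z n.

Lemma sfam_homog F k (z : forall i, Z (k i)) (b : 'I_n -> int) : fam_multilinear F ->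
    (forall i, homog (b i) (z i)) ->
  sfam n s F k z = sg K (pinv s (fun i => pz (b i))) *:
    sact (acast (sum_perm k s) (F _ (fun i => z (s i)))) (block_perm k s).
Proof.
move=> Fl hz; rewrite /sfam.
transitivity (\sum_(e : {ffun 'I_n -> 'F_2}) (\prod_(i < n) (pz (b i) == e i)%:R) *:
    (sg K (pinv s e) *: sact (acast (sum_perm k s) (F _ (fun i => z (s i)))) (block_perm k s))).
  apply: eq_bigr => e _; rewrite scalerA mulrC -scalerA; congr (_ *: _).
  rewrite -sactZ -acastZ; congr (sact (acast _ _) _).
  rewrite [X in X *: _](reindex_inj (@perm_inj _ s)) -(multi_scale _ _ (Fl _)).
  by congr (F _ _); apply: functional_extensionality_dep => i; apply: par_homog.
rewrite sum_pattern; congr (sg K (pinv s _) *: _).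
by apply: functional_extensionality_dep => i; rewrite ffunE.
Qed.

Lemma sfam_multi F : fam_multilinear F -> fam_multilinear (sfam n s F).
Proof.
move=> Fl k; apply: multilinear_sum => e.
have h1 : multilinear (fun z : forall i, Z (k i) => F _ (fun i => par (e (s i)) (z (s i)))).
  apply: (@multilinear_perm K n (fun i => Z (k i)) _ s (fun z => F _ (fun i => par (e (s i)) (z i)))).
  exact: (multilinear_coord (V := fun i => Z (k (s i))) (V' := fun i => Z (k (s i)))
    (g := fun i => par (e (s i))) (Fl _) (fun i => @par_linear K (Z (k (s i))) _)).
have h2 : linear (fun x => sg K (pinv s e) *: sact (@acast K Z _ _ (sum_perm k s) x) (block_perm k s)).
  by move=> a u v; rewrite acast_linear sact_linear linear_scale.
exact: (multilinear_post (V := fun i => Z (k i)) h1 h2).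
Qed.

Lemma sfam_linear : linear (sfam n s).
Proof.
move=> a F G; apply: famP => k z; rewrite fam_linE /sfam scaler_sumr -big_split.
apply: eq_bigr => e _; rewrite fam_linE acast_linear sact_linear scalerDr !scalerA.
by rewrite mulrC.
Qed.

Lemma lab_sfam F k (z : forall i, Z (k i)) (b : 'I_n -> int) T (e : forall i, 'I_(k i) -> T) :
    fam_multilinear F -> (forall i, homog (b i) (z i)) ->
  lab_eq (sfam n s F k z) (join e)
    (sg K (pinv s (fun i => pz (b i))) *: F _ (fun i => z (s i))) (join (fun i => e (s i))).
Proof.
by move=> Fl hz; rewrite (sfam_homog Fl hz); apply: lab_scale; apply: lab_block_perm.
Qed.

Lemma sfam_right F : is_qfam R F -> fam_right_linear R (sfam n s F).
Proof.
move=> [Fl Fe Fr] k l z q b c hz hq; apply: lab_blocks_eq => T e.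
have hzq i : homog (b i + \sum_(j < k i) c (tagnat.Rank i j))
    (ocomp R (z i) (fun j => q (tagnat.Rank i j))) by apply: comp_homog.
rewrite (sfam_homog Fl hz) ocompZ.
set bp := block_perm k s; set E := sum_perm k s.
apply: lab_trans; first by apply: lab_scale; apply: (lab_ocomp_act R _ bp e hq).
apply: lab_trans; first by do 2!apply: lab_scale; apply: (lab_ocomp_cast R E).
have hz' i : homog (b (s i)) (z (s i)) by [].
have hq' x : homog (c (bp (cast_ord E x))) (q (bp (cast_ord E x))) by [].
apply: lab_trans.
  by do 2!apply: lab_scale; apply: (lab_right (fun x => e (bp (cast_ord E x))) Fr hz' hq').
apply: lab_sym; apply: lab_trans.
  by apply: lab_scale; apply: (lab_sfam _ Fl hzq).
rewrite !scalerA -!sgD.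
have -> : blk (fun i => pz (b i)) (fun s => pz (c s)) +
    pinv s (fun i => pz (b i + \sum_(j < k i) c (tagnat.Rank i j))) =
  pinv s (fun i => pz (b i)) + pinv bp (fun i => pz (c i)) +
    blk (k := k \o s) (fun i => pz (b (s i))) (fun x => pz (c (bp (cast_ord E x)))).
  rewrite -blk_block; congr (_ + pinv s _); apply: functional_extensionality_dep => i.
  by rewrite pzD pz_sum.
apply: lab_scale; apply: lab_fam => // i; apply: lab_ocomp => j.
by apply: lab_eq_refl_idx; rewrite block_permE.
Qed.

Lemma sfam_hom a F : is_hom R a F -> is_hom R a (sfam n s F).
Proof.
move=> [Fq Fh]; have [Fl Fe Fr] := Fq; split; last first.
  move=> k z b hz; rewrite (sfam_homog Fl hz); apply: homogZ; apply: sact_homog; apply: acast_homog.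
  have := Fh _ (fun i => z (s i)) (fun i => b (s i)) (fun i => hz (s i)).
  have -> : \sum_(i < n) b i = \sum_(i < n) b (s i) by rewrite (reindex_inj (@perm_inj _ s)).
  by [].
split; [exact: sfam_multi | | exact: sfam_right].
apply: lab_cong_equivariant; first exact: sfam_multi.
move=> k q b k' q' T e e' hq hq' h.
apply: lab_trans; first exact: (lab_sfam e Fl hq).
apply: lab_sym; apply: lab_trans; first exact: (lab_sfam e' Fl hq').
by apply: lab_scale; apply: lab_sym; apply: lab_fam.
Qed.

Lemma sfam_inspan (f : End_dg n) : inspan (@is_hom K Z Q R n) (sfam n s (ev f)).
Proof.
have /asboolP := span_valP f; apply: (inspan_map sfam_linear).
- exact: is_hom0.
- exact: is_hom_linear.
by move=> i F hF; apply: inspan_homog (sfam_hom hF).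
Qed.
End SFam.
End EndSMod.

Arguments ev {K Z Q R n} f k z.
Arguments sfam {K Z n} s F k z.

Section EndSMod2.
Variables (K : fieldType) (Z Q : smod K) (R : comp_map Z Q Z).
Local Notation End_dg := (End_dg R).

Lemma End_lab_eq n (f g : End_dg n) :
  (forall k (z : forall i, Z (k i)) b T (e : forall i, 'I_(k i) -> T),
    (forall i, homog (b i) (z i)) -> lab_eq (ev f k z) (join e) (ev g k z) (join e)) -> f = g.
Proof.
move=> h; apply: End_eq => k z b hz.
by apply: lab_inj (h _ _ _ _ _ hz) (@join_Tagged_inj _ _).
Qed.

Definition end_sact n (f : End_dg n) (s : 'S_n) : End_dg n :=
  @Span K (hom_predg R n) _ (sfam_inspan s f).

Lemma ev_sact n (f : End_dg n) s : ev (end_sact f s) = sfam s (ev f).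
Proof. by []. Qed.

Lemma ev_dgd n (f : End_dg n) : ev (dgd f) = dfam (ev f).
Proof. by []. Qed.

Lemma end_sact_dgd a n (f : End_dg n) s : homog a f -> end_sact (dgd f) s = dgd (end_sact f s).
Proof.
move=> hf; apply: End_eq => k z b hz; rewrite ev_sact !ev_dgd ev_sact.
have [[Fl _ _] Fh] : is_hom R a (ev f) := hf.
have [[sl _ _] sh] := sfam_hom s hf.
rewrite (sfam_homog _ (dfam_multilinear Fl) hz) (dfam_homog sl sh hz) (sfam_homog _ Fl hz).
rewrite (dfam_homog Fl Fh (fun i => hz (s i))) dgdZ -sact_dgd -acast_dgd.
rewrite (linB (@acast_linear _ Z _ _ _)) (linB (@sact_linear _ Z _ _)) scalerBr; congr (_ - _).
rewrite (lin_sum (@acast_linear _ Z _ _ _)) (lin_sum (@sact_linear _ Z _ _)) scaler_sumr.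
(* The slot being differentiated is [i] after the permutation and [s i] before it. *)
rewrite [RHS](reindex_inj (@perm_inj _ s)); apply: eq_bigr => i _.
rewrite acastZ sactZ !scalerA (sfam_homog _ Fl (homog_dfwith hz (dgd_homog (hz (s i))))) scalerA.
rewrite -!sgD; congr (_ *: _); last congr (sact (acast _ (ev f (fun i => k (s i)) _)) _).
  congr sg.   rewrite pz_dfwith -[in RHS]addrA [X in _ = _ + X]addrC pinv_delta.
  exact: addrCA.
apply: functional_extensionality_dep => j; case: (eqVneq i j) => [<-|ne].
  by rewrite !dfwith_in.
by rewrite !dfwith_out // (inj_eq perm_inj).
Qed.

Fact end_sact_morph n (s : 'S_n) : is_dg_morph (fun f : End_dg n => end_sact f s).
Proof.
have sl : linear (fun f : End_dg n => end_sact f s).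
  by move=> a f g; apply: ev_inj; rewrite ev_linear !ev_sact ev_linear sfam_linear.
split=> // [a f hf|]; first exact: sfam_hom.
apply: linear_homog_eq => [a f g|a f g|a f hf]; last exact: end_sact_dgd hf.
- by rewrite dgd_linear sl.
- by rewrite sl dgd_linear.
Qed.

Fact end_sact1 n (f : End_dg n) : end_sact f 1%g = f.
Proof.
apply: End_lab_eq => k z b T e hz; rewrite ev_sact; apply: lab_trans.
  exact: (lab_sfam _ e (ev_multi f) hz).
rewrite pinv1 sg0 scale1r; apply: lab_ev => i; apply: lab_eq_refl_idx.
exact: perm1.
Qed.

Fact end_sactM n (f : End_dg n) (s t : 'S_n) : end_sact f (s * t)%g = end_sact (end_sact f s) t.
Proof.
apply: End_lab_eq => k z b T e hz; rewrite !ev_sact; apply: lab_trans.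
  exact: (lab_sfam _ e (ev_multi f) hz).
apply: lab_sym; apply: lab_trans; first exact: (lab_sfam _ e (sfam_multi s (ev_multi f)) hz).
apply: lab_trans.
  apply: lab_scale; exact: (lab_sfam s (fun i => e (t i)) (ev_multi f) (fun i => hz (t i))).
rewrite scalerA -sgD -pinvM; apply: lab_scale; apply: lab_ev => i; apply: lab_eq_refl_idx.
by rewrite permM.
Qed.

Definition End_smod : smod K := SMod end_sact_morph end_sact1 end_sactM.

Lemma lab_ev_cast m n (E : m = n) (f : End_smod m) k (z : forall i, Z (k i)) T
    (e : forall i, 'I_(k i) -> T) :
  lab_eq (ev (acast E f : End_smod n) k z) (join e)
    (ev (f : End_smod m) _ (fun i => z (cast_ord E i))) (join (fun i => e (cast_ord E i))).
Proof.
case: n / E k z e => k z e; apply: lab_ev => i; apply: lab_eq_refl_idx.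
exact: val_inj.
Qed.

(* The Koszul sign depends on the parities of the g i, hence the sum over the
   possible parities. *)
Definition rcomp n (k : 'I_n -> nat) (F : fam Z Z n) (g : forall i, End_smod (k i)) :
    fam Z Z (\sum_(i < n) k i) := fun l z =>
  acast (esym (sum_blocks l)) (\sum_(e : {ffun 'I_n -> 'F_2})
    F _ (fun i => ev (par (e i) (g i)) _
      (fun j => eps (\sum_(i' < n | (i < i')%N) e i') (z (tagnat.Rank i j))))).
Arguments rcomp {n} k F g.

Section RComp.
Variables (n : nat) (k : 'I_n -> nat).
Implicit Types (F : fam Z Z n) (g : forall i, End_smod (k i)).

(** [eps] moves the arguments in block [i] past the operations [g i'] of the later blocks; together
    these signs are [blk]. *)
Lemma rcomp_homog F g (b : 'I_n -> int) l (z : forall s, Z (l s)) c : fam_multilinear F ->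
    (forall i, homog (b i) (g i)) -> (forall s, homog (c s) (z s)) ->
  rcomp k F g l z = acast (esym (sum_blocks l)) (sg K (blk (fun i => pz (b i)) (fun s => pz (c s))) *:
    F _ (fun i => ev (g i) _ (fun j => z (tagnat.Rank i j)))).
Proof.
move=> Fl hg hz; congr acast.
pose G (e : {ffun 'I_n -> 'F_2}) := F _ (fun i => ev (g i) _
   (fun j => eps (\sum_(i' < n | (i < i')%N) e i') (z (tagnat.Rank i j)))).
transitivity (\sum_(e : {ffun 'I_n -> 'F_2}) (\prod_(i < n) (pz (b i) == e i)%:R) *: G e).
  apply: eq_bigr => e _; rewrite -(multi_scale _ _ (Fl _)); congr (F _ _).
  apply: functional_extensionality_dep => i; rewrite (par_homog _ (hg i)).
  by rewrite (linZ (@ev_linear _ _ _ R _)).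
rewrite sum_pattern /G.
transitivity (F _ (fun i => (\prod_(j < k i)
    sg K ((\sum_(i' < n | (i < i')%N) pz (b i')) * pz (c (tagnat.Rank i j)))) *:
    ev (g i) _ (fun j => z (tagnat.Rank i j)))).
  congr (F _ _); apply: functional_extensionality_dep => i.
  rewrite -(multi_scale _ _ (@ev_multi _ _ _ R _ (g i) _)); congr (ev _ _ _).
  apply: functional_extensionality_dep => j; rewrite (eps_homog _ (hz _)).
  congr (sg K (_ * _) *: _); apply: eq_bigr => i' _; exact: ffunE.
rewrite (multi_scale _ _ (Fl _)); congr (_ *: _).
rewrite /blk sg_sum; apply: eq_bigr => i _; rewrite exchange_big sg_sum; apply: eq_bigr => j _.
by rewrite -mulr_sumr mulrC.
Qed.

Lemma rcomp_multi F g : fam_multilinear F -> fam_multilinear (rcomp k F g).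
Proof.
move=> Fl l.
have h1 : multilinear (fun z : forall s, Z (l s) => \sum_(e : {ffun 'I_n -> 'F_2})
    F _ (fun i => ev (par (e i) (g i)) _
      (fun j => eps (\sum_(i' < n | (i < i')%N) e i') (z (tagnat.Rank i j))))).
  apply: multilinear_sum => e.
  apply: (@multilinear_rank K n k (fun s => Z (l s)) (fun i => Z (\sum_(j < k i) l (tagnat.Rank i j))%N)
    _ (F _) (fun i z => ev (par (e i) (g i)) _ (fun j => eps _ (z j))) (Fl _)) => i.
  exact: (@multilinear_coord K (k i) (fun j => Z (l (tagnat.Rank i j))) (fun j => Z (l (tagnat.Rank i j)))
    _ (ev (par (e i) (g i)) _) _ (@ev_multi _ _ _ R _ _ _) (fun j => @eps_linear K _ _)).
exact: (multilinear_post (V := fun s => Z (l s)) h1 (@acast_linear K Z _ _ _)).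
Qed.

Lemma rcomp_linear g : linear (fun F => rcomp k F g).
Proof.
move=> a F G; apply: famP => l z; rewrite fam_linE -acast_linear; congr acast.
by rewrite scaler_sumr -big_split; apply: eq_bigr => e _; rewrite fam_linE.
Qed.

Lemma rcomp_multi_g F : fam_multilinear F -> multilinear (rcomp k F).
Proof.
move=> Fl g i a u v; apply: famP => l z; rewrite fam_linE -acast_linear; congr acast.
rewrite scaler_sumr -big_split; apply: eq_bigr => e _.
have h i' : linear (fun f : End_smod (k i') => ev (par (e i') f) (fun j => l (tagnat.Rank i' j))
    (fun j => eps (\sum_(i'' < n | (i' < i'')%N) e i'') (z (tagnat.Rank i' j)))).
  by move=> c f f'; rewrite par_linear ev_linear fam_linE.
exact: (@multilinear_coord K n (fun i => End_smod (k i)) _ _ _ _ (Fl _) h g i a u v).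
Qed.

Lemma lab_rcomp F g (b : 'I_n -> int) l (z : forall s, Z (l s)) c T (e : forall s, 'I_(l s) -> T) :
    fam_multilinear F -> (forall i, homog (b i) (g i)) -> (forall s, homog (c s) (z s)) ->
  lab_eq (rcomp k F g l z) (join e) (sg K (blk (fun i => pz (b i)) (fun s => pz (c s))) *:
    F _ (fun i => ev (g i) _ (fun j => z (tagnat.Rank i j)))) (jj e).
Proof.
by move=> Fl hg hz; rewrite (rcomp_homog Fl hg hz); apply: lab_blocks; apply: acastK.
Qed.
End RComp.
End EndSMod2.

Arguments rcomp {K Z Q R n k} F g l z : rename.

Lemma cast_Rank_RankV n (k : 'I_n -> nat) (l : 'I_(\sum_(i < n) k i) -> nat) i (j : 'I_(k i))
    (u : 'I_(l (tagnat.Rank i j))) :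
  cast_ord (esym (sum_blocks l)) (tagnat.Rank (p_ := fun i => \sum_(j < k i) l (tagnat.Rank i j))%N i
    (tagnat.Rank (p_ := fun j => l (tagnat.Rank i j)) j u)) =
  tagnat.Rank (tagnat.Rank i j) u.
Proof. by rewrite -cast_Rank_Rank cast_ordK. Qed.

Section Pentagon.
Variables (n : nat) (k : 'I_n -> nat) (l : 'I_(\sum_(i < n) k i) -> nat).
Variables (b : 'I_n -> 'F_2) (c : 'I_(\sum_(i < n) k i) -> 'F_2).
Variable d : 'I_(\sum_(s < \sum_(i < n) k i) l s) -> 'F_2.

Let m i := (\sum_(j < k i) l (tagnat.Rank i j))%N.
Let d' (t : 'I_(\sum_(i < n) m i)) := d (cast_ord (esym (sum_blocks l)) t).

Lemma bsum_cast i : bsum d' i = bsum (bsum d) i.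
Proof.
rewrite /bsum /m big_Rank; apply: eq_bigr => j _; apply: eq_bigr => u _.
by rewrite /d' cast_Rank_RankV.
Qed.

(** Both sides sort b.. c.. d.. into the nested order: the left one first distributes the d's over
    the c's, the right one first the c's over the b's. *)
Lemma blk_pentagon :
  blk c d + blk b (fun s => c s + bsum d s) =
  blk b c + blk (fun i => b i + bsum c i) d' +
  \sum_(i < n) blk (k := fun j => l (tagnat.Rank i j)) (fun j => c (tagnat.Rank i j))
    (fun t => d' (tagnat.Rank i t)).
Proof.
have -> : blk c d = blk (bsum c) d' +
  \sum_(i < n) blk (k := fun j => l (tagnat.Rank i j)) (fun j => c (tagnat.Rank i j))
    (fun t => d' (tagnat.Rank i t)).
  rewrite !blkE big_Rank -big_split; apply: eq_bigr => i _ /=.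
  transitivity (\sum_(j < k i) (\sum_(i' < n | (i < i')%N) bsum d (tagnat.Rank i j) * bsum c i' +
      \sum_(j' < k i | (j < j')%N) bsum d (tagnat.Rank i j) * c (tagnat.Rank i j'))).
    apply: eq_bigr => j _; rewrite big_Rank (bigID (fun i' : 'I_n => i < i')%N); congr (_ + _).
      apply: eq_bigr => i' /= lt; rewrite [in RHS]/bsum mulr_sumr; apply: eq_bigl => j'.
      by rewrite lt_RankE lt.
    rewrite (bigD1 i) ?ltnn //= [X in _ + X]big1 ?addr0.
      by apply: eq_bigl => j'; rewrite lt_RankE ltnn eqxx.
    move=> i' /andP[/negPf ge ne]; apply: big_pred0 => j'.
    by rewrite lt_RankE ge eq_sym (negPf ne).
  rewrite big_split; congr (_ + _).
    rewrite exchange_big; apply: eq_bigr => i' lt; rewrite bsum_cast /bsum mulr_suml.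
    by apply: eq_bigr => j _.
  rewrite blkE; apply: eq_bigr => j _; apply: eq_bigr => j' _; congr (_ * _).
  by rewrite /bsum; apply: eq_bigr => u _; rewrite /d' cast_Rank_RankV.
rewrite blkDr blkDl.
have -> : blk b (bsum d) = blk b d'.
  by rewrite !blkE; apply: eq_bigr => i _; apply: eq_bigr => i' _; rewrite bsum_cast.
ring.
Qed.
End Pentagon.

Section RCompClosed.
Variables (K : fieldType) (Z Q : smod K) (R : comp_map Z Q Z).
Local Notation End := (End_smod R).
Variables (n : nat) (k : 'I_n -> nat).
Implicit Types (F : fam Z Z n) (g : forall i, End (k i)).

Lemma ev_homog a p (f : End p) : homog a f -> fam_homog a (ev f).
Proof. by case. Qed.

Lemma ev_homog_rank g b l (z : forall s, Z (l s)) c : (forall i, homog (b i) (g i)) ->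
    (forall s, homog (c s) (z s)) ->
  forall i, homog (b i + \sum_(j < k i) c (tagnat.Rank i j)) (ev (g i) _ (fun j => z (tagnat.Rank i j))).
Proof. by move=> hg hz i; apply: ev_homog (hg i) _ _ _ _. Qed.

(** Q passes through [F] and then through each [g i]; the signs combine by [blk_pentagon]. *)
Lemma rcomp_right F g (b : 'I_n -> int) : is_qfam R F -> (forall i, homog (b i) (g i)) ->
  fam_right_linear R (rcomp F g).
Proof.
move=> [Fl Fe Fr] hg l m z q c d hz hq; apply: lab_blocks_eq => T e.
have hzq s : homog (c s + \sum_(j < l s) d (tagnat.Rank s j))
    (ocomp R (z s) (fun j => q (tagnat.Rank s j))) by apply: comp_homog.
have hgz := ev_homog_rank hg hz.
set E := esym (sum_blocks l).
rewrite (rcomp_homog Fl hg hz).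
apply: lab_trans; first exact: (lab_ocomp_cast R E).
rewrite ocompZ.
apply: lab_trans.
  by apply: lab_scale; apply: (lab_right (fun x => e (cast_ord E x)) Fr hgz (fun x => hq (cast_ord E x))).
apply: (@lab_trans _ _ _ _ _ _ _ (sg K (blk (fun i => pz (b i)) (fun s => pz (c s))) *:
    (sg K (blk (fun i => pz (b i + \sum_(j < k i) c (tagnat.Rank i j))) (fun s => pz (d (cast_ord E s)))) *:
    F _ (fun i => sg K (blk (fun j => pz (c (tagnat.Rank i j)))
        (fun t => pz (d (cast_ord E (tagnat.Rank i t))))) *:
      ev (g i) _ (fun j => ocomp R (z (tagnat.Rank i j))
        (fun u => q (tagnat.Rank (tagnat.Rank i j) u))))))
    (join (fun i => join (fun j => join (fun u => e (tagnat.Rank (tagnat.Rank i j) u)))))).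
  do 2!apply: lab_scale; apply: lab_fam => // i.
  have [_ _ gr] := ev_qfam (g i).
  apply: lab_trans.
    exact: (lab_right (fun t => e (cast_ord E (tagnat.Rank i t))) gr (fun j => hz (tagnat.Rank i j))
      (fun t => hq (cast_ord E (tagnat.Rank i t)))).
  apply: lab_scale; apply: lab_ev => j; apply: lab_ocomp => u; apply: lab_eq_refl_idx.
  exact: cast_Rank_RankV.
rewrite (multi_scale _ _ (Fl _)) -sg_sum !scalerA -!sgD.
apply: lab_sym; apply: lab_trans; first by apply: lab_scale; apply: (lab_rcomp _ Fl hg hzq).
rewrite scalerA -sgD.
have -> : (fun s => pz (c s + \sum_(j < l s) d (tagnat.Rank s j))) =
    (fun s => pz (c s) + bsum (fun x => pz (d x)) s).
  by apply: functional_extensionality_dep => s; rewrite pzD pz_sum.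
have -> : (fun i => pz (b i + \sum_(j < k i) c (tagnat.Rank i j))) =
    (fun i => pz (b i) + bsum (fun x => pz (c x)) i).
  by apply: functional_extensionality_dep => s; rewrite pzD pz_sum.
by rewrite blk_pentagon; apply: lab_refl.
Qed.

Lemma rcomp_hom F g a (b : 'I_n -> int) : is_hom R a F -> (forall i, homog (b i) (g i)) ->
  is_hom R (a + \sum_(i < n) b i) (rcomp F g).
Proof.
move=> [Fq Fh] hg; have [Fl Fe Fr] := Fq; split; last first.
  move=> l z c hz; rewrite (rcomp_homog Fl hg hz); apply: acast_homog; apply: homogZ.
  have /Fh := ev_homog_rank hg hz.
  by rewrite big_split addrA -(@big_Rank _ _ _ _ _ xpredT c).
split; [exact: rcomp_multi | | exact: rcomp_right Fq hg].
apply: lab_cong_equivariant; first exact: rcomp_multi.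
move=> l q c l' q' T e e' hq hq' h.
apply: lab_trans; first exact: (lab_rcomp e Fl hg hq).
apply: lab_sym; apply: lab_trans; first exact: (lab_rcomp e' Fl hg hq').
apply: lab_scale; apply: lab_sym; apply: lab_fam => // i.
by apply: lab_ev.
Qed.

Lemma rcomp_inspan (f : End n) g : inspan (@is_hom K Z Q R (\sum_(i < n) k i)) (rcomp (ev f) g).
Proof.
move: g; apply: (multi_ind (V := fun i => End (k i)) (rcomp_multi_g (ev_multi f))).
- exact: inspan0.
- move=> u v hu hv; rewrite -[u]scale1r; apply: inspan_linear => //; [exact: is_hom0 | exact: is_hom_linear].
move=> g b hg; have /asboolP := span_valP f; apply: (inspan_map (rcomp_linear g)).
- exact: is_hom0.
- exact: is_hom_linear.
by move=> i F hF; apply: inspan_homog (rcomp_hom hF hg).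
Qed.
End RCompClosed.

Section SignForms.
Variable K : fieldType.

Lemma sgE_dgd n (a : int) (b : 'I_n -> int) (i : 'I_n) :
  (-1) ^+ (`|a| + \sum_(j < n | (j < i)%N) `|b j|)%N =
  sg K (pz a + \sum_(j < n | (j < i)%N) pz (b j)).
Proof.
rewrite sg_nat natrD natr_sum abszE; congr (sg K (_ + _)).
by apply: eq_bigr => j _; rewrite abszE.
Qed.

Lemma sgE_act n (s : 'S_n) (b : 'I_n -> int) :
  (-1) ^+ (\sum_(i < n) \sum_(j < n | (i < j)%N && (s j < s i)%N) `|b (s i)| * `|b (s j)|)%N =
  sg K (pinv s (fun i => pz (b i))).
Proof.
rewrite sg_nat natr_sum; congr (sg K _).
apply: eq_bigr => i _; rewrite natr_sum; apply: eq_bigr => j _.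
by rewrite natrM !abszE.
Qed.
End SignForms.

(** * Composition in the endomorphism operad *)

Section EndComp.
Variables (K : fieldType) (Z Q : smod K) (R : comp_map Z Q Z).
Local Notation End := (End_smod R).

Definition end_comp n (k : 'I_n -> nat) (f : End n) (g : forall i, End (k i)) :
  End (\sum_(i < n) k i)%N := @Span K (hom_predg R _) _ (rcomp_inspan f g).

Lemma ev_comp n (k : 'I_n -> nat) (f : End n) (g : forall i, End (k i)) :
  ev (end_comp f g) = rcomp (ev f) g.
Proof. by []. Qed.

Fact end_comp_linear_l n k (g : forall i : 'I_n, End (k i)) :
  linear (fun f : End n => end_comp f g).
Proof.
by move=> a u v; apply: ev_inj; rewrite ev_linear !ev_comp ev_linear rcomp_linear.
Qed.

Fact end_comp_linear_r n k (f : End n) (g : forall i, End (k i)) i :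
  linear (fun x : End (k i) => end_comp f (dfwith g x)).
Proof.
move=> a u v; apply: ev_inj; rewrite ev_linear !ev_comp.
exact: (rcomp_multi_g (ev_multi f)).
Qed.

Fact end_comp_homog n k (f : End n) (g : forall i, End (k i)) a (b : 'I_n -> int) :
  homog a f -> (forall i, homog (b i) (g i)) -> homog (a + \sum_(i < n) b i) (end_comp f g).
Proof. exact: rcomp_hom. Qed.

Lemma ev_leibniz n (f : End n) k (z : forall i, Z (k i)) a (b : 'I_n -> int) :
    homog a f -> (forall i, homog (b i) (z i)) ->
  dgd (ev f k z) = ev (dgd f) k z +
    \sum_(i < n) sg K (pz a + \sum_(j < n | (j < i)%N) pz (b j)) *: ev f k (dfwith z (dgd (z i))).
Proof.
by move=> hf hz; rewrite ev_dgd (dfam_homog (ev_multi f) (ev_homog hf) hz) subrK.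
Qed.

Fact end_comp_dgd n k (f : End n) (g : forall i, End (k i)) a (b : 'I_n -> int) :
  homog a f -> (forall i, homog (b i) (g i)) ->
  dgd (end_comp f g) = end_comp (dgd f) g +
    \sum_(i < n) (-1) ^+ (`|a| + \sum_(j < n | (j < i)%N) `|b j|)%N
      *: end_comp f (dfwith g (dgd (g i))).
Proof.
move=> hf hg; apply: End_eq => l z c hz.
rewrite evD (lin_sum (@ev_linear _ _ _ R _)) fam_sum ev_dgd.
have hfg : homog (a + \sum_(i < n) b i) (end_comp f g) by apply: end_comp_homog.
rewrite (dfam_homog (ev_multi _) (ev_homog hfg) hz) !ev_comp.
have Fl := ev_multi f; have hgz := ev_homog_rank hg hz.
rewrite (rcomp_homog Fl hg hz) (rcomp_homog (ev_multi (dgd f)) hg hz) -acast_dgd dgdZ.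
rewrite (ev_leibniz hf hgz) scalerDr (linD (@acast_linear _ Z _ _ _)) -addrA; congr (_ + _).
apply/eqP; rewrite subr_eq; apply/eqP.
have L := @leibniz_nested K n k (fun i => End (k i)) (fun i => Z (\sum_(j < k i) l (tagnat.Rank i j))%N)
  (fun s => Z (l s)) (Z _) (ev f _) (fun i v u => ev v _ u) (Fl _) _ g z (pz a) b c hg hz.
refine (etrans (congr1 _ (etrans _ (L _))) _).
- congr (_ *: _); apply: eq_bigr => i _; congr (sg K (_ + _) *: _).
  by apply: eq_bigr => j _; rewrite pzD pz_sum.
- by move=> i v u b' c' hv hu; apply: ev_leibniz.
rewrite (linD (@acast_linear _ Z _ _ _)) !(lin_sum (@acast_linear _ Z _ _ _)); congr (_ + _).
  apply: eq_bigr => i _; rewrite (linZ (@ev_linear _ _ _ R _)) ev_comp sgE_dgd.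
  rewrite -[RHS]/(_ *: rcomp (ev f) _ _ z).
  by rewrite (rcomp_homog Fl (homog_dfwith hg (dgd_homog (hg i))) hz) -acastZ scalerA.
apply: eq_bigr => s _.
rewrite (rcomp_homog Fl hg (homog_dfwith hz (dgd_homog (hz s)))) -acastZ scalerA.
by rewrite pzD pz_sum.
Qed.

Lemma ev_scale n a (f : End n) k z : ev (a *: f) k z = a *: ev f k z.
Proof. by rewrite (linZ (@ev_linear _ _ _ R _)). Qed.

Lemma lab_comp n (k : 'I_n -> nat) (f : End n) (g : forall i, End (k i)) (b : 'I_n -> int) l
    (z : forall s, Z (l s)) c T (e : forall s, 'I_(l s) -> T) :
    (forall i, homog (b i) (g i)) -> (forall s, homog (c s) (z s)) ->
  lab_eq (ev (end_comp f g) l z) (join e) (sg K (blk (fun i => pz (b i)) (fun s => pz (c s))) *: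
    ev f _ (fun i => ev (g i) _ (fun j => z (tagnat.Rank i j)))) (jj e).
Proof. by move=> hg hz; apply: lab_rcomp => //; apply: ev_multi. Qed.

Lemma pz_ev n (k : 'I_n -> nat) (b : 'I_n -> int) (c : 'I_(\sum_(i < n) k i) -> int) :
  (fun i => pz (b i + \sum_(j < k i) c (tagnat.Rank i j))) =
  (fun i => pz (b i) + bsum (fun x => pz (c x)) i).
Proof. by apply: functional_extensionality_dep => s; rewrite pzD pz_sum. Qed.

Fact end_comp_act_l n k (f : End n) (g : forall i, End (k i)) (b : 'I_n -> int) (s : 'S_n) :
  (forall i, homog (b i) (g i)) ->
  end_comp (sact f s) g =
    (-1) ^+ (\sum_(i < n) \sum_(j < n | (i < j)%N && (s j < s i)%N) `|b (s i)| * `|b (s j)|)%N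
    *: sact (acast (sum_perm k s) (end_comp f (fun i => g (s i)))) (block_perm k s).
Proof.
move=> hg; apply: End_lab_eq => l z c T e hz; rewrite sgE_act ev_scale.
have hgz := ev_homog_rank hg hz.
apply: lab_trans; first exact: lab_comp hg hz.
apply: lab_trans; first by apply: lab_scale; apply: (lab_sfam s _ (ev_multi f) hgz).
rewrite scalerA -sgD pz_ev blk_block -addrA sgD -scalerA; apply: lab_scale.
apply: lab_sym; apply: lab_trans; first exact: (lab_sfam _ _ (ev_multi _) hz).
rewrite sgD -scalerA; apply: lab_scale.
apply: lab_trans; first exact: lab_ev_cast.
apply: lab_trans.
  exact: (lab_comp f _ (fun i => hg (s i)) (fun x => hz (block_perm k s (cast_ord (sum_perm k s) x)))).
apply: lab_scale; apply: lab_ev => i; apply: lab_ev => j; apply: lab_eq_refl_idx.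
exact: block_permE.
Qed.

Fact end_comp_act_r n k (f : End n) (g : forall i, End (k i)) (t : forall i, 'S_(k i)) :
  end_comp f (fun i => sact (g i) (t i)) = sact (end_comp f g) (sum_perms t).
Proof.
have ml : multilinear (fun g : forall i, End (k i) => end_comp f g).
  by move=> q i; apply: end_comp_linear_r.
move: g; apply: (multi_eq (V := fun i => End (k i)) (W := End (\sum_(i < n) k i)%N)).
- exact: (multilinear_coord (V := fun i => End (k i)) (V' := fun i => End (k i)) ml
    (fun i => @sact_linear K End _ (t i))).
- exact: (multilinear_post (V := fun i => End (k i)) ml (@sact_linear K End _ _)).
move=> g b hg; apply: End_lab_eq => l z c T e hz.
have hgt i : homog (b i) (sact (g i) (t i)) by apply: sact_homog.
apply: lab_trans; first exact: (lab_comp f e hgt hz).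
apply: (@lab_trans _ _ _ _ _ _ _ (sg K (blk (fun i => pz (b i)) (fun s => pz (c s))) *:
    ev f _ (fun i => sg K (pinv (t i) (fun j => pz (c (tagnat.Rank i j)))) *:
      ev (g i) _ (fun j => z (tagnat.Rank i (t i j)))))
    (join (fun i => join (fun j => e (tagnat.Rank i (t i j)))))).
  apply: lab_scale; apply: lab_ev => i.
  exact: (lab_sfam (t i) (fun j => e (tagnat.Rank i j)) (ev_multi (g i)) (fun j => hz (tagnat.Rank i j))).
rewrite (multi_scale _ _ (@ev_multi _ _ _ R _ f _)) -sg_sum scalerA -sgD.
rewrite -(pinv_sum_perms (fun x => pz (c x)) t) addrC sgD -scalerA.
apply: lab_sym; apply: lab_trans; first exact: (lab_sfam _ _ (ev_multi _) hz).
apply: lab_scale.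
apply: lab_trans; first exact: (lab_comp f _ hg (fun x => hz (sum_perms t x))).
(* [blk] sees only the total parity of each block, which permutations inside blocks preserve. *)
have -> : blk (fun i => pz (b i)) (fun s => pz (c (sum_perms t s))) =
    blk (fun i => pz (b i)) (fun s => pz (c s)).
  rewrite !blkE; apply: eq_bigr => i _; apply: eq_bigr => i' _; congr (_ * _).
  rewrite /bsum [RHS](reindex_inj (@perm_inj _ (t i))); apply: eq_bigr => j _.
  by rewrite sum_permsE.
apply: lab_scale; apply: lab_ev => i; apply: lab_ev => j; apply: lab_eq_refl_idx.
exact: sum_permsE.
Qed.

Definition End_comp : comp_map End End End := CompMap end_comp_linear_l end_comp_linear_r
  end_comp_homog end_comp_dgd end_comp_act_l end_comp_act_r.

(** Evaluated on arguments, both sides are the threefold nested evaluation, and the signs agree by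
    [blk_pentagon]. *)
Fact End_compA : comp_assoc End_comp End_comp End_comp End_comp.
Proof.
apply/comp_assocP => n k l f g h b c hg hh; apply: End_lab_eq => m z d T e hz.
rewrite ev_scale.
have hhz := ev_homog_rank hh (fun x => hz (cast_ord (sum_blocks l) x)).
have hgh i : homog (b i + \sum_(j < k i) c (tagnat.Rank i j))
    (end_comp (g i) (fun j => h (tagnat.Rank i j))) by apply: end_comp_homog.
set E := sum_blocks l.
apply: lab_trans; first exact: lab_ev_cast.
apply: lab_trans; first exact: (lab_comp _ _ hh (fun x => hz (cast_ord E x))).
apply: lab_trans; first by apply: lab_scale; apply: (lab_comp _ _ hg hhz).
apply: lab_sym; apply: lab_trans; first by apply: lab_scale; apply: (lab_comp _ _ hgh hz).
apply: (@lab_trans _ _ _ _ _ _ _ (sg K (blk (fun i => pz (b i)) (fun s => pz (c s))) *: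
    (sg K (blk (fun i => pz (b i + \sum_(j < k i) c (tagnat.Rank i j))) (fun s => pz (d s))) *:
    ev f _ (fun i => sg K (blk (k := fun j => l (tagnat.Rank i j)) (fun j => pz (c (tagnat.Rank i j)))
        (fun t => pz (d (tagnat.Rank i t)))) *:
      ev (g i) _ (fun j => ev (h (tagnat.Rank i j)) _
        (fun u => z (cast_ord E (tagnat.Rank (tagnat.Rank i j) u)))))))
    (join (fun i => join (fun j => join (fun u => e (cast_ord E (tagnat.Rank (tagnat.Rank i j) u))))))).
  do 2!apply: lab_scale; apply: lab_ev => i.
  apply: lab_trans.
    exact: (lab_comp (g i) (fun t => e (tagnat.Rank i t)) (fun j => hh (tagnat.Rank i j))
      (fun t => hz (tagnat.Rank i t))).
  apply: lab_scale; apply: lab_ev => j; apply: lab_ev => u; apply: lab_eq_refl_idx.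
  by rewrite cast_Rank_Rank.
rewrite (multi_scale _ _ (@ev_multi _ _ _ R _ f _)) -sg_sum !scalerA -!sgD !pz_ev.
rewrite (pz_ev c (fun x => d (cast_ord E x))) blk_pentagon.
have -> : (fun t => pz (d (cast_ord E (cast_ord (esym (sum_blocks l)) t)))) = (fun t => pz (d t)).
  by apply: functional_extensionality_dep => t; rewrite cast_ordKV.
have -> : \sum_(i < n) blk (k := fun j => l (tagnat.Rank i j)) (fun j => pz (c (tagnat.Rank i j)))
    (fun t => pz (d (cast_ord E (cast_ord (esym (sum_blocks l)) (tagnat.Rank i t))))) =
  \sum_(i < n) blk (k := fun j => l (tagnat.Rank i j)) (fun j => pz (c (tagnat.Rank i j)))
    (fun t => pz (d (tagnat.Rank i t))).
  apply: eq_bigr => i _; congr blk.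
  by apply: functional_extensionality_dep => t; rewrite cast_ordKV.
exact: lab_refl.
Qed.
End EndComp.

Lemma blk_1 (k : 'I_1 -> nat) b (c : 'I_(\sum_(i < 1) k i) -> 'F_2) : blk b c = 0.
Proof. by rewrite /blk big_ord1 big1 // => i; rewrite (ord1 i). Qed.

Lemma blk_0 n (k : 'I_n -> nat) (c : 'I_(\sum_(i < n) k i) -> 'F_2) : blk (fun=> 0) c = 0.
Proof. by rewrite blkE big1 // => i _; rewrite big1 // => i' _; rewrite mulr0. Qed.

Lemma cast_Rank1 (k : 'I_1 -> nat) (E : k ord0 = (\sum_(i < 1) k i)%N) j :
  cast_ord E j = tagnat.Rank ord0 j.
Proof. by apply: val_inj; rewrite [RHS]tagnat.RankEsum [X in (X + _)%N]big_pred0. Qed.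

Lemma cast_sum_single (k : nat) (j : 'I_k) :
  cast_ord (sum_single k) (tagnat.Rank (p_ := fun=> k) ord0 j) = j.
Proof. by apply: val_inj; rewrite -[LHS]/(val (tagnat.Rank ord0 j)) [LHS]tagnat.RankEsum [X in (X + _)%N]big_pred0. Qed.

Lemma cast_sum_ones n (i : 'I_n) (j : 'I_1) :
  cast_ord (sum_ones n) (tagnat.Rank (p_ := fun=> 1%N) i j) = i.
Proof.
apply: val_inj; rewrite -[LHS]/(val (tagnat.Rank i j)) [LHS]tagnat.RankEsum (ord1 j) addn0.
by rewrite (big_ord_narrow (ltnW (ltn_ord i))) sum1_card card_ord.
Qed.

(** * The unit of the endomorphism operad and its action on Z *)

Section EndOperad.
Variables (K : fieldType) (Z Q : smod K) (R : comp_map Z Q Z).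
Local Notation End := (End_smod R).

Definition idfam : fam Z Z 1 := fun k z => acast (esym (big_ord1 addn k)) (z ord0).
Arguments idfam : clear implicits.

Lemma lab_idfam k (z : forall i : 'I_1, Z (k i)) T (e : forall i, 'I_(k i) -> T) :
  lab_eq (idfam k z) (join e) (z ord0) (e ord0).
Proof.
by apply/lab_sym/lab_cast => i; rewrite cast_Rank1 joinE.
Qed.

Lemma idfam_multi : fam_multilinear idfam.
Proof.
move=> k q i a u v; rewrite (ord1 i) in u v *.
by rewrite /idfam !dfwith_in acast_linear.
Qed.

Lemma idfam_hom : is_hom R 0 idfam.
Proof.
split; last first.
  move=> k z b hz; have -> : 0 + \sum_(i < 1) b i = b ord0 by rewrite add0r big_ord1.
  exact: acast_homog.
split; first exact: idfam_multi.
  apply: lab_cong_equivariant; first exact: idfam_multi.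
  move=> k q b k' q' T e e' hq hq' h; apply: lab_trans; first exact: lab_idfam.
  by apply: lab_trans (h ord0) _; apply/lab_sym/lab_idfam.
move=> k l z q b c hz hq; apply: lab_blocks_eq => T e; rewrite blk_1 sg0 scale1r.
apply: lab_trans; first exact: lab_ocomp_cast.
apply: lab_sym; apply: lab_trans; first exact: lab_idfam.
by apply: lab_ocomp => i; apply: lab_eq_refl_idx; rewrite cast_Rank1.
Qed.

Lemma idfam_inspan : inspan (@is_hom K Z Q R 1) idfam.
Proof. exact: inspan_homog idfam_hom. Qed.

Definition End_id : End 1%N := @Span K (hom_predg R 1) _ idfam_inspan.

Lemma ev_id : ev End_id = idfam. Proof. by []. Qed.

Fact End_id_homog : homog 0 End_id. Proof. exact: idfam_hom. Qed.

Fact End_id_cycle : is_cycle End_id.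
Proof.
apply: End_eq => k z b hz; rewrite ev_dgd ev_id.
have [[Fl _ _] Fh] := idfam_hom; rewrite (dfam_homog Fl Fh hz) [X in _ - X]big_ord1.
have -> : \sum_(j < 1 | (j < (ord0 : 'I_1))%N) pz (b j) = 0 by apply: big_pred0.
rewrite addr0 sg0 scale1r /idfam dfwith_in acast_dgd subrr.
by rewrite (lin0 (@ev_linear _ _ _ R _)).
Qed.

Fact End_mul1 n (p : End n) : plug_all (End_comp R) End_id p = p.
Proof.
apply: End_lab_eq => k z b T e hz; apply: lab_trans; first exact: lab_ev_cast.
apply: lab_trans.
  exact: (lab_comp p _ (fun=> End_id_homog) (fun i => hz (cast_ord (sum_ones n) i))).
rewrite blk_0 sg0 scale1r; apply: lab_ev => i.
apply: lab_trans; first exact: lab_idfam.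
by apply: lab_eq_refl_idx; rewrite cast_sum_ones.
Qed.

Fact End_1mul n (p : End n) : plug_into (End_comp R) End_id p = p.
Proof.
(* [lab_comp] asks for the degree of [p]; linearity reduces the claim to homogeneous [p]. *)
have h : linear (fun p : End n => plug_into (End_comp R) End_id p).
  move=> a u v; rewrite /plug_into -acast_linear; congr acast.
  have := @comp_linear_r K End End End (End_comp R) 1%N (fun=> n) End_id (fun=> u) ord0.
  move=> /(_ a u v).
  have e (x : End n) : @dfwith 'I_1 (fun=> End n) (fun=> u) ord0 x = (fun _ : 'I_1 => x).
    by apply: functional_extensionality_dep => j; rewrite (ord1 j); exact: (dfwith_in (T := fun _ : 'I_1 => End n)).
  by rewrite !e.
move: p; apply: linear_homog_eq => // a p hp.
apply: End_lab_eq => k z b T e hz; apply: lab_trans; first exact: lab_ev_cast.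
apply: lab_trans.
  exact: (lab_comp End_id _ (fun=> hp) (fun i => hz (cast_ord (sum_single n) i))).
rewrite blk_1 sg0 scale1r; apply: lab_trans; first exact: lab_idfam.
apply: lab_ev => i; apply: lab_eq_refl_idx; exact: cast_sum_single.
Qed.

Definition End_operad : operad K :=
  Operad End_id_homog End_id_cycle (@End_compA K Z Q R) End_mul1 End_1mul.

Fact lact_act_l n k (f : End n) (z : forall i, Z (k i)) (b : 'I_n -> int) (s : 'S_n) :
    (forall i, homog (b i) (z i)) ->
  ev (sact f s) k z =
    (-1) ^+ (\sum_(i < n) \sum_(j < n | (i < j)%N && (s j < s i)%N) `|b (s i)| * `|b (s j)|)%N
    *: sact (acast (sum_perm k s) (ev f _ (fun i => z (s i)))) (block_perm k s).
Proof. by move=> hz; rewrite sgE_act; apply: sfam_homog hz; apply: ev_multi. Qed.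

Fact lact_linear_l n k (z : forall i : 'I_n, Z (k i)) : linear (fun f : End n => ev f k z).
Proof. by move=> a u v; rewrite ev_linear. Qed.

Fact lact_dgd n k (f : End n) (z : forall i, Z (k i)) a (b : 'I_n -> int) :
    homog a f -> (forall i, homog (b i) (z i)) ->
  dgd (ev f k z) = ev (dgd f) k z +
    \sum_(i < n) (-1) ^+ (`|a| + \sum_(j < n | (j < i)%N) `|b j|)%N *: ev f k (dfwith z (dgd (z i))).
Proof.
move=> hf hz; rewrite (ev_leibniz hf hz); congr (_ + _); apply: eq_bigr => i _.
by rewrite sgE_dgd.
Qed.

Definition End_lact : comp_map End Z Z :=
  @CompMap K End Z Z (fun n k f z => ev f k z) lact_linear_l
    (fun n k f => @ev_multi K Z Q R n f k)
    (fun n k f z a b hf hz => ev_homog hf hz) lact_dgd lact_act_l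
    (fun n k f => @ev_equiv K Z Q R n f k).

(** Composition in End is composition of operations with its sign, so this is the value of [rcomp]
    on homogeneous elements. *)
Fact End_lactA : comp_assoc (End_comp R) End_lact End_lact End_lact.
Proof.
apply/comp_assocP => n k l f g z b c hg hz.
have := rcomp_homog (ev_multi f) hg hz => e.
by rewrite -[ocomp End_lact _ z]/(rcomp (ev f) g l z) e acastK.
Qed.

Fact End_lact1 n (z : Z n) : plug_into End_lact End_id z = z.
Proof. by rewrite /plug_into /= /idfam acast_comp acast_id. Qed.

Fact End_lract : comp_assoc End_lact R R End_lact.
Proof.
apply/comp_assocP => n k l f z q b c hz hq; have [_ _ fr] := ev_qfam f.
exact: fr.
Qed.
End EndOperad.

Definition End_bimodule (K : fieldType) (Z : smod K) (Q : operad K) (R : comp_map Z Q Z)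
    (RA : comp_assoc R R (op_mul Q) R) (R1 : forall n (z : Z n), plug_all R (op_id Q) z = z) :
    bimodule (End_operad R) Q :=
  @Bimodule K (End_operad R) Q Z (End_lact R) R (@End_lactA K Z Q R) (@End_lact1 K Z Q R)
    RA R1 (@End_lract K Z Q R).

Arguments idfam {K Z} k z.

(** * Operads of pairs *)

Lemma dfwith_map (I : eqType) (T T' : I -> Type) (f : forall i, T i -> T' i) (q : forall i, T i) i
    (x : T i) : (fun j => f j (dfwith q x j)) = dfwith (fun j => f j (q j)) (f i x).
Proof.
apply: functional_extensionality_dep => j; case: (eqVneq i j) => [<-|ne]; first by rewrite !dfwith_in.
by rewrite !dfwith_out.
Qed.

(** A suboperad of A x B. Closure under the operad structure is asked of homogeneous pairs of one
    degree, for which the signed formulas hold; [orel_linear] extends it to their span. *)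
Record op_rel (K : fieldType) (A B : operad K) := OpRel {
  orel :> forall n, A n -> B n -> Prop;
  orel0 : forall n, orel (0 : A n) (0 : B n);
  orel_linear : forall n a (x x' : A n) (y y' : B n),
    orel x y -> orel x' y' -> orel (a *: x + x') (a *: y + y');
  orel_dgd : forall n i (x : A n) (y : B n),
    homog i x -> homog i y -> orel x y -> orel (dgd x) (dgd y);
  orel_sact : forall n i (x : A n) (y : B n) (s : 'S_n),
    homog i x -> homog i y -> orel x y -> orel (sact x s) (sact y s);
  orel_comp : forall n (k : 'I_n -> nat) a b (x : A n) (y : B n)
      (f : forall i, A (k i)) (g : forall i, B (k i)),
    homog a x -> homog a y -> orel x y ->
    (forall i, homog (b i) (f i)) -> (forall i, homog (b i) (g i)) -> (forall i, orel (f i) (g i)) ->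
    orel (ocomp (op_mul A) x f) (ocomp (op_mul B) y g);
  orel_id : orel (op_id A) (op_id B)
}.

Section Pull.
Variables (K : fieldType) (A B : operad K) (S : op_rel A B).

Definition pull_homog n (i : int) (v : A n * B n) :=
  [/\ homog i v.1, homog i v.2 & S n v.1 v.2].

Definition pull_d n (v : A n * B n) := (dgd v.1, dgd v.2).

Fact pull_homog0 n i : @pull_homog n i 0.
Proof. by split; [exact: homog0 | exact: homog0 | exact: orel0]. Qed.

Fact pull_homog_linear n i (a : K) u v :
  @pull_homog n i u -> @pull_homog n i v -> @pull_homog n i (a *: u + v).
Proof.
by move=> [h1 h2 h3] [h1' h2' h3']; split; [exact: homog_linear | exact: homog_linear | exact: orel_linear].
Qed.

Lemma fst_lin n : linear (fst : A n * B n -> A n). Proof. by []. Qed.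
Lemma snd_lin n : linear (snd : A n * B n -> B n). Proof. by []. Qed.

Fact pull_homog_free n (s : seq int) (x : int -> A n * B n) :
  uniq s -> (forall i, pull_homog i (x i)) -> \sum_(i <- s) x i = 0 ->
  forall i, i \in s -> x i = 0.
Proof.
move=> us hx e i si; apply/eqP; rewrite -pair_eqE /pair_eq /=; apply/andP; split; apply/eqP.
  apply: (homog_free us (x := fun i => (x i).1)) si => [j|]; first by case: (hx j).
  by rewrite -(lin_sum (@fst_lin n)) e.
apply: (homog_free us (x := fun i => (x i).2)) si => [j|]; first by case: (hx j).
by rewrite -(lin_sum (@snd_lin n)) e.
Qed.

Fact pull_d_linear n : linear (@pull_d n).
Proof. by move=> a u v; rewrite /pull_d !dgd_linear. Qed.

Fact pull_d_homog n i v : @pull_homog n i v -> @pull_homog n (i - 1) (pull_d v).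
Proof.
by move=> [h1 h2 h3]; split; [exact: dgd_homog | exact: dgd_homog | exact: orel_dgd h1 h2 h3].
Qed.

Fact pull_dK n i v : @pull_homog n i v -> pull_d (pull_d v) = 0.
Proof. by move=> _; rewrite /pull_d !dgdK. Qed.

Definition pull_predg n : predg K := PreDg (@pull_homog0 n) (@pull_homog_linear n)
  (@pull_homog_free n) (@pull_d_linear n) (@pull_d_homog n) (@pull_dK n).

Definition pull_dg n : dgvect K := span_dg (pull_predg n).

Definition pull1 n (x : pull_dg n) : A n := (span_val x : A n * B n).1.
Definition pull2 n (x : pull_dg n) : B n := (span_val x : A n * B n).2.

Lemma pull_eq n (x y : pull_dg n) : pull1 x = pull1 y -> pull2 x = pull2 y -> x = y.
Proof.
by move=> e1 e2; apply: span_val_inj; move: e1 e2; rewrite /pull1 /pull2; case: (span_val x) (span_val y) => ? ? [? ?] /= -> ->.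
Qed.

Lemma pull1_morph n : is_dg_morph (@pull1 n).
Proof. by split; [move=> a u v; rewrite /pull1 span_val_linear | move=> i v [] | ]. Qed.
Lemma pull2_morph n : is_dg_morph (@pull2 n).
Proof. by split; [move=> a u v; rewrite /pull2 span_val_linear | move=> i v [] | ]. Qed.
Lemma pull1_linear n : linear (@pull1 n). Proof. exact: dg_morph_linear (@pull1_morph n). Qed.
Lemma pull2_linear n : linear (@pull2 n). Proof. exact: dg_morph_linear (@pull2_morph n). Qed.

Lemma pull_rel n (x : pull_dg n) : S n (pull1 x) (pull2 x).
Proof.
rewrite /pull1 /pull2; have /asboolP := span_valP x; elim=> [|i u v [_ _ hu] _ hv]; first exact: orel0.
by have := orel_linear 1 hu hv; rewrite !scale1r.
Qed.

Lemma Pull_subproof n i (x : A n) (y : B n) : homog i x -> homog i y -> S n x y ->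
  inspan (@pre_homog K (pull_predg n)) (x, y).
Proof.
move=> hx hy h; have h' : @pre_homog K (pull_predg n) i (x, y) by [].
exact: inspan_homog h'.
Qed.

Lemma Pull_ex n i (x : A n) (y : B n) : homog i x -> homog i y -> S n x y ->
  exists z : pull_dg n, [/\ homog i z, pull1 z = x & pull2 z = y].
Proof. by move=> hx hy h; exists (Span (Pull_subproof hx hy h)). Qed.

Fact pull_sact_inspan n (s : 'S_n) (x : pull_dg n) :
  inspan (@pre_homog K (pull_predg n)) (sact (pull1 x) s, sact (pull2 x) s).
Proof.
have /asboolP := span_valP x; rewrite /pull1 /pull2.
apply: (inspan_map (V := (A n * B n)%type) (f := fun v => (sact v.1 s, sact v.2 s))).
- by move=> a u v; rewrite /= !sact_linear.
- exact: pull_homog0.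
- exact: pull_homog_linear.
move=> i v [h1 h2 h3]; apply: (@Pull_subproof _ i).
- exact: sact_homog.
- exact: sact_homog.
exact: orel_sact h1 h2 h3.
Qed.

Definition pull_sact n (x : pull_dg n) (s : 'S_n) : pull_dg n := Span (pull_sact_inspan s x).

Fact pull_sact_morph n (s : 'S_n) : is_dg_morph (fun x => pull_sact x s).
Proof.
split=> [a u v|i v [h1 h2 h3]|v].
- by apply: pull_eq; rewrite ?pull1_linear ?pull2_linear -[LHS]/(sact _ s) ?pull1_linear ?pull2_linear sact_linear.
- by split; [exact: sact_homog | exact: sact_homog | exact: orel_sact h1 h2 h3].
by apply: pull_eq; rewrite -[LHS]/(sact (dgd _) s) sact_dgd.
Qed.

Fact pull_sact1 n (x : pull_dg n) : pull_sact x 1%g = x.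
Proof. by apply: pull_eq; rewrite -[LHS]/(sact _ 1%g) sact1. Qed.

Fact pull_sactM n (x : pull_dg n) (s t : 'S_n) : pull_sact x (s * t)%g = pull_sact (pull_sact x s) t.
Proof. by apply: pull_eq; rewrite -[LHS]/(sact _ (s * t)%g) sactM. Qed.

Definition pull_smod : smod K := SMod pull_sact_morph pull_sact1 pull_sactM.

Lemma pull1_smod : @is_smod_morph K pull_smod A pull1.
Proof. by split=> // n; apply: pull1_morph. Qed.
Lemma pull2_smod : @is_smod_morph K pull_smod B pull2.
Proof. by split=> // n; apply: pull2_morph. Qed.

Fact pull_comp_inspan n (k : 'I_n -> nat) (x : pull_smod n) (f : forall i, pull_smod (k i)) :
  inspan (@pre_homog K (pull_predg (\sum_(i < n) k i)))
    (ocomp (op_mul A) (pull1 x) (fun i => pull1 (f i)), ocomp (op_mul B) (pull2 x) (fun i => pull2 (f i))).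
Proof.
move: f; apply: (multi_ind (V := fun i => pull_smod (k i)) (W := (A _ * B _)%type)
  (F := fun f => (ocomp (op_mul A) (pull1 x) (fun i => pull1 (f i)),
    ocomp (op_mul B) (pull2 x) (fun i => pull2 (f i))))).
- move=> q i a u v; rewrite !(dfwith_map (fun i => @pull1 (k i))) !(dfwith_map (fun i => @pull2 (k i))).
  by rewrite pull1_linear pull2_linear !comp_linear_r.
- exact: inspan0.
- move=> u v hu hv; rewrite -[u]scale1r; apply: inspan_linear => //.
  + exact: pull_homog0.
  + exact: pull_homog_linear.
move=> f b hf; have /asboolP := span_valP x; rewrite /pull1 /pull2.
apply: (inspan_map (V := (A n * B n)%type) (f := fun v => (ocomp (op_mul A) v.1 (fun i => pull1 (f i)),
    ocomp (op_mul B) v.2 (fun i => pull2 (f i))))).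
- by move=> a u v; rewrite /= !comp_linear_l.
- exact: pull_homog0.
- exact: pull_homog_linear.
move=> i v [h1 h2 h3].
have hl j : homog (b j) (pull1 (f j)) by case: (hf j).
have hr j : homog (b j) (pull2 (f j)) by case: (hf j).
apply: (@Pull_subproof _ (i + \sum_(j < n) b j)).
- exact: comp_homog.
- exact: comp_homog.
by apply: (orel_comp h1 h2 h3 hl hr) => j; apply: pull_rel.
Qed.

Definition pull_comp n (k : 'I_n -> nat) (x : pull_smod n) (f : forall i, pull_smod (k i)) :
  pull_smod (\sum_(i < n) k i)%N := Span (pull_comp_inspan x f).

Lemma pull1_comp n (k : 'I_n -> nat) (x : pull_smod n) (f : forall i, pull_smod (k i)) :
  pull1 (pull_comp x f) = ocomp (op_mul A) (pull1 x) (fun i => pull1 (f i)).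
Proof. by []. Qed.
Lemma pull2_comp n (k : 'I_n -> nat) (x : pull_smod n) (f : forall i, pull_smod (k i)) :
  pull2 (pull_comp x f) = ocomp (op_mul B) (pull2 x) (fun i => pull2 (f i)).
Proof. by []. Qed.

Lemma pull1_sact n (x : pull_smod n) s : pull1 (sact x s) = sact (pull1 x) s. Proof. by []. Qed.
Lemma pull2_sact n (x : pull_smod n) s : pull2 (sact x s) = sact (pull2 x) s. Proof. by []. Qed.
Lemma pull1_acast m n (e : m = n) (x : pull_smod m) : pull1 (acast e x) = acast e (pull1 x : A m).
Proof. exact: (acast_fun (A := pull_smod) (B := A) pull1). Qed.
Lemma pull2_acast m n (e : m = n) (x : pull_smod m) : pull2 (acast e x) = acast e (pull2 x : B m).
Proof. exact: (acast_fun (A := pull_smod) (B := B) pull2). Qed.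
Lemma pull1_homog i n (x : pull_smod n) : homog i x -> homog i (pull1 x). Proof. by case. Qed.
Lemma pull2_homog i n (x : pull_smod n) : homog i x -> homog i (pull2 x). Proof. by case. Qed.

Fact pull_comp_linear_l n k (q : forall i : 'I_n, pull_smod (k i)) :
  linear (fun p : pull_smod n => pull_comp p q).
Proof.
by move=> a u v; apply: pull_eq; rewrite ?pull1_linear ?pull2_linear ?pull1_comp ?pull2_comp
  ?pull1_linear ?pull2_linear comp_linear_l.
Qed.

Fact pull_comp_linear_r n k (p : pull_smod n) (q : forall i, pull_smod (k i)) i :
  linear (fun x : pull_smod (k i) => pull_comp p (dfwith q x)).
Proof.
move=> a u v; apply: pull_eq; rewrite ?pull1_linear ?pull2_linear ?pull1_comp ?pull2_comp.
  by rewrite !(dfwith_map (fun i => @pull1 (k i))) pull1_linear comp_linear_r.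
by rewrite !(dfwith_map (fun i => @pull2 (k i))) pull2_linear comp_linear_r.
Qed.

Fact pull_comp_homog n k (p : pull_smod n) (q : forall i, pull_smod (k i)) a (b : 'I_n -> int) :
  homog a p -> (forall i, homog (b i) (q i)) -> homog (a + \sum_(i < n) b i) (pull_comp p q).
Proof.
move=> [h1 h2 h3] hq; have hl j : homog (b j) (pull1 (q j)) by case: (hq j).
have hr j : homog (b j) (pull2 (q j)) by case: (hq j).
split; [exact: comp_homog | exact: comp_homog | exact: (pull_rel (pull_comp p q))].
Qed.

Fact pull_comp_dgd n k (p : pull_smod n) (q : forall i, pull_smod (k i)) a (b : 'I_n -> int) :
  homog a p -> (forall i, homog (b i) (q i)) ->
  dgd (pull_comp p q) = pull_comp (dgd p) q +
    \sum_(i < n) (-1) ^+ (`|a| + \sum_(j < n | (j < i)%N) `|b j|)%N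
      *: pull_comp p (dfwith q (dgd (q i))).
Proof.
move=> hp hq; apply: pull_eq.
  rewrite (linD (@pull1_linear _)) (lin_sum (@pull1_linear _)).
  rewrite -[LHS]/(dgd (pull1 (pull_comp p q))) !pull1_comp.
  rewrite (comp_dgd _ (pull1_homog hp) (fun i => pull1_homog (hq i))); congr (_ + _).
  apply: eq_bigr => i _; rewrite (linZ (@pull1_linear _)) pull1_comp.
  by rewrite (dfwith_map (fun i => @pull1 (k i))).
rewrite (linD (@pull2_linear _)) (lin_sum (@pull2_linear _)).
rewrite -[LHS]/(dgd (pull2 (pull_comp p q))) !pull2_comp.
rewrite (comp_dgd _ (pull2_homog hp) (fun i => pull2_homog (hq i))); congr (_ + _).
apply: eq_bigr => i _; rewrite (linZ (@pull2_linear _)) pull2_comp.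
by rewrite (dfwith_map (fun i => @pull2 (k i))).
Qed.

Fact pull_comp_act_l n k (p : pull_smod n) (q : forall i, pull_smod (k i)) (b : 'I_n -> int) (s : 'S_n) :
  (forall i, homog (b i) (q i)) ->
  pull_comp (sact p s) q =
    (-1) ^+ (\sum_(i < n) \sum_(j < n | (i < j)%N && (s j < s i)%N) `|b (s i)| * `|b (s j)|)%N
    *: sact (acast (sum_perm k s) (pull_comp p (fun i => q (s i)))) (block_perm k s).
Proof.
move=> hq; apply: pull_eq.
  rewrite (linZ (@pull1_linear _)) pull1_sact pull1_acast !pull1_comp pull1_sact.
  exact: comp_act_l (fun i => pull1_homog (hq i)).
rewrite (linZ (@pull2_linear _)) pull2_sact pull2_acast !pull2_comp pull2_sact.
exact: comp_act_l (fun i => pull2_homog (hq i)).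
Qed.

Fact pull_comp_act_r n k (p : pull_smod n) (q : forall i, pull_smod (k i)) (t : forall i, 'S_(k i)) :
  pull_comp p (fun i => sact (q i) (t i)) = sact (pull_comp p q) (sum_perms t).
Proof.
by apply: pull_eq; rewrite ?pull1_sact ?pull2_sact ?pull1_comp ?pull2_comp -comp_act_r.
Qed.

Definition pull_mul : comp_map pull_smod pull_smod pull_smod :=
  CompMap pull_comp_linear_l pull_comp_linear_r pull_comp_homog pull_comp_dgd
    pull_comp_act_l pull_comp_act_r.

Definition pull_id : pull_smod 1%N :=
  Span (Pull_subproof (op_id_homog A) (op_id_homog B) (orel_id S)).

Fact pull_id_homog : homog 0 pull_id.
Proof. by split; [exact: op_id_homog | exact: op_id_homog | exact: orel_id]. Qed.

Fact pull_id_cycle : is_cycle pull_id.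
Proof. by apply: pull_eq; [exact: op_id_cycle | exact: op_id_cycle]. Qed.

Fact pull_mulA : comp_assoc pull_mul pull_mul pull_mul pull_mul.
Proof.
move=> n k l p q r b c hq hr; apply: pull_eq.
  rewrite (linZ (@pull1_linear _)) pull1_acast.
  exact: (@op_mulA K A n k l (pull1 p) (fun i => pull1 (q i)) (fun s => pull1 (r s)) b c
    (fun i => pull1_homog (hq i)) (fun i => pull1_homog (hr i))).
rewrite (linZ (@pull2_linear _)) pull2_acast.
exact: (@op_mulA K B n k l (pull2 p) (fun i => pull2 (q i)) (fun s => pull2 (r s)) b c
    (fun i => pull2_homog (hq i)) (fun i => pull2_homog (hr i))).
Qed.

Fact pull_mul1 n (p : pull_smod n) : plug_all pull_mul pull_id p = p.
Proof.
by apply: pull_eq; rewrite /plug_all ?pull1_acast ?pull2_acast; apply: op_mul1.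
Qed.

Fact pull_1mul n (p : pull_smod n) : plug_into pull_mul pull_id p = p.
Proof.
by apply: pull_eq; rewrite /plug_into ?pull1_acast ?pull2_acast; apply: op_1mul.
Qed.

Definition pull_operad : operad K := Operad pull_id_homog pull_id_cycle pull_mulA pull_mul1 pull_1mul.
End Pull.

Record is_operad_morph (K : fieldType) (P P' : operad K) (f : forall n, P n -> P' n) : Prop :=
  IsOperadMorph {
    operad_morph_smod : is_smod_morph f;
    operad_morph_mul : comp_compatible (op_mul P) (op_mul P') f f f;
    operad_morph_id : f 1%N (op_id P) = op_id P'
  }.

Lemma pull1_operad (K : fieldType) (A B : operad K) (S : op_rel A B) :
  @is_operad_morph K (pull_operad S) A (@pull1 K A B S).
Proof. by split=> //; apply: pull1_smod. Qed.
Lemma pull2_operad (K : fieldType) (A B : operad K) (S : op_rel A B) :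
  @is_operad_morph K (pull_operad S) B (@pull2 K A B S).
Proof. by split=> //; apply: pull2_smod. Qed.

(** * Restriction of the left action along a morphism of operads *)

Section Restrict.
Variables (K : fieldType) (P P' Q : operad K) (M : bimodule P Q) (f : forall n, P' n -> P n).
Hypothesis fm : is_operad_morph f.

Let fs := operad_morph_smod fm.
Let fd n := smod_morph_dg fs n.

Fact res_linear_l n k (q : forall i : 'I_n, M (k i)) :
  linear (fun p : P' n => ocomp (lact M) (f p) q).
Proof. by move=> a u v; rewrite (dg_morph_linear (fd n)) comp_linear_l. Qed.

Fact res_homog n k (p : P' n) (q : forall i, M (k i)) a (b : 'I_n -> int) :
  homog a p -> (forall i, homog (b i) (q i)) -> homog (a + \sum_(i < n) b i) (ocomp (lact M) (f p) q).
Proof. by move=> /(dg_morph_homog (fd n)); apply: comp_homog. Qed.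

Fact res_dgd n k (p : P' n) (q : forall i, M (k i)) a (b : 'I_n -> int) :
  homog a p -> (forall i, homog (b i) (q i)) ->
  dgd (ocomp (lact M) (f p) q) = ocomp (lact M) (f (dgd p)) q +
    \sum_(i < n) (-1) ^+ (`|a| + \sum_(j < n | (j < i)%N) `|b j|)%N
      *: ocomp (lact M) (f p) (dfwith q (dgd (q i))).
Proof. by move=> /(dg_morph_homog (fd n)); rewrite (dg_morph_dgd (fd n)); apply: comp_dgd. Qed.

Fact res_act_l n k (p : P' n) (q : forall i, M (k i)) (b : 'I_n -> int) (s : 'S_n) :
  (forall i, homog (b i) (q i)) ->
  ocomp (lact M) (f (sact p s)) q =
    (-1) ^+ (\sum_(i < n) \sum_(j < n | (i < j)%N && (s j < s i)%N) `|b (s i)| * `|b (s j)|)%N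
    *: sact (acast (sum_perm k s) (ocomp (lact M) (f p) (fun i => q (s i)))) (block_perm k s).
Proof. by move=> hq; rewrite (smod_morph_act fs) (comp_act_l _ _ _ hq). Qed.

Definition res_lact : comp_map P' M M :=
  @CompMap K P' M M (fun n k p q => ocomp (lact M) (f p) q) res_linear_l
    (fun n k p => @comp_linear_r K P M M (lact M) n k (f p)) res_homog res_dgd res_act_l
    (fun n k p => @comp_act_r K P M M (lact M) n k (f p)).

Fact res_lactA : comp_assoc (op_mul P') res_lact res_lact res_lact.
Proof.
move=> n k l p q r b c hq hr.
rewrite -[ocomp res_lact _ r]/(ocomp (lact M) (f (ocomp (op_mul P') p q)) r) (operad_morph_mul fm).
exact: (@lactA K P Q M n k l (f p) (fun i => f (q i)) r b c
  (fun i => dg_morph_homog (fd _) (hq i)) hr).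
Qed.

Fact res_lact1 n (m : M n) : plug_into res_lact (op_id P') m = m.
Proof. by rewrite /plug_into /= (operad_morph_id fm); apply: lact1. Qed.

Fact res_lract : comp_assoc res_lact (ract M) (ract M) res_lact.
Proof. by move=> n k l p q r b c hq hr; apply: (@lract K P Q M n k l (f p) q r b c). Qed.

Definition restrict : bimodule P' Q := Bimodule res_lactA res_lact1 (@ractA _ _ _ M) (@ract1 _ _ _ M) res_lract.
End Restrict.

(** * Strict torsors *)

Section LabMore.
Variables (K : fieldType) (T : Type).

Lemma join_Rank n (k : 'I_n -> nat) (e : 'I_(\sum_(i < n) k i) -> T) :
  join (fun i (j : 'I_(k i)) => e (tagnat.Rank i j)) = e.
Proof. by apply: functional_extensionality_dep; apply: RankP => i j; rewrite joinE. Qed.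

Lemma lab_plug_all (A B C : smod K) (c : comp_map A B C) (m : B 1%N) n (x : A n) (e : 'I_n -> T) :
  lab_eq (plug_all c m x) e (ocomp c x (fun=> m)) (join (fun i (_ : 'I_1) => e i)).
Proof.
apply/lab_sym/lab_cast; apply: RankP => i j.
by rewrite joinE cast_sum_ones.
Qed.

Lemma lab_plug_into (A B C : smod K) (c : comp_map A B C) (m : A 1%N) n (x : B n) (e : 'I_n -> T) :
  lab_eq (plug_into c m x) e (ocomp c m (fun=> x)) (join (fun _ : 'I_1 => e)).
Proof.
apply/lab_sym/lab_cast; apply: RankP => i j.
by rewrite joinE; move: j; rewrite (ord1 i) => j; rewrite cast_sum_single.
Qed.

Lemma lab_assoc (A B C D E F : smod K) (AB : comp_map A B D) (DC : comp_map D C E)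
    (BC : comp_map B C F) (AF : comp_map A F E) n (k : 'I_n -> nat)
    (l : 'I_(\sum_(i < n) k i) -> nat) (p : A n) (q : forall i, B (k i)) (r : forall s, C (l s))
    b c (e : forall s, 'I_(l s) -> T) :
    comp_assoc AB DC BC AF -> (forall i, homog (b i) (q i)) -> (forall s, homog (c s) (r s)) ->
  lab_eq (ocomp DC (ocomp AB p q) r) (join e)
    (sg K (blk (fun i => pz (b i)) (fun s => pz (c s))) *:
      ocomp AF p (fun i => ocomp BC (q i) (fun j => r (tagnat.Rank i j)))) (jj e).
Proof. by move=> /comp_assocP h hq hr; apply: lab_blocks; apply: h. Qed.
End LabMore.

Section Torsor.
Variables (K : fieldType) (P Q : operad K) (M : bimodule P Q) (one : M 1%N).
Hypotheses (one_homog : homog 0 one) (one_cycle : is_cycle one).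

Definition tleft n (p : P n) : M n := plug_all (lact M) one p.
Definition tright n (q : Q n) : M n := plug_into (ract M) one q.

Lemma const1 (I : Type) (q : I) (i : 'I_1) (x : I) :
  @dfwith 'I_1 (fun=> I) (fun=> q) i x = (fun=> x).
Proof.
apply: functional_extensionality_dep => j; rewrite (ord1 i) (ord1 j).
exact: (dfwith_in (T := fun _ : 'I_1 => I)).
Qed.

Lemma tleft_linear n : linear (@tleft n).
Proof. by move=> a u v; rewrite /tleft /plug_all comp_linear_l acast_linear. Qed.

Lemma tright_linear n : linear (@tright n).
Proof.
move=> a u v; rewrite /tright /plug_into -acast_linear; congr acast.
have := @comp_linear_r K M Q M (ract M) 1%N (fun=> n) one (fun=> u) ord0 a u v.
by rewrite !const1.
Qed.

Lemma tleft_smod : is_smod_morph tleft.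
Proof.
split=> n; last first.
  move=> p s; apply: (@lab_inj _ _ _ _ _ id) => //.
  apply: lab_trans; first exact: lab_plug_all.
  apply: lab_trans; first by apply: (@lab_ocomp_act _ _ _ _ _ _ _ _ _ _ (fun=> one) (fun=> 0)).
  rewrite [pinv _ _](_ : _ = 0) ?sg0 ?scale1r; last first.
    by rewrite /pinv big1 // => i _; rewrite big1 // => j _; rewrite mul0r.
  apply: lab_trans; first exact: (lab_sym (lab_plug_all _ _ _ (fun i => s i))).
  exact: lab_sact.
have hd a (p : P n) : homog a p -> tleft (dgd p) = dgd (tleft p).
  move=> hp; rewrite /tleft /plug_all -acast_dgd; congr acast.
  rewrite (ocomp_dgd (lact M) (q := fun=> one) hp (fun=> one_homog)) [X in _ = _ + X]big1 ?addr0 // => i _.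
  rewrite (multi0 (V := fun=> M 1%N) (i := i) (@ocomp_multilinear _ _ _ _ (lact M) _ _ p)) ?scaler0 //.
  by rewrite dfwith_in.
split; first exact: tleft_linear.
  move=> a p hp; apply: acast_homog; rewrite -[a]addr0 -[X in a + X](_ : \sum_(i < n) 0 = 0).
    by apply: (comp_homog (lact M) (q := fun=> one) (b := fun=> 0) hp).
  by rewrite big1.
apply: linear_homog_eq => [a u v|a u v|a p]; last exact: hd.
- by rewrite dgd_linear tleft_linear.
- by rewrite tleft_linear dgd_linear.
Qed.

Lemma tright_smod : is_smod_morph tright.
Proof.
split=> n; last first.
  move=> q s; apply: (@lab_inj _ _ _ _ _ id) => //.
  apply: lab_trans; first exact: lab_plug_into.
  apply: (@lab_trans _ _ _ _ _ _ _ (ocomp (ract M) one (fun=> q)) (join (fun _ : 'I_1 => (s : 'I_n -> 'I_n)))).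
    by apply: lab_ocomp => _; apply/lab_sym/lab_sact.
  apply: lab_trans; first exact: (lab_sym (lab_plug_into _ _ _ (fun i => s i))).
  exact: lab_sact.
have hd a (q : Q n) : homog a q -> tright (dgd q) = dgd (tright q).
  move=> hq; rewrite /tright /plug_into -acast_dgd; congr acast.
  have := ocomp_dgd (ract M) (q := fun=> q) (b := fun=> a) one_homog (fun=> hq).
  rewrite one_cycle ocomp0 add0r => ->.
  have -> (G : 'I_1 -> M (\sum_(i < 1) n)%N) : \sum_(i < 1) G i = G ord0 by rewrite [LHS]big_ord1.
  have -> : \sum_(j < 1 | (j < (ord0 : 'I_1))%N) pz a = 0 by apply: big_pred0.
  by rewrite addr0 sg0 scale1r const1.
split; first exact: tright_linear.
  move=> a q hq; apply: acast_homog; rewrite -[a](_ : 0 + \sum_(i < 1) a = a).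
    exact: (comp_homog (ract M) (q := fun=> q) (b := fun=> a) one_homog).
  by rewrite add0r big_ord1.
apply: linear_homog_eq => [a u v|a u v|a q]; last exact: hd.
- by rewrite dgd_linear tright_linear.
- by rewrite tright_linear dgd_linear.
Qed.

(** Associativity of the left action; no sign remains since [one] has degree 0. *)
Lemma tleft_comp n (k : 'I_n -> nat) (p : P n) (f : forall i, P (k i)) :
  tleft (ocomp (op_mul P) p f) = ocomp (lact M) p (fun i => tleft (f i)).
Proof.
move: f; apply: (multi_eq (V := fun i => P (k i)) (W := M (\sum_(i < n) k i)%N)).
- exact: (multilinear_post (V := fun i => P (k i))
    (@ocomp_multilinear _ _ _ _ (op_mul P) n k p) (@tleft_linear _)).
- exact: (multilinear_coord (V := fun i => P (k i)) (V' := fun i => M (k i))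
    (@ocomp_multilinear _ _ _ _ (lact M) n k p) (fun i => @tleft_linear (k i))).
move=> f b hf; apply: (@lab_inj _ _ _ _ _ id) => //.
apply: lab_trans; first exact: lab_plug_all.
apply: lab_trans; first exact: (lab_assoc _ _ (@lactA K P Q M) hf (fun=> one_homog)).
rewrite [blk _ _](_ : _ = 0); last first.
  by rewrite /blk big1 // => i _; rewrite big1 // => i' _; rewrite big1 // => j _; rewrite mul0r.
rewrite sg0 scale1r -[X in lab_eq _ _ _ X](join_Rank (k := k)).
by apply: lab_ocomp => i; apply/lab_sym/lab_plug_all.
Qed.

Lemma tright_comp n (k : 'I_n -> nat) (q : Q n) (g : forall i, Q (k i)) :
  tright (ocomp (op_mul Q) q g) = ocomp (ract M) (tright q) g.
Proof.
move: q; apply: linear_homog_eq.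
- by move=> a u v; rewrite comp_linear_l tright_linear.
- by move=> a u v; rewrite tright_linear comp_linear_l.
move=> a q hq; move: g; apply: (multi_eq (V := fun i => Q (k i)) (W := M (\sum_(i < n) k i)%N)).
- exact: (multilinear_post (V := fun i => Q (k i))
    (@ocomp_multilinear _ _ _ _ (op_mul Q) n k q) (@tright_linear _)).
- exact: (@ocomp_multilinear _ _ _ _ (ract M) n k (tright q)).
move=> g b hg; apply: (@lab_inj _ _ _ _ _ id) => //.
apply: lab_sym; rewrite -[X in lab_eq _ X _ _](join_Rank (k := k)).
apply: lab_trans; first exact: lab_ocomp_cast.
apply: lab_trans.
  exact: (lab_assoc _ _ (@ractA K P Q M) (fun=> hq) (fun i => hg (cast_ord (sum_single n) i))).
rewrite blk_1 sg0 scale1r; apply: lab_sym; apply: lab_trans; first exact: lab_plug_into.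
apply: lab_ocomp => i; rewrite -[X in lab_eq _ X _ _](join_Rank (k := k)).
apply: lab_ocomp => j; apply: (@lab_eq_refl_idx _ Q _ _ k g (fun i j => tagnat.Rank i j)).
by rewrite (ord1 i); rewrite cast_sum_single.
Qed.

(** The two actions commute, whence (p o 1) o q = p o (1 o q). This is what closes [torsor_rel]
    under composition. *)
Lemma tleft_ract n (k : 'I_n -> nat) (p : P n) (g : forall i, Q (k i)) :
  ocomp (ract M) (tleft p) g = ocomp (lact M) p (fun i => tright (g i)).
Proof.
move: g; apply: (multi_eq (V := fun i => Q (k i)) (W := M (\sum_(i < n) k i)%N)).
- exact: (@ocomp_multilinear _ _ _ _ (ract M) n k (tleft p)).
- exact: (multilinear_coord (V := fun i => Q (k i)) (V' := fun i => M (k i))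
    (@ocomp_multilinear _ _ _ _ (lact M) n k p) (fun i => @tright_linear (k i))).
move=> g b hg; apply: (@lab_inj _ _ _ _ _ id) => //.
rewrite -[X in lab_eq _ X _ _](join_Rank (k := k)).
apply: lab_trans; first exact: lab_ocomp_cast.
apply: lab_trans.
  exact: (lab_assoc _ _ (@lract K P Q M) (fun=> one_homog) (fun i => hg (cast_ord (sum_ones n) i))).
rewrite blk_0 sg0 scale1r -[X in lab_eq _ _ _ X](join_Rank (k := k)).
apply: lab_ocomp => i; apply: lab_sym; apply: lab_trans; first exact: lab_plug_into.
apply: lab_ocomp => j; apply: (@lab_eq_refl_idx _ Q _ _ k g (fun i j => tagnat.Rank i j)).
by rewrite cast_sum_ones.
Qed.

Lemma tleft_id : tleft (op_id P) = one.
Proof. by rewrite -[RHS](lact1 one) /tleft /plug_all /plug_into (acast_irr _ (sum_single 1)). Qed.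

Lemma tright_id : tright (op_id Q) = one.
Proof. by rewrite -[RHS](ract1 one) /tright /plug_all /plug_into (acast_irr _ (sum_ones 1)). Qed.

Definition torsor_rel n (p : P n) (q : Q n) := tleft p = tright q.

Definition torsor_op_rel : op_rel P Q.
Proof.
apply: (@OpRel K P Q torsor_rel); rewrite /torsor_rel.
- by move=> n; rewrite (lin0 (@tleft_linear _)) (lin0 (@tright_linear _)).
- by move=> n a x x' y y' e e'; rewrite tleft_linear tright_linear e e'.
- move=> n i x y _ _ e.
  rewrite (dg_morph_dgd (smod_morph_dg tleft_smod n)) e.
  by rewrite -(dg_morph_dgd (smod_morph_dg tright_smod n)).
- by move=> n i x y s _ _ e; rewrite (smod_morph_act tleft_smod) e -(smod_morph_act tright_smod).
(* With x o 1 = 1 o y and f o 1 = 1 o g: 1 o (y g) = (1 o y) g = (x o 1) g = x (1 o g) = x (f o 1) =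
   (x f) o 1. *)
- move=> n k a b x y f g _ _ e _ _ e'; rewrite tleft_comp tright_comp -e tleft_ract; congr ocomp.
  by apply: functional_extensionality_dep => i; apply: e'.
by rewrite tleft_id tright_id.
(* Transparent, so that the relation behind [E] unfolds to [torsor_rel]. *)
Defined.

Local Notation E := (pull_operad torsor_op_rel).

Theorem strict_torsor_zigzag : is_smod_qiso tleft -> is_smod_qiso tright ->
  (forall n i (m : M n), homog i m -> exists2 p : P n, homog i p & tleft p = m) ->
  zigzag (Triple M) (Triple (operad_bimodule Q)).
Proof.
move=> lq rq ls; have lh n : is_hqiso (@tleft n) by apply/hqisoP; case: lq.
have rh n : is_hqiso (@tright n) by apply/hqisoP; case: rq.
have er n (x : E n) : tleft (pull1 x) = tright (pull2 x) by exact: (@pull_rel _ _ _ torsor_op_rel n x).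
(* The kernel of [pull2] consists of the pairs (p, 0) with p o 1 = 0; it is the kernel of the
   surjective quasi-isomorphism [tleft], hence acyclic. *)
have prq n : is_hqiso (@pull2 _ _ _ torsor_op_rel n).
  apply: surj_hqiso; first exact: pull2_morph.
    move=> i q hq; have [p hp e] := ls _ _ _ (dg_morph_homog (smod_morph_dg tright_smod n) hq).
    by have [z [hz _ ez]] := @Pull_ex _ _ _ torsor_op_rel n i p q hp hq e; exists z.
  move=> i x hx x0 xr0; have hp := pull1_homog hx.
  have p0 : is_cycle (pull1 x) by rewrite /is_cycle -(dg_morph_dgd (@pull1_morph _ _ _ _ n)) x0 (lin0 (@pull1_linear _ _ _ _ n)).
  have [|u [hu u0 eu]] := @hqiso_kernel _ _ _ _ (lh n) (@ls n) i (pull1 x) hp p0.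
    by rewrite er xr0 (lin0 (@tright_linear _)).
  have [|z [hz zl zr]] := @Pull_ex _ _ _ torsor_op_rel n (i + 1) u 0 hu (homog0 _ _).
    by rewrite /= /torsor_rel u0 (lin0 (@tright_linear _)).
  exists z; split=> //; apply: pull_eq.
    by rewrite (dg_morph_dgd (@pull1_morph _ _ _ _ n)) zl.
  by rewrite (dg_morph_dgd (@pull2_morph _ _ _ _ n)) zr xr0 dgd0.
have mq n : is_hqiso (fun x : E n => tleft (pull1 x)).
  have -> : (fun x : E n => tleft (pull1 x)) = (fun x : E n => tright (pull2 x)).
    by apply: functional_extensionality_dep => x; apply: er.
  exact: (hqiso_comp (@pull2_morph _ _ _ _ n) (smod_morph_dg tright_smod n) (prq n) (rh n)).
(* Two out of three: [tleft] after [pull1] equals [tright] after [pull2]. *)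
have plq n : is_hqiso (@pull1 _ _ _ torsor_op_rel n).
  exact: (hqiso_cancel_l (@pull1_morph _ _ _ _ n) (smod_morph_dg tleft_smod n) (lh n) (mq n)).
have prO : @is_operad_qiso K E Q (@pull2 _ _ _ torsor_op_rel).
  have [h1 h2 h3] := pull2_operad torsor_op_rel.
  by split=> //; split=> // n; apply/hqisoP/prq.
have plO : @is_operad_qiso K E P (@pull1 _ _ _ torsor_op_rel).
  have [h1 h2 h3] := pull1_operad torsor_op_rel.
  by split=> //; split=> // n; apply/hqisoP/plq.
apply: (@rst_trans _ _ _ (Triple (operad_bimodule E))).
  apply: rst_sym; apply: rst_step.
  (* The middle map respects the left action in the form [tleft] after [pull1], and the right action
     in the form [tright] after [pull2]. *)
  exists (@pull1 _ _ _ torsor_op_rel), (fun n x => tleft (pull1 x)), (@pull2 _ _ _ torsor_op_rel).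
  split=> //=.
  - split; last by move=> n; apply/hqisoP/mq.
    split=> [n|n x s]; first exact: is_dg_morph_comp (@pull1_morph _ _ _ _ n) (smod_morph_dg tleft_smod n).
    by rewrite pull1_sact (smod_morph_act tleft_smod).
  - by move=> n k p q; rewrite /= -tleft_comp.
  - move=> n k p q; rewrite !er -tright_comp.
    by rewrite -pull2_comp.
apply: rst_step; exists (@pull2 _ _ _ torsor_op_rel), (@pull2 _ _ _ torsor_op_rel), (@pull2 _ _ _ torsor_op_rel).
by split=> //=; case: prO.
Qed.
End Torsor.

(** * The cone extension *)

Section Cone.
Variables (K : fieldType) (P Q : operad K) (M : bimodule P Q).

Section ConeDg.
Variable n : nat.
Definition cone_type := (Q n * M n * M n)%type.
Implicit Types z : cone_type.

(** The last factor is a shifted copy of M and a subcomplex with differential [- dgd]; the middle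
    factor belongs to the quotient, so that z |-> [z.1.2] is a chain map. *)
Definition cone_homog (i : int) z := [/\ homog i z.1.1, homog i z.1.2 & homog (i + 1) z.2].
Definition cone_d z : cone_type := (dgd z.1.1, dgd z.1.2, z.1.2 - dgd z.2).

Lemma cone_eq z z' : z.1.1 = z'.1.1 -> z.1.2 = z'.1.2 -> z.2 = z'.2 -> z = z'.
Proof. by case: z z' => [[? ?] ?] [[? ?] ?] /= -> -> ->. Qed.

Lemma cone1_lin : linear (fun z : cone_type => z.1.1). Proof. by []. Qed.
Lemma cone2_lin : linear (fun z : cone_type => z.1.2). Proof. by []. Qed.
Lemma cone3_lin : linear (fun z : cone_type => z.2). Proof. by []. Qed.

Fact cone_homog0 i : cone_homog i 0.
Proof. by split; apply: homog0. Qed.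

Fact cone_homog_linear i (a : K) z z' : cone_homog i z -> cone_homog i z' -> cone_homog i (a *: z + z').
Proof. by move=> [h1 h2 h3] [h1' h2' h3']; split; apply: homog_linear. Qed.

Fact cone_homog_span z : exists (s : seq int) (x : int -> cone_type),
  (forall i, cone_homog i (x i)) /\ z = \sum_(i <- s) x i.
Proof.
suff /(inspan_dec cone_homog0 cone_homog_linear) [s [x [us hx _ e]]] : inspan cone_homog z.
  by exists s, x.
have h1 : inspan cone_homog ((z.1.1, 0, 0) : cone_type).
  apply: (inspan_map (V := Q n) (W := cone_type) (f := fun q => (q, 0, 0)) _ _ _ _ (dg_inspan z.1.1)).
  - by move=> a u v; apply: cone_eq; rewrite //= scaler0 addr0.
  - exact: cone_homog0.
  - exact: cone_homog_linear.
  move=> i q hq; apply: (@inspan_homog _ _ _ i).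
  by split=> //; apply: homog0.
have h2 : inspan cone_homog ((0, z.1.2, 0) : cone_type).
  apply: (inspan_map (V := M n) (W := cone_type) (f := fun m => (0, m, 0)) _ _ _ _ (dg_inspan z.1.2)).
  - by move=> a u v; apply: cone_eq; rewrite //= scaler0 addr0.
  - exact: cone_homog0.
  - exact: cone_homog_linear.
  move=> i m hm; apply: (@inspan_homog _ _ _ i).
  by split=> //; apply: homog0.
have h3 : inspan cone_homog ((0, 0, z.2) : cone_type).
  apply: (inspan_map (V := M n) (W := cone_type) (f := fun m => (0, 0, m)) _ _ _ _ (dg_inspan z.2)).
  - by move=> a u v; apply: cone_eq; rewrite //= scaler0 addr0.
  - exact: cone_homog0.
  - exact: cone_homog_linear.
  move=> i m hm; apply: (@inspan_homog _ _ _ (i - 1)).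
  by split; rewrite /= ?subrK //; apply: homog0.
have := inspan_linear cone_homog0 cone_homog_linear 1 h1
  (inspan_linear cone_homog0 cone_homog_linear 1 h2 h3).
by congr inspan; apply: cone_eq; rewrite /= !scale1r ?addr0 ?add0r.
Qed.

Fact cone_homog_free (s : seq int) (x : int -> cone_type) :
  uniq s -> (forall i, cone_homog i (x i)) -> \sum_(i <- s) x i = 0 ->
  forall i, i \in s -> x i = 0.
Proof.
move=> us hx e i si; apply: cone_eq.
- apply: (homog_free us (x := fun i => (x i).1.1)) si => [j|]; first by case: (hx j).
  by rewrite -(lin_sum cone1_lin) e.
- apply: (homog_free us (x := fun i => (x i).1.2)) si => [j|]; first by case: (hx j).
  by rewrite -(lin_sum cone2_lin) e.
have h := @homog_free K (M n) [seq j + 1 | j <- s] (fun j => (x (j - 1)).2).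
rewrite (map_inj_uniq (addIr 1)) in h.
have := h us _ _ (i + 1); rewrite addrK => -> //.
- by move=> j; have [_ _] := hx (j - 1); rewrite subrK.
- rewrite big_map -[RHS](lin0 cone3_lin) -e (lin_sum cone3_lin).
  by apply: eq_bigr => j _; rewrite addrK.
- by rewrite (mem_map (addIr 1)).
Qed.

Fact cone_d_linear : linear cone_d.
Proof.
move=> a u v; apply: cone_eq; rewrite /= ?dgd_linear //.
by rewrite opprD addrACA scalerBr.
Qed.

Fact cone_d_homog i z : cone_homog i z -> cone_homog (i - 1) (cone_d z).
Proof.
move=> [h1 h2 h3]; split; [exact: dgd_homog | exact: dgd_homog |].
by rewrite subrK; apply: homogB => //; rewrite -[i](addrK 1); apply: dgd_homog.
Qed.

Fact cone_dK z : cone_d (cone_d z) = 0.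
Proof. by apply: cone_eq; rewrite /= ?dgdK // dgdB dgdK subr0 subrr. Qed.

Definition cone_dg : dgvect K := DgVect cone_homog0 cone_homog_linear cone_homog_span
  cone_homog_free cone_d_linear cone_d_homog cone_dK.

Definition cone_sact (z : cone_dg) (s : 'S_n) : cone_dg := (sact z.1.1 s, sact z.1.2 s, sact z.2 s).

Fact cone_sact_morph s : is_dg_morph (fun z : cone_dg => cone_sact z s).
Proof.
split=> [a u v|i v [h1 h2 h3]|v].
- by apply: cone_eq; rewrite /= sact_linear.
- by split; apply: sact_homog.
by apply: cone_eq; rewrite /= ?sact_dgd // (linB (@sact_linear K M _ _)) sact_dgd.
Qed.
Fact cone_sact1 z : cone_sact z 1%g = z.
Proof. by apply: cone_eq; rewrite /= sact1. Qed.
Fact cone_sactM z s t : cone_sact z (s * t)%g = cone_sact (cone_sact z s) t.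
Proof. by apply: cone_eq; rewrite /= sactM. Qed.
End ConeDg.

(* Q (+) Cone(id_M), an extension of Q by a contractible right Q-module which
   surjects onto M through a map that is split as a map of graded right
   Q-modules. *)
Definition cone : smod K := SMod cone_sact_morph cone_sact1 cone_sactM.

Lemma cone1_smod : @is_smod_morph K cone Q (fun n z => z.1.1).
Proof. by split=> // n; split=> // i v []. Qed.

Lemma acast1 m n (e : m = n) (z : cone m) : (acast e z).1.1 = acast e (z.1.1 : Q m).
Proof. by case: n / e. Qed.
Lemma acast2 m n (e : m = n) (z : cone m) : (acast e z).1.2 = acast e (z.1.2 : M m).
Proof. by case: n / e. Qed.
Lemma acast3 m n (e : m = n) (z : cone m) : (acast e z).2 = acast e (z.2 : M m).
Proof. by case: n / e. Qed.

(** There is no sign in the shifted factor: elements of Q act from the right and never cross the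
    shift. *)
Definition cone_comp n (k : 'I_n -> nat) (z : cone n) (q : forall i, Q (k i)) :
  cone (\sum_(i < n) k i)%N :=
  (ocomp (op_mul Q) z.1.1 q, ocomp (ract M) z.1.2 q, ocomp (ract M) z.2 q).

Fact cone_comp_linear_l n k (q : forall i : 'I_n, Q (k i)) :
  linear (fun z : cone n => cone_comp z q).
Proof. by move=> a u v; apply: cone_eq; rewrite /= comp_linear_l. Qed.

Fact cone_comp_linear_r n k (z : cone n) (q : forall i, Q (k i)) i :
  linear (fun x : Q (k i) => cone_comp z (dfwith q x)).
Proof. by move=> a u v; apply: cone_eq; rewrite /= comp_linear_r. Qed.

Fact cone_comp_homog n k (z : cone n) (q : forall i, Q (k i)) a (b : 'I_n -> int) :
  homog a z -> (forall i, homog (b i) (q i)) -> homog (a + \sum_(i < n) b i) (cone_comp z q).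
Proof.
by move=> [h1 h2 h3] hq; split; rewrite /= 1?addrAC; apply: comp_homog.
Qed.

Fact cone_comp_dgd n k (z : cone n) (q : forall i, Q (k i)) a (b : 'I_n -> int) :
  homog a z -> (forall i, homog (b i) (q i)) ->
  dgd (cone_comp z q) = cone_comp (dgd z) q +
    \sum_(i < n) (-1) ^+ (`|a| + \sum_(j < n | (j < i)%N) `|b j|)%N
      *: cone_comp z (dfwith q (dgd (q i))).
Proof.
move=> [h1 h2 h3] hq; apply: cone_eq.
- rewrite (linD (@cone1_lin _)) (lin_sum (@cone1_lin _)); exact: comp_dgd h1 hq.
- rewrite (linD (@cone2_lin _)) (lin_sum (@cone2_lin _)); exact: comp_dgd h2 hq.
rewrite (linD (@cone3_lin _)) (lin_sum (@cone3_lin _)) /= (ocomp_dgd _ h3 hq).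
rewrite ocompB opprD addrA; congr (_ + _); rewrite -sumrN; apply: eq_bigr => i _.
(* The extra 1 in the degree of the last factor is offset by the sign of its differential. *)
rewrite -scaleNr pzD1; congr (_ *: _).
by rewrite sg_nat natrD natr_sum abszE addrAC sgD sg1 mulrN1 opprK; congr (sg K (_ + _));
  apply: eq_bigr => j _; rewrite abszE.
Qed.

Fact cone_comp_act_l n k (z : cone n) (q : forall i, Q (k i)) (b : 'I_n -> int) (s : 'S_n) :
  (forall i, homog (b i) (q i)) ->
  cone_comp (sact z s) q =
    (-1) ^+ (\sum_(i < n) \sum_(j < n | (i < j)%N && (s j < s i)%N) `|b (s i)| * `|b (s j)|)%N
    *: sact (acast (sum_perm k s) (cone_comp z (fun i => q (s i)))) (block_perm k s).
Proof.
move=> hq; apply: cone_eq => /=; rewrite ?acast1 ?acast2 ?acast3; exact: comp_act_l hq.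
Qed.

Fact cone_comp_act_r n k (z : cone n) (q : forall i, Q (k i)) (t : forall i, 'S_(k i)) :
  cone_comp z (fun i => sact (q i) (t i)) = sact (cone_comp z q) (sum_perms t).
Proof. by apply: cone_eq; rewrite /= comp_act_r. Qed.

Definition cone_ract : comp_map cone Q cone := CompMap cone_comp_linear_l cone_comp_linear_r
  cone_comp_homog cone_comp_dgd cone_comp_act_l cone_comp_act_r.

Fact cone_ractA : comp_assoc cone_ract cone_ract (op_mul Q) cone_ract.
Proof.
move=> n k l p q r b c hq hr; apply: cone_eq => /=; rewrite ?acast1 ?acast2 ?acast3.
- exact: (@op_mulA K Q n k l _ q r b c).
- exact: (@ractA K P Q M n k l _ q r b c).
- exact: (@ractA K P Q M n k l _ q r b c).
Qed.

Fact cone_ract1 n (z : cone n) : plug_all cone_ract (op_id Q) z = z.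
Proof.
apply: cone_eq; rewrite /plug_all ?acast1 ?acast2 ?acast3.
- exact: op_mul1.
- exact: (ract1 (z.1.2 : M n)).
- exact: (ract1 (z.2 : M n)).
Qed.

Definition cone_bimodule := End_bimodule cone_ractA cone_ract1.

Definition cin n (q : Q n) : cone n := (q, 0, 0).
Definition cout n (z : cone n) : Q n := z.1.1.
(** The contraction of the cone, of degree 1 because the last factor is shifted. It is right linear
    and so defines an operation of arity one in the endomorphism operad. *)
Definition chom n (z : cone n) : cone n := (0, z.2, 0).
(** A section of [cproj] as a map of graded right modules only: [dgd (csec m)] has last component
    [m]. *)
Definition csec n (m : M n) : cone n := (0, m, 0).

Lemma cin_smod : is_smod_morph cin.
Proof.
split=> [n|n q s]; last first.
  by apply: cone_eq; rewrite //= (lin0 (@sact_linear K M _ _)).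
split=> [a u v|i q hq|q].
- by apply: cone_eq; rewrite //= scaler0 addr0.
- by split=> //; apply: homog0.
by apply: cone_eq; rewrite //= dgd0 // subrr.
Qed.

Lemma cout_smod : is_smod_morph cout. Proof. exact: cone1_smod. Qed.

Lemma chomK n (z : cone n) : dgd (chom z) + chom (dgd z) = z - cin (cout z).
Proof.
apply: cone_eq; rewrite /= ?dgd0 ?subrr ?subr0 ?addr0 //.
by rewrite addrC subrK.
Qed.

Variable one : M 1%N.
Hypotheses (one_homog : homog 0 one) (one_cycle : is_cycle one).

Definition cproj n (z : cone n) : M n := tright one z.1.1 + z.1.2.

Lemma cproj_smod : is_smod_morph cproj.
Proof.
have [rm ra] := tright_smod one_homog one_cycle.
split=> [n|n z s]; last by rewrite /cproj /= ra sactD.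
have [rl rh rd] := rm n; split=> [a u v|i z [h1 h2 h3]|z]; rewrite /cproj /=.
- by rewrite rl scalerDr addrACA.
- by apply: homogD => //; apply: rh.
by rewrite rd dgdD.
Qed.

Lemma csecK n (m : M n) : cproj (csec m) = m.
Proof. by rewrite /cproj (lin0 (@tright_linear _ _ _ M one n)) add0r. Qed.

Lemma cproj_cin n (q : Q n) : cproj (cin q) = tright one q.
Proof. exact: addr0. Qed.

Lemma cproj_comp n (k : 'I_n -> nat) (z : cone n) (q : forall i, Q (k i)) :
  cproj (ocomp cone_ract z q) = ocomp (ract M) (cproj z) q.
Proof. by rewrite /cproj /= tright_comp ocompD. Qed.

Definition cone_one : cone 1%N := cin (op_id Q).

Lemma cone_one_homog : homog 0 cone_one.
Proof. exact: dg_morph_homog (smod_morph_dg cin_smod 1) _ _ (op_id_homog Q). Qed.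

Lemma cone_one_cycle : is_cycle cone_one.
Proof.
rewrite /is_cycle /cone_one; have [_ _ <-] := smod_morph_dg cin_smod 1.
by rewrite op_id_cycle (lin0 (dg_morph_linear (smod_morph_dg cin_smod 1))).
Qed.

Lemma cproj_one : cproj cone_one = one.
Proof. by rewrite cproj_cin tright_id. Qed.

Lemma cone_tright n (q : Q n) : @tright K _ _ cone_bimodule cone_one n q = cin q.
Proof.
apply: cone_eq; rewrite /tright /plug_into /= ?acast1 ?acast2 ?acast3 /=.
- exact: op_1mul.
- by rewrite ocomp0 (lin0 (@acast_linear K M _ _ _)).
- by rewrite ocomp0 (lin0 (@acast_linear K M _ _ _)).
Qed.

Lemma cin_hqiso n : is_hqiso (@cin n).
Proof.
have im := smod_morph_dg cin_smod n; split=> // [i q z hq q0 hz e|i z hz z0].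
  exists (cout z); first by case: hz.
  by rewrite -[q]/(cout (cin q)) e.
have [h1 h2 h3] := hz.
(* For a cycle [z], [chomK] makes [z - cin (cout z)] the boundary of [chom z]. *)
exists (cout z), (- chom z); split=> //.
- by rewrite /is_cycle -[RHS](lin0 (@cone1_lin n)) -z0.
- by apply: homogN; split=> //; apply: homog0.
rewrite dgdN -[RHS]addr0 -[0 in RHS](_ : - chom (dgd z) = 0) -?opprD ?chomK ?opprB //.
by rewrite z0; apply: cone_eq; rewrite //= oppr0.
Qed.
End Cone.

(** * Homotopies in an operad *)

Section Homotopy.
Variables (K : fieldType) (O : operad K) (rho h : O 1%N).
Hypotheses (rho_homog : homog 0 rho) (h_homog : homog 1 h) (h_dgd : dgd h = op_id O - rho).

Definition plug_fam n (f : O n) (x : 'I_n -> O 1%N) : O n := acast (sum_ones n) (ocomp (op_mul O) f x).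

(** The summands of the usual homotopy from the identity to [rho] on a tensor power: [h] in one
    place, [rho] before it and the identity after it. *)
Definition htpy_step m n (j : 'I_n) : O 1%N :=
  if (j < m)%N then rho else if (j == m :> nat) then h else op_id O.

(** The prefactor cancels the sign with which [dgd] crosses [f]. *)
Definition homotopy a n (f : O n) : O n := sg K (pz a) *: \sum_(i < n) plug_fam f (htpy_step i (n := n)).

Lemma htpy_step_homog n (i j : 'I_n) : homog (if j == i then 1 else 0) (htpy_step i j).
Proof.
rewrite /htpy_step; case: eqVneq => [->|ne]; first by rewrite ltnn eqxx.
by rewrite (inj_eq val_inj) (negPf ne); case: ifP => // _; apply: op_id_homog.
Qed.

Lemma homog_homotopy a n (f : O n) : homog a f -> homog (a + 1) (homotopy a f).
Proof.
move=> hf; apply: homogZ; apply: homog_sum => i _; apply: acast_homog.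
rewrite -[1](_ : \sum_(j < n) (if j == i then 1 else 0) = 1).
  by apply: comp_homog => // j; apply: htpy_step_homog.
by rewrite (bigD1 i) //= eqxx big1 ?addr0 // => j /negPf->.
Qed.

(* The identity is replaced by rho one input at a time. *)
Lemma homotopy_dgd a n (f : O n) : homog a f -> is_cycle f ->
  dgd (homotopy a f) = f - plug_all (op_mul O) rho f.
Proof.
move=> hf f0.
have rho0 : dgd rho = 0.
  have : dgd (dgd h) = 0 by apply: dgdK.
  by rewrite h_dgd dgdB op_id_cycle sub0r => /eqP; rewrite oppr_eq0 => /eqP.
(* [r m] has [rho] in its first [m] inputs. Up to the sign of [f], the summand [i] has boundary
   [r i - r i.+1], and the sum telescopes. *)
pose r m : O n := plug_fam f (fun j => if (j < m)%N then rho else op_id O).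
have rn : r n = plug_all (op_mul O) rho f.
  rewrite /r /plug_fam (_ : (fun j : 'I_n => _) = (fun=> rho)) //.
  by apply: functional_extensionality_dep => j; rewrite ltn_ord.
have r0 : r 0%N = f by rewrite -[RHS](op_mul1 f).
have e (i : 'I_n) : dgd (plug_fam f (htpy_step i (n := n))) = sg K (pz a) *: (r i - r i.+1) :> O n.
  rewrite /plug_fam -acast_dgd (ocomp_dgd (op_mul O) hf (@htpy_step_homog n i)) f0 ocomp0 add0r.
  rewrite [X in acast _ X](bigD1 i) //= [X in acast _ (_ + X)]big1 ?addr0; last first.
    move=> j ne; rewrite [ocomp _ _ _](_ : _ = 0) ?scaler0 //.
    apply: (multi0 (V := fun=> O 1%N) (i := j) (@ocomp_multilinear _ _ _ _ (op_mul O) _ _ f)).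
    rewrite dfwith_in /htpy_step; case: ifP => // _; rewrite (inj_eq val_inj) (negPf ne).
    exact: op_id_cycle.
  have -> : \sum_(j < n | (j < i)%N) pz (if j == i then 1 else 0) = 0.
    by rewrite big1 // => j lt; case: eqP lt => // ->; rewrite ltnn.
  rewrite addr0 acastZ; congr (_ *: _).
  have -> : dgd (htpy_step i i) = op_id O - rho by rewrite /htpy_step ltnn eqxx.
  rewrite (linB (@comp_linear_r _ _ _ _ (op_mul O) n (fun=> 1%N) f (htpy_step i (n := n)) i)).
  have -> : @dfwith 'I_n (fun=> O 1%N) (htpy_step i (n := n)) i (op_id O) =
      (fun j : 'I_n => if (j < i)%N then rho else op_id O).
    apply: functional_extensionality_dep => j; case: (eqVneq i j) => [<-|ne].
      by rewrite (dfwith_in (T := fun=> O 1%N)) ltnn.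
    have ne' : (j == i :> nat) = false by apply/negP => /eqP/val_inj ji; rewrite ji eqxx in ne.
    by rewrite (dfwith_out (T := fun=> O 1%N)) // /htpy_step ne'.
  have -> : @dfwith 'I_n (fun=> O 1%N) (htpy_step i (n := n)) i rho =
      (fun j : 'I_n => if (j < i.+1)%N then rho else op_id O).
    apply: functional_extensionality_dep => j; case: (eqVneq i j) => [<-|ne].
      by rewrite (dfwith_in (T := fun=> O 1%N)) ltnSn.
    have ne' : (j == i :> nat) = false by apply/negP => /eqP/val_inj ji; rewrite ji eqxx in ne.
    by rewrite (dfwith_out (T := fun=> O 1%N)) // /htpy_step ltnS [(j <= i)%N]leq_eqVlt ne'.
  exact: (linB (@acast_linear _ O _ _ _)).
rewrite -rn -{2}r0 /homotopy dgdZ dgd_sum.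
have -> : \sum_(i < n) dgd (plug_fam f (htpy_step i (n := n))) = \sum_(i < n) sg K (pz a) *: (r i - r i.+1).
  by apply: eq_bigr => i _; apply: e.
rewrite -scaler_sumr scalerA sg_sq scale1r -[RHS]opprB -(telescope_sumr _ (leq0n n)) -sumrN big_mkord.
by apply: eq_bigr => i _; rewrite opprB.
Qed.
End Homotopy.

(** Maps of graded right modules, of degree [d]. Commutation with the differentials is left out
    because [csec] and [chom] fail it. *)
Record is_graded (K : fieldType) (A B Q : smod K) (RA : comp_map A Q A) (RB : comp_map B Q B)
    (d : int) (f : forall n, A n -> B n) : Prop := IsGraded {
  graded_linear : forall n, linear (@f n);
  graded_homog : forall n i (x : A n), homog i x -> homog (d + i) (f n x);
  graded_act : forall n (x : A n) s, f n (sact x s) = sact (f n x) s;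
  graded_right : forall n k (x : A n) (q : forall i : 'I_n, Q (k i)),
    f _ (ocomp RA x q) = ocomp RB (f n x) q
}.

(** * Elements of the endomorphism operad built from graded maps *)

Section Transport.
Variables (K : fieldType) (Z Q A B C : smod K) (R : comp_map Z Q Z).
Variables (c : comp_map A B C) (RB : comp_map B Q B) (RC : comp_map C Q C).
Hypothesis cA : comp_assoc c RC RB c.
Variables (g : forall n, Z n -> B n) (t : forall n, C n -> Z n).
Hypotheses (gg : is_graded R RB 0 g) (tg : is_graded RC R 0 t).

(** [x] is composed with graded maps out of and into Z. This yields both the lift of an operation of
    P and the section of the evaluation at 1. *)
Definition tfam n (x : A n) : fam Z Z n := fun k z => t (ocomp c x (fun i => g (z i))).
Arguments tfam {n} x k z.

Lemma tfam_hom a n (x : A n) : homog a x -> is_hom R a (tfam x).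
Proof.
have [gl gh ga gr] := gg; have [tl th ta tr] := tg => hx; split; last first.
  move=> k z b hz; rewrite -[a + _]add0r; apply: th; apply: comp_homog => // i.
  by rewrite -[b i]add0r; apply: gh.
split.
- move=> k; have h := multilinear_coord (V := fun i => Z (k i)) (@ocomp_multilinear _ _ _ _ c n k x)
    (fun i => gl (k i)).
  exact: (multilinear_post (V := fun i => Z (k i)) h (tl _)).
- move=> k z s; rewrite /tfam -ta -comp_act_r; congr (t (ocomp c x _)).
  by apply: functional_extensionality_dep => i; apply: ga.
move=> k l z q b d hz hq; have hg i : homog (b i) (g (z i)) by rewrite -[b i]add0r; apply: gh.
rewrite /tfam -tr -(acast_fun t).
rewrite (iffLR (comp_assocP _ _ _ _) cA _ _ _ _ _ _ _ _ hg hq).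
rewrite (linZ (tl _)); congr (_ *: t (ocomp c x _)).
by apply: functional_extensionality_dep => i; rewrite gr.
Qed.

Lemma tfam_linear n : linear (fun x : A n => tfam x).
Proof.
have [tl th ta tr] := tg; move=> a u v; apply: famP => k z.
by rewrite fam_linE /tfam comp_linear_l tl.
Qed.

Lemma tfam_inspan n (x : A n) : inspan (@is_hom K Z Q R n) (tfam x).
Proof.
apply: (inspan_map (@tfam_linear n)) (dg_inspan x).
- exact: is_hom0.
- exact: is_hom_linear.
by move=> i v /tfam_hom/inspan_homog.
Qed.

Definition transport n (x : A n) : End_smod R n := @Span K (hom_predg R n) _ (tfam_inspan x).

Lemma ev_transport n (x : A n) k (z : forall i, Z (k i)) :
  ev (transport x) k z = t (ocomp c x (fun i => g (z i))).
Proof. by []. Qed.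

Lemma transport_homog n a (x : A n) : homog a x -> homog a (transport x).
Proof. exact: tfam_hom. Qed.
End Transport.

Section UFam.
Variables (K : fieldType) (Z Q : smod K) (R : comp_map Z Q Z) (d : int) (u : forall n, Z n -> Z n).
Hypothesis ug : is_graded R R d u.

Definition ufam : fam Z Z 1 := fun k z => idfam k (fun i => u (z i)).
Arguments ufam : clear implicits.

Lemma ufam_hom : is_hom R d ufam.
Proof.
have [ul uh ua ur] := ug; have [[il ie ir] ih] := idfam_hom R; split; last first.
  move=> k z b hz; have -> : d + \sum_(i < 1) b i = d + b ord0 by rewrite big_ord1.
  by apply: acast_homog; apply: uh.
split.
- move=> k; exact: (multilinear_coord (V := fun i => Z (k i)) (il k) (fun i => ul (k i))).
- move=> k z s; rewrite /ufam -ie; congr (idfam k _).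
  by apply: functional_extensionality_dep => i; apply: ua.
move=> k l z q b c hz hq; rewrite /ufam (ir _ _ _ _ _ _ (fun i => uh _ _ _ (hz i)) hq) !blk_1.
congr (_ *: idfam _ _); by apply: functional_extensionality_dep => i; rewrite ur.
Qed.

Definition End_of : End_smod R 1%N := @Span K (hom_predg R 1) _ (inspan_homog ufam_hom).

Lemma End_of_homog : homog d End_of. Proof. exact: ufam_hom. Qed.

Lemma lab_End_of k (z : forall i : 'I_1, Z (k i)) T (e : forall i, 'I_(k i) -> T) :
  lab_eq (ev End_of k z) (join e) (u (z ord0)) (e ord0).
Proof. exact: (@lab_idfam _ Z k (fun i => u (z i)) T e). Qed.

Lemma ev_End_of_dgd k (z : forall i : 'I_1, Z (k i)) (b : 'I_1 -> int) :
    (forall i, homog (b i) (z i)) ->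
  ev (dgd End_of) k z = idfam k (fun i => dgd (u (z i)) - sg K (pz d) *: u (dgd (z i))).
Proof.
move=> hz; have [[Fl _ _] Fh] := ufam_hom.
rewrite ev_dgd (dfam_homog Fl Fh hz) [X in _ - X]big_ord1.
have -> : \sum_(j < 1 | (j < (ord0 : 'I_1))%N) pz (b j) = 0 by apply: big_pred0.
rewrite addr0 /ufam /idfam -acast_dgd.
by rewrite dfwith_in -acastZ (linB (@acast_linear _ Z _ _ _)).
Qed.
End UFam.

(** * The zig-zag *)

Section ConeTorsor.
Variables (K : fieldType) (P Q : operad K) (M : bimodule P Q) (one : M 1%N).
Hypotheses (one_homog : homog 0 one) (one_cycle : is_cycle one).

Local Notation Z := (cone M).
Local Notation R := (cone_ract M).
Local Notation EndZ := (End_operad R).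
Local Notation CB := (cone_bimodule M).
Local Notation cone_one := (cone_one M).
Local Notation cproj := (@cproj K P Q M one).
Local Notation ztleft := (@tleft K EndZ Q CB cone_one).

Lemma cin_linear n : linear (@cin K P Q M n).
Proof. exact: dg_morph_linear (smod_morph_dg (cin_smod M) n). Qed.
Lemma cout_linear n : linear (@cout K P Q M n).
Proof. exact: dg_morph_linear (smod_morph_dg (cout_smod M) n). Qed.
Lemma cproj_linear n : linear (@cproj n).
Proof. exact: dg_morph_linear (smod_morph_dg (cproj_smod one_homog one_cycle) n). Qed.

Lemma cin_comp n (k : 'I_n -> nat) (q : Q n) (q' : forall i, Q (k i)) :
  cin M (ocomp (op_mul Q) q q') = ocomp R (cin M q) q'.
Proof. by apply: cone_eq; rewrite //= ocomp0. Qed.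

Lemma id_graded : is_graded R R 0 (fun n (z : Z n) => z).
Proof. by split=> // n i x; rewrite add0r. Qed.

Lemma cout_graded : is_graded R (op_mul Q) 0 (@cout K P Q M).
Proof. by split=> // n i x []; rewrite add0r. Qed.

Lemma cinout_graded : is_graded R R 0 (fun n (z : Z n) => cin M (cout z)).
Proof.
split=> [n a u v|n i z [h1 _ _]|n z s|n k z q].
- by rewrite cout_linear cin_linear.
- by rewrite add0r; split=> //; apply: homog0.
- by rewrite -(smod_morph_act (cin_smod M)).
by rewrite -cin_comp.
Qed.

Lemma chom_graded : is_graded R R 1 (@chom K P Q M).
Proof.
split=> [n a u v|n i z [_ _ h]|n z s|n k z q].
- by apply: cone_eq; rewrite //= scaler0 addr0.
- by rewrite addrC; split=> //; apply: homog0.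
- by apply: cone_eq; rewrite //= (lin0 (@sact_linear K _ _ _)).
by apply: cone_eq; rewrite //= ocomp0.
Qed.

Lemma csec_graded : is_graded (ract M) R 0 (@csec K P Q M).
Proof.
split=> [n a u v|n i z h|n z s|n k z q].
- by apply: cone_eq; rewrite //= scaler0 addr0.
- by rewrite add0r; split=> //; apply: homog0.
- by apply: cone_eq; rewrite //= (lin0 (@sact_linear K _ _ _)).
by apply: cone_eq; rewrite //= ocomp0.
Qed.

Lemma cproj_graded : is_graded R (ract M) 0 cproj.
Proof.
have [pm pa] := cproj_smod one_homog one_cycle; split=> [n|n i z hz|n z s|n k z q].
- exact: cproj_linear.
- by rewrite add0r; apply: (dg_morph_homog (pm n)).
- exact: pa.
exact: cproj_comp.
Qed.

Definition cone_retr : EndZ 1%N := End_of cinout_graded.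
Definition cone_htpy : EndZ 1%N := End_of chom_graded.

Lemma cone_retr_homog : homog 0 cone_retr. Proof. exact: End_of_homog. Qed.
Lemma cone_htpy_homog : homog 1 cone_htpy. Proof. exact: End_of_homog. Qed.

Lemma cone_htpy_dgd : dgd cone_htpy = op_id EndZ - cone_retr.
Proof.
apply: End_eq => k z b hz; rewrite (ev_End_of_dgd _ hz) (linB (@ev_linear _ _ _ R 1)).
rewrite -[RHS]/(idfam k z - idfam k (fun i => cin M (cout (z i)))) /idfam.
by rewrite sg1 scaleN1r opprK chomK (linB (@acast_linear _ Z _ _ _)).
Qed.

(** The operation with value [w] at (1, .., 1), extended to Q by right linearity and composed with
    the projections Z -> Q. *)
Definition zsec n (w : Z n) : EndZ n := transport (@cone_ractA K P Q M) cout_graded id_graded w.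

Lemma ev_zsec n (w : Z n) k (z : forall i, Z (k i)) : ev (zsec w) k z = ocomp R w (fun i => cout (z i)).
Proof. by []. Qed.

Lemma zsec_homog n a (w : Z n) : homog a w -> homog a (zsec w).
Proof. exact: transport_homog. Qed.

Lemma zsec0 n : zsec (0 : Z n) = 0.
Proof.
apply: End_eq => k z b hz; rewrite ev_zsec ocomp0.
by rewrite (lin0 (@ev_linear _ _ _ R n)).
Qed.

Lemma zsec_dgd n a (w : Z n) : homog a w -> dgd (zsec w) = zsec (dgd w).
Proof.
move=> hw; apply: End_eq => k z b hz.
rewrite ev_dgd (dfam_homog (ev_multi _) (ev_homog (zsec_homog hw)) hz) !ev_zsec.
have hr i : homog (b i) (cout (z i)) by case: (hz i).
rewrite (ocomp_dgd R hw hr) -addrA -[RHS]addr0; congr (_ + _); apply/eqP; rewrite subr_eq0; apply/eqP.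
apply: eq_bigr => i _; rewrite ev_zsec; congr (_ *: ocomp R w _).
by rewrite (dfwith_map (fun i => @cout K P Q M (k i))).
Qed.

Lemma tleft_zsec n (w : Z n) : ztleft (zsec w) = w.
Proof. by rewrite /tleft -[RHS](cone_ract1 w). Qed.

(** [cone_retr] sends [z] to [cone_one] acted on by [cout z], so by right linearity f (rho, .., rho)
    is determined by the value of f at (1, .., 1). Here the freeness of Q on one generator
    enters. *)
Lemma plug_cone_retr n (f : EndZ n) : plug_all (op_mul EndZ) cone_retr f = zsec (ztleft f).
Proof.
apply: End_lab_eq => k z b T e hz; rewrite ev_zsec.
have -> : ocomp R (ztleft f) (fun i => cout (z i)) = ev (f : End_smod R n) k (fun i => cin M (cout (z i))).
  rewrite (@tleft_ract K EndZ Q CB cone_one (cone_one_homog M)).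
  congr (ev f k _); apply: functional_extensionality_dep => i; exact: cone_tright.
apply: lab_trans; first exact: lab_ev_cast.
apply: lab_trans.
  exact: (lab_comp _ _ (fun=> cone_retr_homog) (fun i => hz (cast_ord (sum_ones n) i))).
rewrite blk_0 sg0 scale1r; apply: lab_ev => i.
apply: lab_trans; first exact: lab_End_of.
apply: (@lab_eq_refl_idx _ Z _ _ k (fun i => cin M (cout (z i))) e).
by rewrite cast_sum_ones.
Qed.

Lemma contraction a n (f : EndZ n) : homog a f -> is_cycle f ->
  dgd (homotopy cone_retr cone_htpy a f) = f - zsec (ztleft f).
Proof. by move=> hf f0; rewrite (homotopy_dgd cone_retr_homog cone_htpy_homog cone_htpy_dgd) // plug_cone_retr. Qed.

Lemma ztleft_smod : is_smod_morph ztleft.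
Proof. exact: (@tleft_smod K EndZ Q CB cone_one (@cone_one_homog K P Q M) (@cone_one_cycle K P Q M)). Qed.

Lemma ztleft_surj n i (w : Z n) : homog i w -> exists2 f : EndZ n, homog i f & ztleft f = w.
Proof. by move=> hw; exists (zsec w); [exact: zsec_homog | exact: tleft_zsec]. Qed.

Lemma ztleft_hqiso n : is_hqiso (@tleft K EndZ Q CB cone_one n).
Proof.
have tm := smod_morph_dg ztleft_smod n; have [tl th td] := tm.
apply: surj_hqiso => //; first exact: ztleft_surj.
move=> i f hf f0 tf0; have e := contraction hf f0; have hh := homog_homotopy cone_retr_homog cone_htpy_homog hf.
rewrite tf0 zsec0 subr0 in e; set u := homotopy _ _ _ _ in e hh.
(* [u] bounds [f], but its value at 1 is only a cycle. The correction removes this value and is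
   itself a cycle, as [ztleft f] vanishes. *)
exists (u - zsec (ztleft u)); split.
- by apply: homogB => //; apply: zsec_homog; apply: th.
- by rewrite (linB tl) tleft_zsec subrr.
by rewrite dgdB (zsec_dgd (th _ _ hh)) -td e tf0 zsec0 subr0.
Qed.

Hypothesis left_qiso : is_smod_qiso (fun n (p : P n) => tleft one p).
Hypothesis right_qiso : is_smod_qiso (fun n (q : Q n) => tright one q).

(** Two out of three: [cproj] restricts along [cin] to [tright]. *)
Lemma cproj_hqiso n : is_hqiso (@cproj n).
Proof.
apply: (hqiso_cancel_r (smod_morph_dg (cin_smod M) n) (smod_morph_dg (cproj_smod one_homog one_cycle) n)).
  exact: cin_hqiso.
have -> : (fun q : Q n => cproj (cin M q)) = (fun q : Q n => tright one q).
  by apply: functional_extensionality_dep => q; apply: cproj_cin.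
by apply/hqisoP; case: right_qiso.
Qed.

Lemma cproj_surj n i (m : M n) : homog i m -> exists2 z : Z n, homog i z & cproj z = m.
Proof.
move=> hm; exists (csec m); last exact: csecK.
by rewrite -[i]add0r; apply: (graded_homog csec_graded).
Qed.

Definition lift_rel n (p : P n) (f : EndZ n) := forall k (z : forall i, Z (k i)),
  cproj (ev (f : End_smod R n) k z) = ocomp (lact M) p (fun i => cproj (z i)).

Lemma lift_rel_homog n (p : P n) (f : EndZ n) :
  (forall k (z : forall i, Z (k i)) b, (forall i, homog (b i) (z i)) ->
    cproj (ev (f : End_smod R n) k z) = ocomp (lact M) p (fun i => cproj (z i))) -> lift_rel p f.
Proof.
move=> h k; apply: (multi_eq (V := fun i => Z (k i)) (W := M (\sum_(i < n) k i)%N)); last exact: h.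
- exact: (multilinear_post (V := fun i => Z (k i)) (@ev_multi _ _ _ R _ f k) (@cproj_linear _)).
- exact: (multilinear_coord (V := fun i => Z (k i)) (V' := fun i => M (k i))
    (@ocomp_multilinear _ _ _ _ (lact M) n k p) (fun i => @cproj_linear (k i))).
Qed.

Let cproj_dg n := smod_morph_dg (cproj_smod one_homog one_cycle) n.
Let cproj_act := smod_morph_act (cproj_smod one_homog one_cycle).
Let cproj_homog n i (z : Z n) : homog i z -> homog i (cproj z).
Proof. exact: dg_morph_homog (cproj_dg n) i z. Qed.

Fact lift_rel0 n : @lift_rel n 0 0.
Proof.
move=> k z; rewrite ocomp0 (lin0 (@ev_linear _ _ _ R n)) fam0E.
exact: (lin0 (@cproj_linear _)).
Qed.

Fact lift_rel_linear n a (p p' : P n) (f f' : EndZ n) :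
  lift_rel p f -> lift_rel p' f' -> lift_rel (a *: p + p') (a *: f + f').
Proof.
move=> e e' k z.
by rewrite comp_linear_l (@ev_linear _ _ _ R n) fam_linE cproj_linear e e'.
Qed.

Fact lift_rel_dgd n i (p : P n) (f : EndZ n) :
  homog i p -> homog i f -> lift_rel p f -> lift_rel (dgd p) (dgd f).
Proof.
move=> hp hf e; apply: lift_rel_homog => k z b hz.
have := congr1 (@dgd _ _) (e k z); rewrite -(dg_morph_dgd (cproj_dg _)) (ev_leibniz hf hz).
rewrite (ocomp_dgd (lact M) hp (fun i => cproj_homog (hz i))) (linD (@cproj_linear _)).
have -> : cproj (\sum_(j < n) sg K (pz i + \sum_(j' < n | (j' < j)%N) pz (b j')) *:
    ev (f : End_smod R n) k (dfwith z (dgd (z j)))) =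
  \sum_(j < n) sg K (pz i + \sum_(j' < n | (j' < j)%N) pz (b j')) *:
    ocomp (lact M) p (dfwith (fun j => cproj (z j)) (dgd (cproj (z j)))).
  rewrite (lin_sum (@cproj_linear _)); apply: eq_bigr => j _.
  rewrite (linZ (@cproj_linear _)) e; congr (_ *: ocomp _ p _).
  by rewrite (dfwith_map (fun i => @cproj (k i))) (dg_morph_dgd (cproj_dg _)).
exact: addIr.
Qed.

Fact lift_rel_sact n i (p : P n) (f : EndZ n) (s : 'S_n) :
  homog i p -> homog i f -> lift_rel p f -> lift_rel (sact p s) (sact f s).
Proof.
move=> hp hf e; apply: lift_rel_homog => k z b hz.
rewrite (ocomp_act_l (lact M) p s (fun i => cproj_homog (hz i))).
rewrite [ev _ _ _](sfam_homog s (@ev_multi _ _ _ R _ f) hz) (linZ (@cproj_linear _)) cproj_act.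
by rewrite (acast_fun (A := Z) cproj) e.
Qed.

Fact lift_rel_comp n (k : 'I_n -> nat) a b (p : P n) (f : EndZ n)
    (p' : forall i, P (k i)) (f' : forall i, EndZ (k i)) :
  homog a p -> homog a f -> lift_rel p f ->
  (forall i, homog (b i) (p' i)) -> (forall i, homog (b i) (f' i)) -> (forall i, lift_rel (p' i) (f' i)) ->
  lift_rel (ocomp (op_mul P) p p') (ocomp (op_mul EndZ) f f').
Proof.
move=> hp hf e hp' hf' e'; apply: lift_rel_homog => l z c hz.
rewrite [ev _ _ _](rcomp_homog (@ev_multi _ _ _ R _ f) hf' hz) (acast_fun (A := Z) cproj).
rewrite (linZ (@cproj_linear _)) e.
have E := iffLR (comp_assocP _ _ _ _) (@lactA K P Q M) n k l p p' (fun s => cproj (z s)) b c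
  hp' (fun s => cproj_homog (hz s)).
rewrite -[RHS](acastK (sum_blocks l) (esym (sum_blocks l))) E; congr (acast _ (_ *: ocomp _ p _)).
by apply: functional_extensionality_dep => i; apply: e'.
Qed.

Fact lift_rel_id : lift_rel (op_id P) (op_id EndZ).
Proof.
move=> k z; apply: (@lab_inj _ _ _ _ _ id) => //.
rewrite -[X in lab_eq _ X _ _](join_Rank (k := k)) -[X in lab_eq _ _ _ X](join_Rank (k := k)).
apply: lab_trans; first by apply: (lab_eq_fun (g := cproj)); [exact: cproj_smod | exact: lab_idfam].
rewrite -[X in lab_eq X](lact1 (cproj (z ord0))); apply: lab_trans; first exact: lab_plug_into.
apply: lab_ocomp => i; apply: (@lab_eq_refl_idx _ M _ _ k (fun i => cproj (z i)) (fun i j => tagnat.Rank i j)).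
by rewrite (ord1 i).
Qed.

Definition lift_op_rel : op_rel P EndZ := OpRel lift_rel0 lift_rel_linear lift_rel_dgd
  lift_rel_sact lift_rel_comp lift_rel_id.

Local Notation P' := (pull_operad lift_op_rel).

Lemma P'_rel n (x : P' n) k (z : forall i, Z (k i)) :
  cproj (ev (pull2 x : End_smod R n) k z) = ocomp (lact M) (pull1 x) (fun i => cproj (z i)).
Proof. exact: (@pull_rel _ _ _ lift_op_rel n x k z). Qed.

(** [cproj] maps [cone_one] to [one], so the relation evaluated at units compares evaluation in End
    with evaluation in P. This square gives [lift_End_hqiso]. *)
Lemma cproj_ztleft n (x : P' n) : cproj (ztleft (pull2 x)) = tleft one (pull1 x).
Proof.
rewrite /tleft /plug_all (acast_fun (A := Z) cproj); congr acast.
rewrite -[ocomp (lact CB) _ _]/(ev (pull2 x : End_smod R n) _ _) P'_rel; congr (ocomp _ _ _).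
by apply: functional_extensionality_dep => i; apply: cproj_one.
Qed.

(** The lift of p is s p (pi, .., pi) with s = [csec]. It need not commute with the differentials,
    but [surj_hqiso] asks for surjectivity in each degree only. *)
Lemma lift_surj n i (p : P n) : homog i p -> exists2 x : P' n, homog i x & pull1 x = p.
Proof.
move=> hp; pose f : EndZ n := transport (@lract K P Q M) cproj_graded csec_graded p.
have hf : homog i f by apply: transport_homog.
have [|x [hx ex _]] := @Pull_ex _ _ _ lift_op_rel n i p f hp hf; last by exists x.
by move=> k z; rewrite ev_transport csecK.
Qed.

(** The homotopy acts on the inputs of [f] only, so values in the kernel of [cproj] stay there. *)
Lemma cproj_homotopy a n (f : EndZ n) : homog a f ->
  (forall k (z : forall i, Z (k i)), cproj (ev (f : End_smod R n) k z) = 0) ->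
  forall k (z : forall i, Z (k i)),
    cproj (ev (homotopy cone_retr cone_htpy a f : End_smod R n) k z) = 0.
Proof.
move=> hf f0; have cl n := @cproj_linear n.
have main (i : 'I_n) : forall k (z : forall i, Z (k i)),
    cproj (ev (plug_fam f (htpy_step cone_retr cone_htpy i (n := n)) : End_smod R n) k z) = 0.
  move=> k; apply: (multi_eq (V := fun i => Z (k i)) (W := M (\sum_(i < n) k i)%N)
    (G := fun=> 0)).
  - exact: (multilinear_post (V := fun i => Z (k i)) (@ev_multi _ _ _ R _ _ k) (cl _)).
  - by move=> q j c u v; rewrite scaler0 addr0.
  move=> z b hz; have hs := htpy_step_homog cone_retr_homog cone_htpy_homog i.
  have := lab_comp f (fun x j => @Tagged _ (cast_ord (sum_ones n) x) (fun i => 'I_(k i)) j) hs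
    (fun i => hz (cast_ord (sum_ones n) i)).
  move/(lab_trans (lab_ev_cast _ _ _ (fun i => @Tagged _ i (fun i => 'I_(k i))))).
  move/(lab_eq_fun (cproj_smod one_homog one_cycle)).
  by rewrite (linZ (cl _)) f0 scaler0 => /lab_eq0.
move=> k z; rewrite /homotopy (@ev_scale _ _ _ R) (linZ (cl _)) (lin_sum (@ev_linear _ _ _ R n)).
rewrite fam_sum (lin_sum (cl _)) [X in _ *: X]big1 ?scaler0 // => i _.
exact: main.
Qed.

(** The kernel of [pull1] consists of the f with values in the kernel of [cproj]. A cycle f there is
    homotopic to [zsec] of its value at 1, a cycle of the acyclic complex ker [cproj], which
    therefore bounds. *)
Lemma lift_hqiso n : is_hqiso (@pull1 _ _ _ lift_op_rel n).
Proof.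
apply: surj_hqiso; [exact: pull1_morph | exact: lift_surj |].
move=> i x hx x0 xl0; have hf := pull2_homog hx.
have f0 : is_cycle (pull2 x).
  by rewrite /is_cycle -(dg_morph_dgd (@pull2_morph _ _ _ lift_op_rel n)) x0 (lin0 (@pull2_linear _ _ _ _ n)).
have pf k (z : forall i, Z (k i)) : cproj (ev (pull2 x : End_smod R n) k z) = 0.
  by rewrite P'_rel xl0 ocomp0.
have [tl th td] := smod_morph_dg ztleft_smod n.
have [||w [hw pw ew]] := hqiso_kernel (@cproj_hqiso n) (@cproj_surj n) (th _ _ hf).
- by rewrite /is_cycle -td f0 (lin0 tl).
- by rewrite cproj_ztleft xl0 (lin0 (@tleft_linear _ _ _ M one n)).
(* The homotopy bounds f - zsec (ztleft f), and [zsec w] bounds the rest. *)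
pose u : EndZ n := homotopy cone_retr cone_htpy i (pull2 x) + zsec w.
have hu : homog (i + 1) u.
  by apply: homogD; [apply: (homog_homotopy cone_retr_homog cone_htpy_homog) | apply: zsec_homog].
have [|y [hy yl yr]] := @Pull_ex _ _ _ lift_op_rel n (i + 1) 0 u (homog0 _ _) hu.
  move=> k z; rewrite (@evD _ _ _ R n) (linD (@cproj_linear _)) cproj_homotopy // add0r ocomp0.
  by rewrite ev_zsec cproj_comp pw ocomp0.
exists y; split=> //; apply: pull_eq.
  by rewrite (dg_morph_dgd (@pull1_morph _ _ _ _ n)) yl xl0 dgd0.
rewrite (dg_morph_dgd (@pull2_morph _ _ _ _ n)) yr dgdD contraction // (zsec_dgd hw) -ew.
by rewrite subrK.
Qed.

(** Two out of three: followed by the quasi-isomorphisms [ztleft] and [cproj], [pull2] becomes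
    [tleft] after [pull1], which is a quasi-isomorphism too. *)
Lemma lift_End_hqiso n : is_hqiso (@pull2 _ _ _ lift_op_rel n).
Proof.
have tm := smod_morph_dg ztleft_smod n.
apply: (hqiso_cancel_l (@pull2_morph _ _ _ lift_op_rel n) (is_dg_morph_comp tm (cproj_dg n))).
  exact: (hqiso_comp tm (cproj_dg n) (ztleft_hqiso n) (@cproj_hqiso n)).
have -> : (fun x : P' n => cproj (ztleft (pull2 x))) = (fun x : P' n => tleft one (pull1 x)).
  by apply: functional_extensionality_dep => x; apply: cproj_ztleft.
have lq : is_hqiso (@tleft _ _ _ M one n) by apply/hqisoP; case: left_qiso.
exact: (hqiso_comp (@pull1_morph _ _ _ _ n) (hqiso_morph lq) (@lift_hqiso n) lq).
Qed.

Lemma id_smod_qiso (A : smod K) : is_smod_qiso (fun n (x : A n) => x).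
Proof. by split=> // n; split=> // w w0; exists w => //; exists 0; rewrite subrr dgd0. Qed.

Lemma id_operad_qiso (O : operad K) : is_operad_qiso (fun n (x : O n) => x).
Proof. by split=> //; apply: id_smod_qiso. Qed.

Lemma quasi_torsor_zigzag : zigzag (Triple M) (Triple (operad_bimodule Q)).
Proof.
(* The triple (P', Z, Q), with P' acting on Z through its projection to End. *)
pose T' := Triple (restrict CB (pull2_operad lift_op_rel)).
apply: (@rst_trans _ _ _ T').
  apply: rst_sym; apply: rst_step.
  exists (@pull1 _ _ _ lift_op_rel), cproj, (fun n x => x).
  split=> /=.
  - have [h1 h2 h3] := pull1_operad lift_op_rel.
    by split=> //; split=> // n; apply/hqisoP/lift_hqiso.
  - exact: id_operad_qiso.
  - by split=> [|n]; [exact: cproj_smod | apply/hqisoP/cproj_hqiso].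
  - by move=> n k p q; apply: P'_rel.
  - by move=> n k p q; apply: cproj_comp.
apply: (@rst_trans _ _ _ (Triple CB)).
  apply: rst_step; exists (@pull2 _ _ _ lift_op_rel), (fun n x => x), (fun n x => x).
  split=> //=.
  - have [h1 h2 h3] := pull2_operad lift_op_rel.
    by split=> //; split=> // n; apply/hqisoP/lift_End_hqiso.
  - exact: id_operad_qiso.
  - exact: id_smod_qiso.
(* For the unit [cone_one], evaluation has the section [zsec] and the map from Q is [cin]. *)
apply: (@strict_torsor_zigzag _ _ _ CB cone_one (cone_one_homog M) (cone_one_cycle M)).
- by split=> [|n]; [exact: ztleft_smod | apply/hqisoP/ztleft_hqiso].
- split=> [|n].
    exact: (@tright_smod K EndZ Q CB cone_one (cone_one_homog M) (cone_one_cycle M)).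
  have -> : @tright _ _ _ CB cone_one n = @cin _ _ _ M n.
    by apply: functional_extensionality_dep => q; apply: cone_tright.
  by apply/hqisoP/cin_hqiso.
- by move=> n i w hw; apply: ztleft_surj.
Qed.
End ConeTorsor.

Theorem theorem2 (K : fieldType) (K_char0 : [pchar K] =i pred0)
  (P Q : operad K) (M : bimodule P Q) (M_quasi_torsor : quasi_torsor M) :
  zigzag (Triple M) (Triple (operad_bimodule Q)).
Proof.
have [one [one_homog lq rq]] := M_quasi_torsor.
(* [one] is the image under the chain map [tleft] of the operad unit, which is a cycle. *)
have one_cycle : is_cycle one.
  have [tl _ td] := smod_morph_dg (smod_qiso_morph lq) 1.
  by rewrite /is_cycle -(tleft_id one) -td op_id_cycle (lin0 tl).
exact: (quasi_torsor_zigzag one_homog one_cycle lq rq).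
Qed.
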